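(* Let $\lambda<0$ be a real constant. Then on each filtered probability space $(\Omega,\mathcal{F},(\mathcal{F}_t)_{t\geq 0},\mathbb{P})$ that supports a one-dimensional standard Brownian motion $W$ and a real-valued random variable $\zeta$ independent of $W$, there exists a solution $X$ of the equation $$\mathrm{d}X(t)=\lambda\,\mathrm{d}t+\mathbf{1}_{\{X(t)>0\}}\,\mathrm{d}W(t),\qquad 0\le t<\infty,$$ which satisfies $X(0)=\zeta$ and is adapted to the filtration $\big(\mathcal{F}^{(\zeta,W)}_t\big)_{t\ge 0}$ generated by $(\zeta,W)$. Moreover, $X$ is the unique process with these properties (up to indistinguishability), and the distribution of every weak solution to this equation with the same initial distribution (that is, the distribution of $\zeta$) coincides with the distribution of $X$.
   Context: The filtration generated by $(\zeta,W)$ is $\mathcal{F}^{(\zeta,W)}_t=\sigma(\zeta,\,W(s):0\le s\le t)$. A solution of the equation with $X(0)=\zeta$ and driving Brownian motion $W$ is an adapted process $X$ with continuous paths such that, with probability one, $X(t)=\zeta+\lambda t+\int_0^t\mathbf{1}_{\{X(s)>0\}}\,\mathrm{d}W(s)$ for all $t\ge 0$. A weak solution with initial distribution $\mu$ consists of some filtered probability space together with a continuous adapted process $Y$ and a standard Brownian motion $B$ relative to the filtration of that space, such that $Y(0)$ has distribution $\mu$ and, with probability one, $Y(t)=Y(0)+\lambda t+\int_0^t\mathbf{1}_{\{Y(s)>0\}}\,\mathrm{d}B(s)$ for all $t\ge0$. Its distribution is the law of $Y$ on $C([0,\infty);\mathbb{R})$. *)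

(* Defs.v *)
From HB Require Import structures.
From mathcomp Require Import all_boot all_order all_algebra.
From mathcomp Require Import all_classical all_reals all_analysis.

Set Implicit Arguments.
Unset Strict Implicit.
Unset Printing Implicit Defensive.

Import Order.TTheory GRing.Theory Num.Theory.
Import numFieldNormedType.Exports.

Local Open Scope classical_set_scope.
Local Open Scope ring_scope.

(* A process is a function X : R -> T -> R; only its values at times t >= 0
   matter, and every condition below is restricted to such times. The same
   holds for filtrations F : R -> set (set T). Neither completeness nor
   right-continuity is assumed of a filtration. *)
Section stochastic_processes.
Context d (T : measurableType d) (R : realType).
Implicit Types (P : probability T R) (F : R -> set (set T)) (X : R -> T -> R).

Definition filtration F :=
  (forall t, 0 <= t -> sigma_algebra setT (F t) /\ F t `<=` measurable) /\
  (forall s t, 0 <= s -> s <= t -> F s `<=` F t).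

Definition adapted F X :=
  forall t, 0 <= t -> g_sigma_algebra_preimage (X t) `<=` F t.

Definition continuous_paths X :=
  forall w, {within `[0, +oo[, continuous (X ^~ w)}.

Definition independent P (G H : set (set T)) :=
  forall A B, G A -> H B -> P (A `&` B) = (P A * P B)%E.

Definition sigma_process X : set (set T) :=
  <<s \bigcup_(s in `[0, +oo[) g_sigma_algebra_preimage (X s) >>.

Definition generated_filtration (zeta : T -> R) (W : R -> T -> R) :
    R -> set (set T) :=
  fun t => <<s g_sigma_algebra_preimage zeta `|`
               \bigcup_(s in `[0, t]) g_sigma_algebra_preimage (W s) >>.

Definition brownian_motion P F (W : R -> T -> R) :=
  [/\ adapted F W, continuous_paths W, {ae P, forall w, W 0 w = 0},
      (forall s t, 0 <= s -> s < t ->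
        independent P (g_sigma_algebra_preimage (W t \- W s)) (F s)) &
      (forall s t, 0 <= s -> s < t -> forall A, measurable A ->
        P ((W t \- W s) @^-1` A) = normal_prob 0 (Num.sqrt (t - s)) A)].

Definition indistinguishable P X X' :=
  {ae P, forall w, forall t, 0 <= t -> X t w = X' t w}.

(* sum over i < sp_size of sp_coef i * 1_(sp_time i, sp_time (i + 1)],
   with sp_coef i bounded and F (sp_time i)-measurable *)
Record simple_process F := SimpleProcess {
  sp_size : nat;
  sp_time : nat -> R;
  sp_coef : nat -> T -> R;
  sp_time_ge0 : 0 <= sp_time 0%N;
  sp_time_lt : forall i, (i < sp_size)%N -> sp_time i < sp_time i.+1;
  sp_coef_meas : forall i, (i < sp_size)%N ->
    g_sigma_algebra_preimage (sp_coef i) `<=` F (sp_time i);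
  sp_coef_bnd : exists C : R, forall i w, (i < sp_size)%N ->
    `|sp_coef i w| <= C }.

Definition sp_val F (S : simple_process F) (s : R) (w : T) : R :=
  \sum_(i < sp_size S) sp_coef S i w * \1_(`]sp_time S i, sp_time S i.+1]) s.

Definition sp_int F (S : simple_process F) (B : R -> T -> R) (t : R) (w : T) :
    R :=
  \sum_(i < sp_size S) sp_coef S i w *
    (B (Num.min (sp_time S i.+1) t) w - B (Num.min (sp_time S i) t) w).

(* I is a version with continuous paths of the Ito integral of H against the
   F-Brownian motion B: for each t, I t is the L^2(P)-limit of the integrals
   over [0, t] of simple processes that converge to H in L^2([0, t] x T). By
   the Ito isometry this limit does not depend on the approximating sequence,
   so I is determined up to indistinguishability. *)
Definition ito_integral P F (B H I : R -> T -> R) :=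
  [/\ continuous_paths I,
      (forall t, 0 <= t -> measurable_fun setT (I t)) &
      forall t, 0 <= t -> exists S : nat -> simple_process F,
        ((fun n => \int[P]_w \int[lebesgue_measure]_(s in `[0%R, t])
           ((sp_val (S n) s w - H s w) ^+ 2)%:E)%E @ \oo --> 0%E) /\
        ((fun n => \int[P]_w
           ((sp_int (S n) B t w - I t w) ^+ 2)%:E)%E @ \oo --> 0%E)].

Definition sde_solution P F (lambda : R) (zeta : T -> R) (B X : R -> T -> R) :=
  [/\ adapted F X, continuous_paths X &
      exists I : R -> T -> R,
        ito_integral P F B (fun s w => (0 < X s w)%R%:R) I /\
        {ae P, forall w, forall t, 0 <= t ->
          X t w = zeta w + lambda * t + I t w}].

Definition weak_solution P F (lambda : R) (mu : set R -> \bar R)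
    (Y B : R -> T -> R) :=
  [/\ filtration F, brownian_motion P F B, sde_solution P F lambda (Y 0) B Y &
      forall A, measurable A -> P (Y 0 @^-1` A) = mu A].

End stochastic_processes.

Section path_space.
Context (R : realType).

Definition halfline : set R := `[0, +oo[.

Definition path_space := continuousType halfline R.

(* The compact-open topology is that of uniform convergence on compact sets. *)
Definition path_borel : set (set path_space) :=
  <<s preimage_set_system setT
        (fun f : path_space => (f : {compact-open, halfline -> R})) open >>.

(* For X with continuous paths, this is the inverse image of A under the map
   that sends w to the path X ^~ w restricted to [0, +oo[. *)
Definition path_preimage (T : Type) (X : R -> T -> R) (A : set path_space) :
    set T :=
  [set w | exists2 f : path_space, A f &
                   forall t : halfline, f t = X (set_val t) w].

Definition same_path_law d (T : measurableType d) (P : probability T R)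
    d' (T' : measurableType d') (P' : probability T' R)
    (X : R -> T -> R) (X' : R -> T' -> R) :=
  forall A, path_borel A -> P (path_preimage X A) = P' (path_preimage X' A).

End path_space.

(* Main.v *)
Require Import Defs.
From HB Require Import structures.
From mathcomp Require Import all_boot all_order all_algebra.
From mathcomp Require Import all_classical all_reals all_analysis.
From mathcomp Require Import measurable_realfun ring lra.
Set Implicit Arguments.
Unset Strict Implicit.
Unset Printing Implicit Defensive.
Import Order.TTheory GRing.Theory Num.Theory.
Import numFieldNormedType.Exports.
Local Open Scope classical_set_scope.
Local Open Scope ring_scope.

(** Put [V t = W t - W 0] and [Z t = zeta + lambda * t + V t], and let [tau] be
    the time up to which [Z] stays positive. As [lambda < 0], the process
    [X t = zeta + lambda * t + V (min t tau)] never leaves the non-positive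
    half-line after [tau], so it solves the equation.

    Conversely, let [X] be a solution, [I] its stochastic integral, and [h t] the
    supremum of the [s <= t] such that [X] is positive on [[0, s]]. The Ito
    isometry, applied on finer and finer grids, shows that [I] is constant on
    intervals where [X <= 0] and that [V - I] is constant on intervals where
    [X > 0]. If [I t < I (h t)], let [q] be the last time in [[h t, t]] with
    [I q >= I (h t)]; then [X s <= X (h t) + lambda * (s - h t) <= 0] for
    [q < s <= t], so [I] is constant on [[q, t]], a contradiction. Thus
    [I t - I (h t)] is nonnegative; it is a limit of mean zero elementary integrals
    bounded in L^2, so it vanishes almost surely. Hence [I t = V (h t)], and [X] is
    given by the formula above.

    So every solution, on any probability space, is almost surely the same
    functional of [zeta] and [V]. This gives uniqueness, and also equality of the
    laws, because the joint law of [(zeta, V)] is determined by the law of [zeta]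
    and the independent Gaussian increments of [V]. *)

(** * Independence and moments *)

(** The integrand jumps at the level 0, the filtration is neither complete nor right-continuous, and
    the Ito integral is known only as an L^2-limit at each fixed time. So [h] is never treated as a
    stopping time. It enters through the events that a path is positive on [[a, s]], which lie in
    [F s], and through left-point sums over a grid in which such an event switches each increment
    on. These sums telescope, and their integrands differ from the wanted indicator within one cell
    only, so the isometry leaves an error of the order of the mesh. The same device gives both
    constancy statements, the measurability of the explicit solution and the value of its Ito
    integral. The comparison of [I t] with [I (h t)] is pathwise and involves uncountably many
    times; it starts from almost sure facts at pairs of rational times, which are countable, and
    continuity of the paths supplies the others. Fatou's lemma for rescaled squares takes the place
    of optional stopping. *)

Section independence_expectation.
Context d (T : measurableType d) (R : realType) (P : probability T R).
Local Open Scope ereal_scope.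

(** The joint law of [U] and [V] is the product of their laws, because the two agree on rectangles;
    Tonelli then yields integrability of the product and Fubini its integral. *)
Lemma integral_mul_independent (U V : T -> R) :
  measurable_fun setT U -> measurable_fun setT V ->
  (forall A B, measurable A -> measurable B ->
     P (U @^-1` A `&` V @^-1` B) = P (U @^-1` A) * P (V @^-1` B)) ->
  P.-integrable setT (EFin \o U) -> P.-integrable setT (EFin \o V) ->
  \int[P]_w (U w * V w)%:E = (\int[P]_w (U w)%:E) * (\int[P]_w (V w)%:E).
Proof.
move=> mU mV UV iU iV.
have mUV : measurable_fun setT (fun w => (U w, V w)) by exact/measurable_fun_pair.
pose u : {mfun T >-> R} := mfun_Sub (mem_set mU).
pose v : {mfun T >-> R} := mfun_Sub (mem_set mV).
pose m1 : probability _ R := distribution P u.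
pose m2 : probability _ R := distribution P v.
pose Q := pushforward P (fun w => (U w, V w)).
have QE A : measurable A -> (m1 \x m2) A = Q A.
  apply: product_measure_unique => B C mB mC.
  by rewrite /Q /pushforward /= -UV//.
have QI (f : R * R -> \bar R) : \int[Q]_z f z = \int[m1 \x m2]_z f z.
  by rewrite /Q; apply: eq_measure_integral => A mA _; exact/esym/QE.
have mmul : measurable_fun [set: R * R] (EFin \o (fun z : R * R => z.1 * z.2)%R).
  by apply/measurable_EFinP/measurable_funM.
have int1 : m1.-integrable setT EFin.
  apply: integrable_pushforward => //.
have int2 : m2.-integrable setT EFin.
  apply: integrable_pushforward => //.
have E1 : \int[m1]_x x%:E = \int[P]_w (U w)%:E.
  by rewrite /m1 /distribution integral_pushforward.
have E2 : \int[m2]_x x%:E = \int[P]_w (V w)%:E.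
  by rewrite /m2 /distribution integral_pushforward.
have fin1 : \int[P]_w (U w)%:E \is a fin_num by exact: integrable_fin_num.
have fin2 : \int[P]_w (V w)%:E \is a fin_num by exact: integrable_fin_num.
have imul : (m1 \x m2).-integrable setT (fun z : R * R => (z.1 * z.2)%:E).
  apply/integrable12ltyP => //=.
  under eq_integral do under eq_integral do rewrite normrM EFinM.
  have mabs : measurable_fun [set: R] (EFin \o (fun y : R => `|y|)%R).
    by apply/measurable_EFinP/measurableT_comp.
  under eq_integral do rewrite ge0_integralZl//.
  have fin3 : \int[m2]_y `|y|%:E < +oo by case/integrableP: int2.
  have fin4 : \int[m1]_y `|y|%:E < +oo by case/integrableP: int1.
  have ge3 : 0 <= \int[m2]_y `|y|%:E by exact: integral_ge0.
  have ge4 : 0 <= \int[m1]_y `|y|%:E by exact: integral_ge0.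
  rewrite ge0_integralZr//=.
  by apply: lte_mul_pinfty => //; rewrite ge0_fin_numE.
have imulP : P.-integrable setT (fun w => (U w * V w)%:E).
  apply/integrableP; split; first by apply/measurable_EFinP; exact: measurable_funM.
  have mam : measurable_fun [set: R * R] (abse \o (EFin \o (fun z : R * R => z.1 * z.2)%R)).
    exact: measurableT_comp.
  have := ge0_integral_pushforward mUV P measurableT mam.
  rewrite preimage_setT -/Q QI => <-; last by move=> y _; exact: abse_ge0.
  by case/integrableP: imul.
have -> : \int[P]_w (U w * V w)%:E = \int[Q]_z (z.1 * z.2)%:E.
  by rewrite /Q integral_pushforward.
rewrite -/Q QI.
rewrite -integral12_prod_meas1// /fubini_F /=.
under eq_integral.
  move=> x _; under eq_integral do rewrite EFinM.
  rewrite integralZl// E2 -(fineK fin2); over.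
by rewrite integralZr// ?E1 fineK.
Qed.
End independence_expectation.

Section normal_moments.
Context (R : realType).
Local Open Scope ereal_scope.
Local Notation mu := (@lebesgue_measure R).

(** The Radon-Nikodym derivative of [normal_prob 0 s] and the function [normal_pdf 0 s] have the
    same integral over every measurable set, hence agree almost everywhere. *)
Lemma ge0_integral_normal_prob (s : R) (f : R -> \bar R) :
  (forall x, 0 <= f x) -> measurable_fun setT f ->
  \int[normal_prob 0 s]_x f x = \int[mu]_x (f x * (normal_pdf 0 s x)%:E).
Proof.
move=> f0 mf.
pose pr : probability _ R := normal_prob 0 s.
pose nu : {finite_measure set _ -> \bar R} := pr.
have dom : nu `<< mu by exact: normal_prob_dominates.
rewrite -(Radon_Nikodym_SigmaFinite.change_of_variables dom)//.
have ae : ae_eq mu setT (Radon_Nikodym_SigmaFinite.f nu mu)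
    (fun x => (normal_pdf 0 s x)%:E).
  apply: integral_ae_eq => //.
  - exact: Radon_Nikodym_SigmaFinite.f_integrable.
  - by apply/measurable_EFinP; exact: measurable_normal_pdf.
  - by move=> E _ mE; rewrite -Radon_Nikodym_SigmaFinite.f_integral.
apply: ae_eq_integral => //.
- apply: emeasurable_funM => //.
  by have /measurable_int := Radon_Nikodym_SigmaFinite.f_integrable dom.
- apply: emeasurable_funM => //.
  by apply/measurable_EFinP; exact: measurable_normal_pdf.
- exact: ae_eqe_mul2l.
Qed.

(* Only its finiteness matters here, not that it equals 1. *)
Definition normal_moment2 : \bar R := \int[normal_prob 0 1]_x (x ^+ 2)%:E.

Lemma normal_moment2_scale (s : R) : (0 < s)%R ->
  \int[normal_prob 0 s]_x (x ^+ 2)%:E = (s ^+ 2)%:E * normal_moment2.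
Proof.
move=> s0.
have msqr : measurable_fun [set: R] (EFin \o (fun x : R => x ^+ 2)%R).
  by apply/measurable_EFinP; exact: measurable_funX.
rewrite /normal_moment2 !ge0_integral_normal_prob//; last 2 first.
  by move=> x; rewrite lee_fin sqr_ge0.
  by move=> x; rewrite lee_fin sqr_ge0.
rewrite -ge0_integralZl//; last 3 first.
- apply: emeasurable_funM => //.
  by apply/measurable_EFinP; exact: measurable_normal_pdf.
- by move=> x _; rewrite mule_ge0// lee_fin ?sqr_ge0 ?normal_pdf_ge0.
- by rewrite lee_fin sqr_ge0.
under eq_integral do rewrite -EFinM.
have dE : [eta *%R s]^`()%classic = cst s.
  apply/funext => x; rewrite derive1E deriveM// derive_id derive_cst scaler0 addr0.
  by rewrite /GRing.scale/= mulr1.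
rewrite (@increasing_ge0_integration_by_substitutionT _ (fun x => s * x)%R); last first.
- by move=> x; rewrite mulr_ge0 ?sqr_ge0 ?normal_pdf_ge0.
- move=> x; apply: cvgM; first exact: sqr_continuous.
  by apply: continuous_normal_pdf; rewrite gt_eqF.
- exact/gt0_cvgMry.
- exact/gt0_cvgMrNy.
- by move=> x; exact: derivableM.
- by rewrite dE; exact: is_cvg_cst.
- by rewrite dE; exact: is_cvg_cst.
- by rewrite dE => ?; exact: cvg_cst.
- by move=> x y; rewrite ltr_pM2l.
apply: eq_integral => x _; congr (_%:E); rewrite /= !fctE dE/=.
rewrite !normal_pdfE ?gt_eqF//.
rewrite /normal_peak /normal_fun !subr0 exprMn expr1n mul1r -mulrnAr sqrtrM ?sqr_ge0//.
rewrite sqrtr_sqr gtr0_norm// invfM.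
have -> : (- (s ^+ 2 * x ^+ 2) / (s ^+ 2 *+ 2) = - x ^+ 2 / (1 *+ 2))%R.
  have s2 : s != 0%R by rewrite gt_eqF.
  by rewrite -[(s ^+ 2 *+ 2)%R]mulr_natr -mulrN -mulf_div divff ?mul1r ?sqrf_eq0.
have key (a b c : R) : (s ^+ 2 * a * (s^-1 * b * c) * s = s ^+ 2 * (a * (b * c)))%R.
  by field; rewrite gt_eqF.
exact: key.
Qed.

Lemma normal_moment2_fin : normal_moment2 \is a fin_num.
Proof.
rewrite ge0_fin_numE; last by apply: integral_ge0 => x _; rewrite lee_fin sqr_ge0.
set q : R := Num.sqrt 2.
have q2 : (q ^+ 2 = 2)%R by rewrite sqr_sqrtr.
have q0 : (0 < q)%R by rewrite sqrtr_gt0.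
(* [x ^ 2 * exp (- x ^ 2 / 2) <= 4 * exp (- x ^ 2 / 4)] and the right-hand side is
   a multiple of the density of variance 2. *)
pose C : R := (4 * normal_peak 1 / normal_peak q)%R.
have C0 : (0 <= C)%R by rewrite !mulr_ge0 ?invr_ge0 ?normal_peak_ge0.
have mpdf (s : R) : measurable_fun [set: R] (EFin \o normal_pdf 0 s).
  by apply/measurable_EFinP; exact: measurable_normal_pdf.
have msqr : measurable_fun [set: R] (EFin \o (fun x : R => x ^+ 2)%R).
  by apply/measurable_EFinP; exact: measurable_funX.
rewrite /normal_moment2 ge0_integral_normal_prob//; last first.
  by move=> x; rewrite lee_fin sqr_ge0.
apply: (@le_lt_trans _ _ (\int[mu]_x (C%:E * (normal_pdf 0 q x)%:E))); last first.
  rewrite ge0_integralZl//; [|exact: mpdf|by move=> x _; rewrite lee_fin normal_pdf_ge0].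
  by rewrite integral_normal_pdf mule1 ltry.
apply: (@ge0_le_integral _ _ R mu) => //.
- by move=> x _; rewrite mule_ge0// lee_fin ?sqr_ge0 ?normal_pdf_ge0.
- by apply: emeasurable_funM => //; exact: mpdf.
- by apply: emeasurable_funM => //; exact: mpdf.
move=> x _; rewrite -!EFinM lee_fin !normal_pdfE ?gt_eqF// /normal_fun !subr0 q2.
have CE a : (C * (normal_peak q * a) = normal_peak 1 * (4 * a))%R.
  have : normal_peak q != 0%R by rewrite gt_eqF// normal_peak_gt0// gt_eqF.
  by rewrite /C; move: (normal_peak q) (normal_peak 1) => k l k0; field.
rewrite CE mulrCA ler_wpM2l ?normal_peak_ge0// expr1n.
set u : R := (x ^+ 2 / 4)%R.
have -> : (- x ^+ 2 / (1 *+ 2) = - u - u)%R by rewrite /u -mulr_natr; field.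
have -> : (- x ^+ 2 / (2 *+ 2) = - u)%R by rewrite /u -mulr_natr; field.
have -> : (x ^+ 2 = 4 * u)%R by rewrite /u; field.
have ue : (u * expR (- u) <= 1)%R.
  rewrite expRN ler_pdivrMr ?expR_gt0// mul1r.
  by apply: le_trans (expR_ge1Dx _); rewrite lerDr.
rewrite expRD; move: (expR _) (expR_ge0 (- u)) ue => e e0 ue.
by nra.
Qed.

Lemma normal_prob_sym (s : R) (A : set (measurableTypeR R)) : (0 < s)%R -> measurable A ->
  normal_prob 0 s (-%R @^-1` A) = normal_prob 0 s A.
Proof.
move=> s0 mA; rewrite /normal_prob.
have mN : measurable_fun [set: measurableTypeR R] (-%R : _ -> measurableTypeR R).
  exact: oppr_measurable.
have mf : measurable_fun A (EFin \o normal_pdf 0 s).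
  by apply/measurable_funTS/measurable_EFinP; exact: measurable_normal_pdf.
have f0 : {in A, forall y, 0 <= (EFin \o normal_pdf 0 s) y}.
  by move=> x _; rewrite lee_fin normal_pdf_ge0.
transitivity (\int[pushforward mu (-%R : _ -> measurableTypeR R)]_(x in A)
    (EFin \o normal_pdf 0 s) x); last first.
  by apply: eq_measure_integral => B mB _; exact: lebesgue_measureN.
rewrite (ge0_integral_pushforward mN mu mA mf f0).
apply: eq_integral => x _; congr (_%:E).
by rewrite !normal_pdfE ?gt_eqF// /normal_fun !subr0 sqrrN.
Qed.

End normal_moments.

(* Measurability with respect to the sigma-algebra generated by [S], for an [S]
   that need not be the sigma-algebra carried by [T]. *)
Definition smeas (T : pointedType) (R : realType) (S : set (set T)) (f : T -> R) :=
  measurable_fun [set: g_sigma_algebraType S] (f : g_sigma_algebraType S -> R).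

Section smeas_theory.
Context (T : pointedType) (R : realType).
Implicit Types (S : set (set T)) (f : T -> R).

Lemma smeasP S f : sigma_algebra setT S ->
  smeas S f <-> g_sigma_algebra_preimage f `<=` S.
Proof.
move=> sS; split=> [mf _ [B mB <-]|fS _ B mB].
  by rewrite -(sigma_algebra_id sS); exact: (mf measurableT B mB).
rewrite /measurable /=; apply: sub_sigma_algebra; apply: fS.
by exists B.
Qed.

Lemma sub_smeas S S' f : S `<=` <<s S' >> -> smeas S f -> smeas S' f.
Proof.
move=> SS' mf _ B mB; have := mf measurableT B mB.
by apply: smallest_sub => //; exact: smallest_sigma_algebra.
Qed.

Lemma smeas_indic S (A : set T) : <<s S >> A -> smeas S (\1_A : T -> R).
Proof. by move=> SA; exact: (@measurable_indic _ (g_sigma_algebraType S)). Qed.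

End smeas_theory.

Lemma smeas_measurable d (T : measurableType d) (R : realType) (S : set (set T))
    (f : T -> R) : S `<=` measurable -> smeas S f -> measurable_fun setT f.
Proof.
move=> Sm mf _ B mB; have := mf measurableT B mB.
apply: smallest_sub => //; exact: sigma_algebra_measurable.
Qed.

Section square_integrable.
Context d (T : measurableType d) (R : realType) (P : probability T R).
Local Open Scope ereal_scope.

Definition sqint (f : T -> R) :=
  measurable_fun setT f /\ \int[P]_w ((f w) ^+ 2)%:E < +oo.

Lemma measurable_sqr (f : T -> R) : measurable_fun setT f ->
  measurable_fun setT (fun w => ((f w) ^+ 2)%:E).
Proof. by move=> mf; apply/measurable_EFinP; exact: measurable_funX. Qed.

Lemma sqint_sqr (f : T -> R) : sqint f -> P.-integrable setT (fun w => ((f w) ^+ 2)%:E).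
Proof.
move=> [mf fi]; apply/integrableP; split; first exact: measurable_sqr.
by under eq_integral do rewrite gee0_abs ?lee_fin ?sqr_ge0//.
Qed.

Lemma sqint_mul (f g : T -> R) : sqint f -> sqint g ->
  P.-integrable setT (fun w => (f w * g w)%:E).
Proof.
move=> f2 g2; have [mf _] := f2; have [mg _] := g2.
have i2 : P.-integrable setT (fun w => ((f w) ^+ 2 + (g w) ^+ 2)%:E).
  exact: (integrableD measurableT (sqint_sqr f2) (sqint_sqr g2)).
apply: (le_integrable measurableT _ _ i2).
  by apply/measurable_EFinP; exact: measurable_funM.
move=> w _ /=; rewrite lee_fin [leRHS]ger0_norm ?addr_ge0 ?sqr_ge0//.
rewrite normrM -(real_normK (num_real (f w))) -(real_normK (num_real (g w))).
move: `|f w|%R `|g w|%R (normr_ge0 (f w)) (normr_ge0 (g w)) => a b a0 b0.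
nra.
Qed.

Lemma sqint_cst (k : R) : sqint (cst k).
Proof.
split=> //; apply: integrable_lty => //.
exact: (finite_measure_integrable_cst P (k ^+ 2)).
Qed.

Lemma sqint_integrable (f : T -> R) : sqint f -> P.-integrable setT (EFin \o f).
Proof.
move=> f2; have := sqint_mul f2 (sqint_cst 1).
by apply: eq_integrable => // w _; rewrite /= mulr1.
Qed.

Lemma sqintD (f g : T -> R) : sqint f -> sqint g -> sqint (f \+ g)%R.
Proof.
move=> f2 g2; have [mf _] := f2; have [mg _] := g2.
split; first exact: measurable_funD.
have ifg : P.-integrable setT (fun w => (2 * (f w) ^+ 2 + 2 * (g w) ^+ 2)%:E).
  have i2 (h : T -> R) : sqint h -> P.-integrable setT (fun w => (2 * (h w) ^+ 2)%:E).
    by move=> h2; exact: (integrableZl measurableT 2 (sqint_sqr h2)).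
  exact: (integrableD measurableT (i2 _ f2) (i2 _ g2)).
apply: le_lt_trans (integrable_lty _ ifg) => //.
apply: ge0_le_integral => //.
- by move=> w _; rewrite lee_fin sqr_ge0.
- by apply: measurable_sqr; exact: measurable_funD.
- by case/integrableP: ifg.
- move=> w _; rewrite lee_fin /=; have := sqr_ge0 (f w - g w)%R.
  move: (f w) (g w) => a b; nra.
Qed.

Lemma sqint_bounded (f h : T -> R) (C : R) : measurable_fun setT h ->
  (forall w, `|h w| <= C)%R -> sqint f -> sqint (fun w => h w * f w)%R.
Proof.
move=> mh hC f2; have [mf f2oo] := f2; split; first exact: measurable_funM.
have ifg : P.-integrable setT (fun w => (C ^+ 2 * (f w) ^+ 2)%:E).
  exact: (integrableZl measurableT (C ^+ 2) (sqint_sqr f2)).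
apply: le_lt_trans (integrable_lty _ ifg) => //.
apply: ge0_le_integral => //.
- by move=> w _; rewrite lee_fin sqr_ge0.
- by apply: measurable_sqr; exact: measurable_funM.
- by case/integrableP: ifg.
- move=> w _; rewrite lee_fin exprMn ler_wpM2r ?sqr_ge0//.
  by rewrite -real_normK ?num_real// lerXn2r ?nnegrE ?(le_trans _ (hC w)).
Qed.

Lemma bounded_sqint (h : T -> R) (C : R) : measurable_fun setT h ->
  (forall w, `|h w| <= C)%R -> sqint h.
Proof.
move=> mh hC; have := sqint_bounded mh hC (sqint_cst 1).
by under eq_fun do rewrite mulr1.
Qed.

Lemma sqint_sum (I : Type) (s : seq I) (f : I -> T -> R) :
  (forall i, sqint (f i)) -> sqint (fun w => \sum_(i <- s) f i w)%R.
Proof.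
move=> f2; elim: s => [|i s ih].
  by under eq_fun do rewrite big_nil; exact: (sqint_cst 0).
by under eq_fun do rewrite big_cons; exact: sqintD.
Qed.

End square_integrable.

Section brownian_increments.
Context d (T : measurableType d) (R : realType) (P : probability T R).
Variables (F : R -> set (set T)) (B : R -> T -> R).
Hypotheses (hF : filtration F) (hB : brownian_motion P F B).
Local Open Scope ereal_scope.

Lemma filtration_sigma t : (0 <= t)%R -> sigma_algebra setT (F t).
Proof. by move=> t0; have [/(_ _ t0)[]] := hF. Qed.

Lemma filtration_sub t : (0 <= t)%R -> F t `<=` measurable.
Proof. by move=> t0; have [/(_ _ t0)[]] := hF. Qed.

Lemma filtration_smeas s t (f : T -> R) : (0 <= s)%R -> (s <= t)%R ->
  smeas (F s) f -> smeas (F t) f.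
Proof.
move=> s0 st; apply: sub_smeas => A FA; apply: sub_sigma_algebra.
by have [_ /(_ _ _ s0 st)] := hF; exact.
Qed.

Lemma filtration_measurable t (f : T -> R) : (0 <= t)%R ->
  smeas (F t) f -> measurable_fun setT f.
Proof. by move=> t0; apply: smeas_measurable; exact: filtration_sub. Qed.

Lemma brownian_smeas t : (0 <= t)%R -> smeas (F t) (B t).
Proof.
by case: hB => aB _ _ _ _ t0; apply/smeasP; [exact: filtration_sigma|exact: aB].
Qed.

Lemma brownian_measurable t : (0 <= t)%R -> measurable_fun setT (B t).
Proof. by move=> t0; apply: (filtration_measurable t0); exact: brownian_smeas. Qed.

Lemma increment_measurable s t : (0 <= s)%R -> (s <= t)%R ->
  measurable_fun setT (B t \- B s)%R.
Proof.
move=> s0 st.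
by apply: measurable_funB; apply: brownian_measurable => //; exact: le_trans st.
Qed.

Lemma increment_smeas s t : (0 <= s)%R -> (s <= t)%R -> smeas (F t) (B t \- B s)%R.
Proof.
move=> s0 st; have t0 := le_trans s0 st.
apply: measurable_funB; first exact: brownian_smeas.
exact: filtration_smeas st (brownian_smeas s0).
Qed.

Lemma increment_ge0_integral s t (f : measurableTypeR R -> \bar R) : (0 <= s)%R -> (s < t)%R ->
  (forall x, 0 <= f x) -> measurable_fun setT f ->
  \int[P]_w f (B t w - B s w)%R = \int[normal_prob 0 (Num.sqrt (t - s))]_x f x.
Proof.
move=> s0 st f0 mf; have [_ _ _ _ lawB] := hB.
have mD : measurable_fun setT ((B t \- B s)%R : T -> measurableTypeR R).
  exact: increment_measurable s0 (ltW st).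
have := ge0_integral_pushforward mD P measurableT mf (fun x _ => f0 x).
rewrite preimage_setT => /= <-.
by apply: eq_measure_integral => A mA _; exact: lawB.
Qed.

Definition moment2 : R := fine (@normal_moment2 R).

Lemma moment2_ge0 : (0 <= moment2)%R.
Proof.
by rewrite fine_ge0//; apply: integral_ge0 => x _; rewrite lee_fin sqr_ge0.
Qed.

Lemma increment_sqr s t : (0 <= s)%R -> (s <= t)%R ->
  \int[P]_w ((B t w - B s w) ^+ 2)%:E = (moment2 * (t - s))%:E.
Proof.
move=> s0; rewrite le_eqVlt => /predU1P[->|st].
  under eq_integral do rewrite subrr expr0n/=.
  by rewrite integral0 subrr mulr0.
rewrite (increment_ge0_integral s0 st (f := fun x => (x ^+ 2)%:E)).
- rewrite normal_moment2_scale ?sqrtr_gt0 ?subr_gt0// sqr_sqrtr ?subr_ge0 1?ltW//.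
  by rewrite -(fineK (@normal_moment2_fin R)) -EFinM mulrC.
- by move=> x; rewrite lee_fin sqr_ge0.
- by apply/measurable_EFinP; exact: measurable_funX.
Qed.

Lemma increment_sqint s t : (0 <= s)%R -> (s <= t)%R -> sqint P (B t \- B s)%R.
Proof.
by move=> s0 st; split; [exact: increment_measurable|rewrite increment_sqr// ltry].
Qed.

(** By the symmetry of the centred normal law, the positive and the negative part of the increment
    have the same integral, which is finite by square integrability. *)
Lemma increment_mean0 s t : (0 <= s)%R -> (s <= t)%R ->
  \int[P]_w (B t w - B s w)%:E = 0.
Proof.
move=> s0; rewrite le_eqVlt => /predU1P[->|st].
  by under eq_integral do rewrite subrr; rewrite integral0.
pose N := normal_prob 0 (Num.sqrt (t - s)).
have sq0 : (0 < Num.sqrt (t - s))%R by rewrite sqrtr_gt0 subr_gt0.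
have iD := sqint_integrable (increment_sqint s0 (ltW st)).
rewrite integralE.
suff -> : \int[P]_w (fun w => (B t w - B s w)%:E)^\- w =
          \int[P]_w (fun w => (B t w - B s w)%:E)^\+ w.
  rewrite subee//; exact: (integrable_pos_fin_num measurableT iD).
pose g x : \bar R := maxe x%:E 0.
have mg : measurable_fun [set: R] g.
  by apply: measurable_maxe => //; exact/measurable_EFinP.
have g0 x : 0 <= g x by rewrite /g le_max lexx orbT.
transitivity (\int[N]_x g (- x)%R).
  rewrite -(increment_ge0_integral s0 st (f := fun x => g (- x)%R))//.
    by apply: eq_integral => w _; rewrite /g /= funenegE EFinN.
  exact: (measurableT_comp mg (@oppr_measurable R setT)).
transitivity (\int[N]_x g x); last first.
  rewrite -(increment_ge0_integral s0 st (f := g))//.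
  by apply: eq_integral => w _; rewrite /g /= funeposE.
have mN : measurable_fun [set: measurableTypeR R] (-%R : _ -> measurableTypeR R).
  exact: oppr_measurable.
have := ge0_integral_pushforward mN N measurableT mg (fun x _ => g0 x).
rewrite preimage_setT /= => <-.
by apply: eq_measure_integral => A mA _; exact: normal_prob_sym.
Qed.

Lemma increment_indep s t (Z : T -> R) (C D : set R) : (0 <= s)%R -> (s < t)%R ->
  smeas (F s) Z -> measurable C -> measurable D ->
  P (Z @^-1` C `&` (B t \- B s)%R @^-1` D) = P (Z @^-1` C) * P ((B t \- B s)%R @^-1` D).
Proof.
move=> s0 st mZ mC mD; have [_ _ _ indB _] := hB.
rewrite setIC muleC; apply: (indB _ _ s0 st); first by exists D => //; rewrite setTI.
move/(smeasP _ (filtration_sigma s0)): mZ; apply.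
by exists C => //; rewrite setTI.
Qed.

Lemma increment_orth s t (Z : T -> R) : (0 <= s)%R -> (s <= t)%R ->
  smeas (F s) Z -> sqint P Z -> \int[P]_w (Z w * (B t w - B s w))%:E = 0.
Proof.
move=> s0; rewrite le_eqVlt => /predU1P[->|st] mZ Z2.
  by under eq_integral do rewrite subrr mulr0; rewrite integral0.
have [mZ' _] := Z2.
rewrite (integral_mul_independent mZ' (increment_measurable s0 (ltW st))).
- by rewrite (increment_mean0 s0 (ltW st)) mule0.
- by move=> C D mC mD; exact: increment_indep.
- exact: sqint_integrable.
- exact/sqint_integrable/increment_sqint/ltW.
Qed.

Lemma increment_sqr_indep s t (Z : T -> R) : (0 <= s)%R -> (s <= t)%R ->
  smeas (F s) Z -> sqint P Z ->
  \int[P]_w (Z w * (B t w - B s w) ^+ 2)%:E =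
  (\int[P]_w (Z w)%:E) * (moment2 * (t - s))%:E.
Proof.
move=> s0; rewrite le_eqVlt => /predU1P[->|st] mZ Z2.
  by under eq_integral do rewrite subrr expr0n mulr0; rewrite integral0 subrr mulr0 mule0.
have [mZ' _] := Z2; have mD := increment_measurable s0 (ltW st).
rewrite (integral_mul_independent mZ' (V := fun w => ((B t w - B s w) ^+ 2)%R)).
- by rewrite increment_sqr// ltW.
- exact: measurable_funX.
- move=> C D mC mD'.
  rewrite (_ : (fun w => ((B t w - B s w) ^+ 2)%R) @^-1` D =
    (B t \- B s)%R @^-1` ((fun x => x ^+ 2)%R @^-1` D)) //.
  apply: increment_indep => //; rewrite -[X in measurable X]setTI.
  exact: (measurable_funX 2 (@measurable_id _ _ setT)).
- exact: sqint_integrable.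
- exact: (sqint_sqr (increment_sqint s0 (ltW st))).
Qed.

End brownian_increments.

(** * Elementary integrands and the isometry *)

Section elementary.
Context (T : pointedType) (R : realType).

(* Unlike in [simple_process], the intervals ]el_lo i, el_hi i] may overlap and
   need not be ordered, so that sums and products require no common refinement. *)
Record elementary (F : R -> set (set T)) := Elementary {
  el_ix : finType;
  el_co : el_ix -> T -> R;
  el_lo : el_ix -> R;
  el_hi : el_ix -> R;
  el_lo_ge0 : forall i, 0 <= el_lo i;
  el_lo_hi : forall i, el_lo i <= el_hi i;
  el_co_smeas : forall i, smeas (F (el_lo i)) (el_co i);
  el_co_bnd : exists C : R, forall i w, `|el_co i w| <= C }.

Arguments el_co {F} e i.
Arguments el_lo {F} e i.
Arguments el_hi {F} e i.
Arguments el_co_bnd {F} e.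

Variable F : R -> set (set T).
Implicit Types (E : elementary F) (N : R -> T -> R).

Definition el_val E (r : R) (w : T) : R :=
  \sum_i el_co E i w * \1_(`]el_lo E i, el_hi E i]) r.

Definition el_int E N (w : T) : R :=
  \sum_i el_co E i w * (N (el_hi E i) w - N (el_lo E i) w).

End elementary.
Arguments el_co {T R F} e i.
Arguments el_lo {T R F} e i.
Arguments el_hi {T R F} e i.
Arguments el_co_bnd {T R F} e.
Arguments el_lo_ge0 {T R F} e i.
Arguments el_lo_hi {T R F} e i.
Arguments el_co_smeas {T R F} e i.

Section brownian_isometry.
Context d (T : measurableType d) (R : realType) (P : probability T R).
Variables (F : R -> set (set T)) (B : R -> T -> R).
Hypotheses (hF : filtration F) (hB : brownian_motion P F B).
Local Open Scope ereal_scope.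

Lemma bounded_mul_sqint (f h : T -> R) (t C : R) : (0 <= t)%R ->
  smeas (F t) h -> (forall w, `|h w| <= C)%R -> smeas (F t) f -> sqint P f ->
  smeas (F t) (fun w => h w * f w)%R /\ sqint P (fun w => h w * f w)%R.
Proof.
move=> t0 mh hC mf f2; split; first exact: measurable_funM.
exact: sqint_bounded (filtration_measurable hF t0 mh) hC f2.
Qed.

(* The length of the intersection of ]a, b] and ]c, e]. *)
Definition overlap (a b c e : R) : R :=
  (Num.max (Num.max a c) (Num.min b e) - Num.max a c)%R.

Lemma overlapC a b c e : overlap a b c e = overlap c e a b.
Proof. by rewrite /overlap (maxC c a) (minC e b). Qed.

(** If the intervals overlap, the time axis is cut at [c], [m = min b e] and [M = max b e]. The
    product of the increments splits into [(B c - B a) * (B e - B c)], [(B m - B c) ^ 2] and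
    [(B m - B c) * (B M - B m)]; in the two mixed terms the later increment is orthogonal to
    everything known before it, so only the square survives. *)
Lemma increments_cov_le (a b c e C : R) (Z : T -> R) :
  (0 <= a)%R -> (a <= b)%R -> (a <= c)%R -> (c <= e)%R ->
  smeas (F c) Z -> (forall w, `|Z w| <= C)%R ->
  \int[P]_w (Z w * ((B b w - B a w) * (B e w - B c w)))%:E =
  \int[P]_w (Z w)%:E * (moment2 R * overlap a b c e)%:E.
Proof.
move=> a0 ab ac ce mZ ZC; have c0 := le_trans a0 ac.
have Z2 : sqint P Z := bounded_sqint P (filtration_measurable hF c0 mZ) ZC.
rewrite /overlap (max_idPr ac).
case: (leP b c) => [bc|cb].
  have -> : (Num.max c (Num.min b e) - c = 0)%R.
    by rewrite (max_idPl _) ?subrr// ge_min bc.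
  rewrite mulr0 mule0.
  have mD := filtration_smeas hF (le_trans a0 ab) bc (increment_smeas hF hB a0 ab).
  have [mZD ZD2] := bounded_mul_sqint c0 mZ ZC mD (increment_sqint hF hB a0 ab).
  rewrite -(increment_orth hF hB c0 ce mZD ZD2).
  by apply: eq_integral => w _; rewrite mulrA.
set m := Num.min b e; set M := Num.max b e.
have cm : (c <= m)%R by rewrite le_min (ltW cb).
have mM : (m <= M)%R by rewrite ge_min le_max lexx.
have m0 := le_trans c0 cm.
rewrite (max_idPr cm).
have mD1 := increment_smeas hF hB a0 ac.
have [mZ1 Z12] := bounded_mul_sqint c0 mZ ZC mD1 (increment_sqint hF hB a0 ac).
have mD2 := increment_smeas hF hB c0 cm.
have [mZ2 Z22] := bounded_mul_sqint m0 (filtration_smeas hF c0 cm mZ) ZC mD2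
  (increment_sqint hF hB c0 cm).
have i1 := sqint_mul Z12 (increment_sqint hF hB c0 ce).
have i2 := sqint_mul Z22 (increment_sqint hF hB c0 cm).
have i3 := sqint_mul Z22 (increment_sqint hF hB m0 mM).
have i23 : P.-integrable setT (fun w => (Z w * (B m \- B c) w * (B m \- B c) w +
    Z w * (B m \- B c) w * (B M \- B m) w)%:E) by exact: (integrableD measurableT i2 i3).
transitivity (\int[P]_w ((Z w * (B c \- B a) w * (B e \- B c) w)%:E +
   (Z w * (B m \- B c) w * (B m \- B c) w + Z w * (B m \- B c) w * (B M \- B m) w)%:E)).
  apply: eq_integral => w _; rewrite -EFinD; congr (_%:E) => /=.
  by rewrite /m /M; case: (leP b e) => be; ring.
rewrite integralD//.
rewrite [X in X + _](_ : _ = 0); last exact: (increment_orth hF hB c0 ce mZ1 Z12).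
under eq_integral do rewrite EFinD.
rewrite integralD// add0e.
rewrite [X in _ + X](_ : _ = 0); last exact: (increment_orth hF hB m0 mM mZ2 Z22).
rewrite adde0 -(increment_sqr_indep hF hB c0 cm mZ Z2).
by apply: eq_integral => w _; rewrite /= -mulrA.
Qed.

Lemma increments_cov (a b c e C D : R) (X Y : T -> R) :
  (0 <= a)%R -> (a <= b)%R -> (0 <= c)%R -> (c <= e)%R ->
  smeas (F a) X -> (forall w, `|X w| <= C)%R ->
  smeas (F c) Y -> (forall w, `|Y w| <= D)%R ->
  \int[P]_w ((X w * (B b w - B a w)) * (Y w * (B e w - B c w)))%:E =
  \int[P]_w (X w * Y w)%:E * (moment2 R * overlap a b c e)%:E.
Proof.
move=> a0 ab c0 ce mX XC mY YD.
have XYCD w : (`|X w * Y w| <= C * D)%R by rewrite normrM ler_pM.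
case: (leP a c) => ac.
  rewrite -(increments_cov_le (C := C * D) (Z := fun w => X w * Y w)%R)//.
    by apply: eq_integral => w _; congr (_%:E); ring.
  by apply: measurable_funM => //; exact: (filtration_smeas hF a0 ac mX).
rewrite overlapC -(increments_cov_le (C := C * D) (Z := fun w => X w * Y w)%R)//.
- by apply: eq_integral => w _; congr (_%:E); ring.
- exact: ltW.
- by apply: measurable_funM => //; exact: (filtration_smeas hF c0 (ltW ac) mY).
Qed.

Lemma integral_indic_overlap (a b c e : R) : (a <= b)%R -> (c <= e)%R ->
  \int[lebesgue_measure]_r (\1_(`]a, b]) r * \1_(`]c, e]) r)%:E =
  (overlap a b c e)%:E.
Proof.
move=> ab ce.
transitivity (\int[lebesgue_measure]_r (\1_(`]Num.max a c, Num.min b e]) r)%:E).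
  apply: eq_integral => r _; rewrite !indicE -natrM mulnb; congr (_%:R%:E).
  congr nat_of_bool; apply/andP/idP; rewrite !inE/= !in_itv/= gt_max le_min.
    by move=> [/andP[-> ->] /andP[-> ->]].
  by move=> /andP[/andP[-> ->] /andP[-> ->]].
rewrite integral_indic//= setIT lebesgue_measure_itv/= lte_fin /overlap.
by case: ltP => h; rewrite ?subrr// -EFinB.
Qed.

End brownian_isometry.

Section isometry.
Context d (T : measurableType d) (R : realType) (P : probability T R).
Variables (F : R -> set (set T)) (B : R -> T -> R).
Hypotheses (hF : filtration F) (hB : brownian_motion P F B).
Local Open Scope ereal_scope.

Lemma el_co_measurable (E : elementary F) i : measurable_fun setT (el_co E i).
Proof. exact: (filtration_measurable hF (el_lo_ge0 E i) (el_co_smeas E i)). Qed.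

Lemma el_co_sqint (E : elementary F) i : sqint P (el_co E i).
Proof.
have [C EC] := el_co_bnd E.
exact: (bounded_sqint P (el_co_measurable i) (EC i)).
Qed.

(** Both sides of the isometry expand into the double sum of these terms, up to the factor
    [moment2]. The covariance formula holds for arbitrary pairs of intervals, so they may
    overlap. *)
Let cov (E : elementary F) (i j : el_ix E) : R :=
  (fine (\int[P]_w (el_co E i w * el_co E j w)%:E) *
  overlap (el_lo E i) (el_hi E i) (el_lo E j) (el_hi E j))%R.

Lemma el_term_sqint (E : elementary F) (N : R -> T -> R) i :
  (forall s t, (0 <= s)%R -> (s <= t)%R -> sqint P (N t \- N s)%R) ->
  sqint P (fun w => el_co E i w * (N (el_hi E i) w - N (el_lo E i) w))%R.
Proof.
move=> N2; have [C EC] := el_co_bnd E.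
exact: (sqint_bounded (el_co_measurable i) (EC i) (N2 _ _ (el_lo_ge0 E i) (el_lo_hi E i))).
Qed.

Let co_fin (E : elementary F) (i j : el_ix E) :
  \int[P]_w (el_co E i w * el_co E j w)%:E =
  (fine (\int[P]_w (el_co E i w * el_co E j w)%:E))%:E.
Proof.
rewrite fineK//; apply: integrable_fin_num => //.
exact: (sqint_mul (el_co_sqint i) (el_co_sqint j)).
Qed.

Lemma el_int_sqint (E : elementary F) (N : R -> T -> R) :
  (forall s t, (0 <= s)%R -> (s <= t)%R -> sqint P (N t \- N s)%R) ->
  sqint P (el_int E N).
Proof.
by move=> N2; apply: sqint_sum => i; exact: el_term_sqint.
Qed.

Let el_int_sqr_cov (E : elementary F) :
  \int[P]_w ((el_int E B w) ^+ 2)%:E = (moment2 R * \sum_i \sum_j @cov E i j)%:E.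
Proof.
have [C EC] := el_co_bnd E.
under eq_integral.
  move=> w _; rewrite expr2 /el_int mulr_suml -sumEFin.
  under eq_bigr do rewrite mulr_sumr -sumEFin.
  over.
have i2 i j := sqint_mul (el_term_sqint i (increment_sqint hF hB))
  (el_term_sqint j (increment_sqint hF hB)).
rewrite integral_sum//; last by move=> i; apply: integrable_sum => // j _; exact: i2.
rewrite mulr_sumr -sumEFin; apply: eq_bigr => i _.
rewrite integral_sum//.
rewrite mulr_sumr -sumEFin; apply: eq_bigr => j _.
rewrite (increments_cov hF hB _ _ _ _ (el_co_smeas E i) (EC i) (el_co_smeas E j) (EC j))
  ?el_lo_ge0 ?el_lo_hi//.
by rewrite co_fin -EFinM /cov mulrCA.
Qed.

Let el_val_sqr_cov (E : elementary F) :
  \int[P]_w \int[lebesgue_measure]_r ((el_val E r w) ^+ 2)%:E =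
  (\sum_i \sum_j @cov E i j)%:E.
Proof.
transitivity (\int[P]_w (\sum_i \sum_j ((el_co E i w * el_co E j w)%R *
    overlap (el_lo E i) (el_hi E i) (el_lo E j) (el_hi E j))%:E)).
  apply: eq_integral => w _; under eq_integral.
    move=> r _; rewrite expr2 /el_val mulr_suml -sumEFin.
    under eq_bigr do rewrite mulr_sumr -sumEFin.
    over.
  have ii i j : lebesgue_measure.-integrable setT (fun r : R =>
      (\1_(`]el_lo E i, el_hi E i]) r * \1_(`]el_lo E j, el_hi E j]) r)%:E).
    apply: (le_integrable measurableT _ _
      (integrable_indic_itv (el_lo E i) (el_hi E i) false false)) => /=.
      by apply/measurable_EFinP; exact: measurable_funM.
    move=> r _; rewrite lee_fin !indicE -natrM !normr_nat ler_nat.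
    by case: (_ \in _); case: (_ \in _).
  have iii i j : lebesgue_measure.-integrable setT (fun r : R =>
     (el_co E i w * \1_(`]el_lo E i, el_hi E i]) r *
       (el_co E j w * \1_(`]el_lo E j, el_hi E j]) r))%:E).
    have := integrableZl measurableT (el_co E i w * el_co E j w) (ii i j).
    by apply: eq_integrable => // r _; rewrite -EFinM; congr (_%:E); ring.
  rewrite integral_sum//; last by move=> i; apply: integrable_sum => // j _; exact: iii.
  apply: eq_bigr => i _; rewrite integral_sum//; apply: eq_bigr => j _.
  rewrite EFinM -(integral_indic_overlap (el_lo_hi E i) (el_lo_hi E j)).
  rewrite -integralZl//.
  by apply: eq_integral => r _; rewrite -EFinM; congr (_%:E); ring.
have jj i j : P.-integrable setT (fun w => ((el_co E i w * el_co E j w)%R *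
    overlap (el_lo E i) (el_hi E i) (el_lo E j) (el_hi E j))%:E).
  have := integrableZr measurableT (overlap (el_lo E i) (el_hi E i) (el_lo E j) (el_hi E j))
    (sqint_mul (el_co_sqint i) (el_co_sqint j)).
  by apply: eq_integrable => // w _; rewrite -EFinM.
rewrite integral_sum//; last by move=> i; apply: integrable_sum => // j _; exact: jj.
rewrite -sumEFin; apply: eq_bigr => i _; rewrite integral_sum// -sumEFin.
apply: eq_bigr => j _; under eq_integral do rewrite EFinM.
rewrite integralZr//; last exact: (sqint_mul (el_co_sqint i) (el_co_sqint j)).
by rewrite co_fin -EFinM.
Qed.

Theorem el_isometry (E : elementary F) :
  \int[P]_w ((el_int E B w) ^+ 2)%:E =
  (moment2 R)%:E * \int[P]_w \int[lebesgue_measure]_r ((el_val E r w) ^+ 2)%:E.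
Proof. by rewrite el_val_sqr_cov -EFinM el_int_sqr_cov. Qed.

Lemma el_int_mean0 (E : elementary F) : \int[P]_w (el_int E B w)%:E = 0.
Proof.
under eq_integral do rewrite /el_int -sumEFin.
rewrite integral_sum//; last first.
  by move=> i; exact: (sqint_integrable (el_term_sqint i (increment_sqint hF hB))).
rewrite big1// => i _.
exact: (increment_orth hF hB (el_lo_ge0 E i) (el_lo_hi E i) (el_co_smeas E i) (el_co_sqint i)).
Qed.

End isometry.

(** * Square norms, L^2-null sequences and limits of means *)

Section square_norm.
Context d (T : measurableType d) (R : realType) (mu : {measure set T -> \bar R}).
Local Open Scope ereal_scope.

Definition nrm2 (f : T -> R) := \int[mu]_x ((f x) ^+ 2)%:E.

Lemma nrm2_ge0 f : 0 <= nrm2 f.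
Proof. by apply: integral_ge0 => x _; rewrite lee_fin sqr_ge0. Qed.

(** The triangle inequality is always used in this squared form, typically with [a = b = 2]: the
    pointwise hypothesis is then a polynomial inequality and no square root appears. *)
Lemma nrm2_le (f g h : T -> R) (a b : R) : (0 <= a)%R -> (0 <= b)%R ->
  measurable_fun setT f -> measurable_fun setT g -> measurable_fun setT h ->
  (forall x, (f x) ^+ 2 <= a * (g x) ^+ 2 + b * (h x) ^+ 2)%R ->
  nrm2 f <= a%:E * nrm2 g + b%:E * nrm2 h.
Proof.
move=> a0 b0 mf mg mh fgh.
have m2 (k : T -> R) : measurable_fun setT k ->
    measurable_fun setT (fun x => ((k x) ^+ 2)%:E).
  by move=> mk; apply/measurable_EFinP; exact: measurable_funX.
have p2 (k : T -> R) x : setT x -> 0 <= ((k x) ^+ 2)%:E by rewrite lee_fin sqr_ge0.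
have m3 (c : R) (k : T -> R) : measurable_fun setT k ->
    measurable_fun setT (fun x => c%:E * ((k x) ^+ 2)%:E).
  by move=> mk; apply: emeasurable_funM => //; exact: m2.
have Z (c : R) (k : T -> R) : (0 <= c)%R -> measurable_fun setT k ->
    c%:E * nrm2 k = \int[mu]_x (c%:E * ((k x) ^+ 2)%:E).
  move=> c0 mk; rewrite ge0_integralZl//; first exact: m2.
  by move=> x; exact: p2.
rewrite !Z//.
rewrite -ge0_integralD//; [|by move=> x _; rewrite mule_ge0// lee_fin ?sqr_ge0|
  exact: m3|by move=> x _; rewrite mule_ge0// lee_fin ?sqr_ge0|exact: m3].
apply: ge0_le_integral => //.
- by move=> x _; rewrite lee_fin sqr_ge0.
- exact: m2.
- by apply: emeasurable_funD; exact: m3.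
- by move=> x _; rewrite -!EFinM -EFinD lee_fin.
Qed.

Lemma nrm2_eq0_ae (f : T -> R) : measurable_fun setT f -> nrm2 f = 0 ->
  {ae mu, forall x, f x = 0%R}.
Proof.
move=> mf f0.
have m2 : measurable_fun setT (fun w => ((f w) ^+ 2)%:E).
  by apply/measurable_EFinP; exact: measurable_funX.
have [+ _] := ae_eq_integral_abs mu measurableT m2.
move=> /(_ _)/wrap[].
  by rewrite -[RHS]f0; apply: eq_integral => x _; rewrite gee0_abs// lee_fin sqr_ge0.
apply: filterS => x /(_ I)[] /eqP.
by rewrite sqrf_eq0 => /eqP.
Qed.

Definition null2 (f : nat -> T -> R) := nrm2 (f n) @[n --> \oo] --> 0.

Lemma null2_le (f g h : nat -> T -> R) (a b : R) : (0 <= a)%R -> (0 <= b)%R ->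
  (forall n, measurable_fun setT (f n)) -> (forall n, measurable_fun setT (g n)) ->
  (forall n, measurable_fun setT (h n)) ->
  (forall n x, (f n x) ^+ 2 <= a * (g n x) ^+ 2 + b * (h n x) ^+ 2)%R ->
  null2 g -> null2 h -> null2 f.
Proof.
move=> a0 b0 mf mg mh fgh g0 h0.
have c0 : a%:E * nrm2 (g n) + b%:E * nrm2 (h n) @[n --> \oo] --> 0.
  rewrite [X in _ --> X](_ : _ = a%:E * 0 + b%:E * 0); last by rewrite !mule0 adde0.
  by apply: cvgeD; [rewrite !mule0|apply: cvgeZl|apply: cvgeZl].
apply: (squeeze_cvge _ (cvg_cst 0) c0).
by near=> n; rewrite nrm2_ge0/= nrm2_le.
Unshelve. all: by end_near. Qed.

Lemma null2_cst0 : null2 (fun _ => cst 0%R).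
Proof.
rewrite /null2 /nrm2; under eq_fun do under eq_integral do rewrite expr0n/=.
by under eq_fun do rewrite integral0; exact: cvg_cst.
Qed.

Lemma null2D (f g : nat -> T -> R) :
  (forall n, measurable_fun setT (f n)) -> (forall n, measurable_fun setT (g n)) ->
  null2 f -> null2 g -> null2 (fun n x => f n x + g n x)%R.
Proof.
move=> mf mg; apply: (@null2_le _ _ _ 2 2) => // [n|n x].
  exact: measurable_funD.
by have := sqr_ge0 (f n x - g n x)%R; move: (f n x) (g n x) => a b; nra.
Qed.

Lemma null2M (f : nat -> T -> R) (h : T -> R) (C : R) :
  measurable_fun setT h -> (forall x, `|h x| <= C)%R ->
  (forall n, measurable_fun setT (f n)) ->
  null2 f -> null2 (fun n x => h x * f n x)%R.
Proof.
move=> mh hC mf f0; apply: (@null2_le _ f (fun _ => cst 0%R) (C ^+ 2) 0) => //.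
- by rewrite sqr_ge0.
- by move=> n; exact: measurable_funM.
- move=> n x; rewrite mul0r addr0 exprMn ler_wpM2r ?sqr_ge0//.
  by rewrite -real_normK ?num_real// lerXn2r ?nnegrE ?(le_trans _ (hC x)).
- exact: null2_cst0.
Qed.

Lemma null2_sum (I : Type) (s : seq I) (f : I -> nat -> T -> R) :
  (forall i n, measurable_fun setT (f i n)) -> (forall i, null2 (f i)) ->
  null2 (fun n x => \sum_(i <- s) f i n x)%R.
Proof.
move=> mf f0; elim: s => [|i s ih].
  rewrite (_ : (fun _ => _) = (fun _ => cst 0%R)); first exact: null2_cst0.
  by apply/funext => n; apply/funext => x; rewrite big_nil.
rewrite (_ : (fun _ => _) = (fun n x => f i n x + \sum_(j <- s) f j n x)%R).
  by apply: null2D => // n; exact: measurable_sum.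
by apply/funext => n; apply/funext => x; rewrite big_cons.
Qed.

End square_norm.

Lemma lee_null (R : realType) (x a : \bar R) (e : nat -> \bar R) :
  e n @[n --> \oo] --> 0%E -> (forall n, x <= a + e n)%E -> (x <= a)%E.
Proof.
move=> e0 xa.
have : (a + e n)%E @[n --> \oo] --> (a + 0)%E.
  by apply: cvgeD => //; [exact: fin_num_adde_defl|exact: cvg_cst].
by rewrite adde0; apply: cvge_ge; exact: nearW.
Qed.

(** Integrating [|x| <= e + x ^ 2 / e] with [x = f w - g n w] bounds the mean of [f] by [e] plus a
    null sequence, for every [e > 0]. Square integrability of [f] comes from a single [n] at which
    the error is finite. *)
Lemma mean0_lim d (T : measurableType d) (R : realType) (P : probability T R)
    (f : T -> R) (g : nat -> T -> R) :
  measurable_fun setT f -> (forall n, sqint P (g n)) ->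
  (forall n, \int[P]_w (g n w)%:E = 0)%E ->
  null2 P (fun n w => f w - g n w) -> sqint P f /\ (\int[P]_w (f w)%:E = 0)%E.
Proof.
move=> mf g2 g0 fg.
have mfg n : measurable_fun setT (fun w => f w - g n w).
  by apply: measurable_funB => //; case: (g2 n).
have f2 : sqint P f.
  have [fin _] := (fine_cvgP _ _).1 fg.
  have [n nfin] := filter_ex fin.
  rewrite (_ : f = (fun w => (f w - g n w) + g n w)); last first.
    by apply/funext => w; rewrite subrK.
  by apply: sqintD => //; split => //; rewrite -ge0_fin_numE ?nrm2_ge0.
split=> //; apply/eqP; rewrite -abse_eq0 eq_le abse_ge0 andbT.
have fg2 n : sqint P (fun w => f w - g n w).
  rewrite (_ : (fun w => _) = (f \+ (fun w => -1 * g n w))); last first.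
    by apply/funext => w /=; rewrite mulN1r.
  apply: sqintD => //; apply: (@sqint_bounded _ _ _ _ _ _ 1) => //.
  by move=> w; rewrite normrN1.
apply/lee_addgt0Pr => e e0; rewrite add0e.
have c0 : (e^-1%:E * nrm2 P (fun w => f w - g n w)%R)%E @[n --> \oo] --> 0%E.
  rewrite [X in _ --> X](_ : _ = e^-1%:E * 0)%E; last by rewrite mule0.
  exact: cvgeZl.
apply: (lee_null c0) => n. 
have -> : (\int[P]_w (f w)%:E = \int[P]_w (f w - g n w)%:E)%E.
  under [RHS]eq_integral do rewrite EFinB.
  rewrite integralB//; [|exact: sqint_integrable|exact: sqint_integrable].
  by rewrite g0 sube0.
apply: le_trans (le_abse_integral _ _ _) _ => //. 
  exact/measurable_EFinP.
have m2 : measurable_fun setT (fun w => ((f w - g n w) ^+ 2)%:E).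
  exact: measurable_sqr.
have p2 w : setT w -> (0 <= ((f w - g n w) ^+ 2)%:E)%E by rewrite lee_fin sqr_ge0.
rewrite /nrm2 -ge0_integralZl// ?lee_fin ?invr_ge0 ?(ltW e0)//.
have <- : (\int[P]_w e%:E = e%:E)%E.
  rewrite integral_cst//= [X in (_ * X)%E](_ : _ = 1%E) ?mule1//.
  exact: probability_setT.
rewrite -ge0_integralD//.

- apply: ge0_le_integral => //.
  + by apply: measurableT_comp => //; exact/measurable_EFinP.
  + by apply: emeasurable_funD => //; exact: emeasurable_funM.
  + move=> w _; rewrite -EFinM -EFinD lee_fin; move: (f w - g n w) => x.
    rewrite -lerBlDl -(ler_pM2l e0) mulVKf ?gt_eqF// -real_normK ?num_real//.
    by have := sqr_ge0 (`|x| - e / 2); have := normr_ge0 x; move: `|x| => y; nra.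
- by move=> w _; rewrite lee_fin ltW.
- by move=> w _; rewrite mule_ge0// lee_fin ?invr_ge0 ?sqr_ge0 ?ltW.
- exact: emeasurable_funM.
Qed.

(** Extending a path to negative times by its value at 0 turns continuity within the half-line into
    ordinary continuity, to which composition of limits applies. *)
Lemma continuous_maxr0 (R : realType) (f : R -> R) :
  {within `[0, +oo[, continuous f} -> continuous (fun x : R => f (Num.max 0 x)).
Proof.
move=> /subspace_continuousP cf x.
have h0 : `[0, +oo[%classic (Num.max 0 x) by rewrite /= in_itv/= andbT le_max lexx.
have cm : {for x, continuous (Num.max (0 : R))}.
  rewrite (_ : Num.max (0 : R) = (fun y : R => (y + `|y|) / 2)).
    apply: cvgMl; apply: cvgD; first exact: cvg_id.
    by apply: cvg_norm; exact: cvg_id.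
  apply/funext => y; case: (leP 0 y) => y0; first by rewrite ger0_norm//; field.
  by rewrite ltr0_norm// subrr mul0r.
apply: cvg_comp (cf _ h0) => Q QA.
have := cm _ QA; apply: (@filterS _ (nbhs x)) => y /=; apply.
by rewrite /= in_itv/= andbT le_max lexx.
Qed.

(** * The space-time norm and joint measurability *)

Section space_time.
Context d (T : measurableType d) (R : realType) (P : probability T R).
Local Notation leb := (@lebesgue_measure R).
Implicit Types (K : R -> T -> R) (t : R).

(* The space-time norm on [0, t] x T; [K] is cut off outside [0, t] so that it can
   be compared with [nrm2] of the product measure. *)
Definition st_measurable t K :=
  measurable_fun [set: T * measurableTypeR R] (fun z => K z.2 z.1 * \1_(`[0, t]) z.2).

Definition st_nrm2 t K : \bar R :=
  (\int[P]_w \int[leb]_(s in `[0%R, t]) ((K s w) ^+ 2)%:E)%E.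

Lemma st_nrm2E t K : st_measurable t K ->
  st_nrm2 t K = nrm2 (P \x leb)%E (fun z => K z.2 z.1 * \1_(`[0, t]) z.2).
Proof.
move=> mK; rewrite /nrm2 fubini_tonelli1//=; last 2 first.
- by apply/measurable_EFinP; exact: measurable_funX.
- by move=> z; rewrite lee_fin sqr_ge0.
apply: eq_integral => w _; rewrite /fubini_F [LHS]integral_mkcond.
apply: eq_integral => s _ /=; rewrite patchE indicE.
by case: ifPn => _; rewrite ?mulr1// mulr0 expr0n.
Qed.

Lemma st_nrm2_ge0 t K : (0 <= st_nrm2 t K)%E.
Proof.
by apply: integral_ge0 => w _; apply: integral_ge0 => s _; rewrite lee_fin sqr_ge0.
Qed.

Lemma st_nrm2_le t K K1 K2 (a b : R) : 0 <= a -> 0 <= b ->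
  st_measurable t K -> st_measurable t K1 -> st_measurable t K2 ->
  (forall s w, 0 <= s <= t -> (K s w) ^+ 2 <= a * (K1 s w) ^+ 2 + b * (K2 s w) ^+ 2) ->
  (st_nrm2 t K <= a%:E * st_nrm2 t K1 + b%:E * st_nrm2 t K2)%E.
Proof.
move=> a0 b0 mK mK1 mK2 KK; rewrite !st_nrm2E//; apply: nrm2_le => //.
move=> [w s] /=; rewrite indicE.
have [|_] := boolP (s \in `[0, t]%classic); last by rewrite !mulr0 expr0n/= !mulr0 addr0.
by rewrite inE/= in_itv/= !mulr1; exact: KK.
Qed.

Lemma st_measurableB t K K' : st_measurable t K -> st_measurable t K' ->
  st_measurable t (fun s w => K s w - K' s w).
Proof.
move=> mK mK'; rewrite /st_measurable; under eq_fun do rewrite mulrBl.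
exact: measurable_funB.
Qed.

Lemma st_measurableM t K K' : st_measurable t K -> st_measurable t K' ->
  st_measurable t (fun s w => K s w * K' s w).
Proof.
move=> mK mK'; rewrite /st_measurable.
rewrite (_ : (fun z => _) = (fun z : T * measurableTypeR R => (K z.2 z.1 * \1_(`[0, t]) z.2) *
  (K' z.2 z.1 * \1_(`[0, t]) z.2))); first exact: measurable_funM.
apply/funext => z; rewrite indicE; case: (_ \in _); rewrite ?mulr1//=.
by rewrite !mulr0.
Qed.

Lemma measurable_snd_comp (g : R -> R) : measurable_fun [set: measurableTypeR R] g ->
  measurable_fun [set: T * measurableTypeR R] (fun z => g z.2).
Proof. by move=> mg; exact: (measurableT_comp mg (@measurable_snd _ _ T _)). Qed.

Lemma measurable_fst_comp (f : T -> R) : measurable_fun setT f ->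
  measurable_fun [set: T * measurableTypeR R] (fun z => f z.1).
Proof. by move=> mf; exact: (measurableT_comp mf (@measurable_fst _ _ T _)). Qed.

Lemma st_measurable_prod t (f : T -> R) (g : R -> R) : measurable_fun setT f ->
  measurable_fun [set: measurableTypeR R] g -> st_measurable t (fun s w => f w * g s).
Proof.
move=> mf mg; apply: measurable_funM.
  by apply: measurable_funM; [exact: measurable_fst_comp|exact: measurable_snd_comp].
by apply: measurable_snd_comp; exact: measurable_indic.
Qed.

Lemma st_measurable_sum t (I : Type) (s : seq I) (K : I -> R -> T -> R) :
  (forall i, st_measurable t (K i)) ->
  st_measurable t (fun r w => \sum_(i <- s) K i r w).
Proof.
move=> mK; rewrite /st_measurable; under eq_fun do rewrite mulr_suml.
by apply: measurable_sum.
Qed.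

(** Freezing [X] at the multiple of [1 / (n + 1)] just below the current time gives a process whose
    preimages are countable unions of rectangles; by continuity of the paths, these processes
    converge pointwise to [X]. *)
Lemma st_measurable_continuous t (X : R -> T -> R) (f : R -> R) :
  (forall s, 0 <= s -> measurable_fun setT (X s)) -> continuous_paths X ->
  measurable_fun setT f -> st_measurable t (fun s w => f (X s w)).
Proof.
move=> mX cX mf.
pose k n (s : R) : nat := Num.truncn (n.+1%:R * Num.max 0 s).
have s0 n (s : R) : 0 <= n.+1%:R * Num.max 0 s by rewrite mulr_ge0// le_max lexx.
pose Xn n (z : T * measurableTypeR R) := X ((k n z.2)%:R / n.+1%:R) z.1.
have mlt n (r : R) : measurable ([set s | n.+1%:R * Num.max 0 s < r] : set (measurableTypeR R)).
  have mc : measurable_fun [set: measurableTypeR R] (fun s : R => n.+1%:R * Num.max 0 s).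
    by apply: measurable_funM => //; exact: measurable_maxr.
  have := mc measurableT _ (measurable_itv `]-oo, r[); rewrite setTI.
  by congr (measurable _); apply/seteqP; split => s /=; rewrite in_itv.
have mk n i : measurable (k n @^-1` [set i] : set (measurableTypeR R)).
  rewrite (_ : _ @^-1` _ = [set s | n.+1%:R * Num.max 0 s < i.+1%:R] `\`
      [set s | n.+1%:R * Num.max 0 s < i%:R]); first exact: measurableD.
  apply/seteqP; split => s; rewrite /k/= -!truncn_lt_nat//.
    by move=> ->; rewrite ltnSn ltnn.
  by rewrite ltnS => -[h1] /negP; rewrite -leqNgt => h2; apply/eqP; rewrite eqn_leq h1.
have mXn n : measurable_fun setT (Xn n).
  move=> _ A mA; rewrite setTI.
  have -> : Xn n @^-1` A = \bigcup_i ((X (i%:R / n.+1%:R) @^-1` A) `*` (k n @^-1` [set i])).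
    apply/seteqP; split => [[w s] /= XA|[w s] [i _ /= [XA kis]]]; first by exists (k n s).
    by rewrite /Xn /= kis.
  apply: bigcup_measurable => i _; apply: measurableX; last exact: mk.
  by rewrite -[X in measurable X]setTI; apply: mX => //; rewrite divr_ge0.
have mX' : measurable_fun [set: T * measurableTypeR R] (fun z => X (Num.max 0 z.2) z.1).
  apply: (measurable_fun_cvg (h := Xn)) => //.
  move=> [w s] _ /=.
  have u0 n : 0 <= (k n s)%:R / n.+1%:R :> R by rewrite divr_ge0.
  have u_cvg : ((k n s)%:R / n.+1%:R : R) @[n --> \oo] --> Num.max 0 s.
    apply: (@squeeze_cvgr _ _ _ _ (fun n => Num.max 0 s - n.+1%:R^-1)
      (fun=> Num.max 0 s)); last exact: cvg_cst.
    - apply: nearW => n; have /andP[h1 h2] := truncn_itv (s0 n s).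
      rewrite lerBlDr -[X in _ + X]mul1r -mulrDl ler_pdivlMr// ler_pdivrMr//.
      by rewrite [_ * n.+1%:R]mulrC h1 natr1 ltW.
    - rewrite -[X in _ --> X]subr0; apply: cvgB; first exact: cvg_cst.
      exact: cvg_harmonic.
  have := cvg_comp _ _ u_cvg (@continuous_maxr0 R _ (cX w) (Num.max 0 s)).
  rewrite (max_idPr _ : Num.max 0 (Num.max 0 s) = _) ?le_max ?lexx//.
  by rewrite (_ : Xn ^~ (w, s) = (fun x => X (Num.max 0 x) w) \o
      (fun n => (k n s)%:R / n.+1%:R))//; apply/funext => n /=; rewrite (max_idPr (u0 n)).
rewrite /st_measurable.
rewrite [X in measurable_fun _ X](_ : _ =
    (fun z => f (X (Num.max 0 z.2) z.1) * \1_(`[0, t]) z.2)).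
  apply: measurable_funM; first exact: (measurableT_comp mf mX').
  by apply: measurable_snd_comp; exact: measurable_indic.
apply/funext => -[w s] /=; rewrite indicE.
have [|_] := boolP (s \in `[0, t]%classic); last by rewrite !mulr0.
by rewrite inE/= in_itv/= => /andP[s_ge0 _]; rewrite (max_idPr s_ge0).
Qed.

End space_time.

(** * Truncation, product and difference of elementary integrands *)

Lemma increment_overlap (R : realType) (f : R -> R) (a b c e : R) : a <= b -> c <= e ->
  f (Num.max (Num.max a c) (Num.min b e)) - f (Num.max a c) =
  f (Num.min e b) - f (Num.min c b) - (f (Num.min e a) - f (Num.min c a)).
Proof.
move=> ab ce.
case: (leP a c) => ac; case: (leP e b) => be; case: (leP c b) => cb;
  case: (leP e a) => ea; try (by ring); try (by exfalso; lra).
- have -> : e = c by lra. have -> : a = c by lra. by rewrite maxxx; ring.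
- by rewrite (max_idPr ce); ring.
- by rewrite (max_idPr ab); ring.
Qed.

Section elementary_operations.
Context d (T : measurableType d) (R : realType) (P : probability T R).
Variables (F : R -> set (set T)) (hF : filtration F).
Implicit Types (E : elementary F) (N : R -> T -> R).

Definition el_below t E := forall i, el_hi E i <= t.

Section truncation.
Variables (u : R) (u0 : 0 <= u) (E : elementary F).

(** An interval beyond [u] collapses to the point [u], at which its coefficient need not be known
    yet; replacing the coefficient by 0 keeps the integrand adapted and changes no value up to
    [u]. *)
Let co i : T -> R := if el_lo E i <= u then el_co E i else cst 0.

Let trunc_lo_ge0 i : 0 <= Num.min (el_lo E i) u.
Proof. by rewrite le_min el_lo_ge0. Qed.

Let trunc_lo_hi i : Num.min (el_lo E i) u <= Num.min (el_hi E i) u.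
Proof. by rewrite le_min !ge_min el_lo_hi lexx orbT. Qed.

Let trunc_smeas i : smeas (F (Num.min (el_lo E i) u)) (co i).
Proof.
rewrite /co; case: leP => h; first exact: el_co_smeas.
exact: measurable_cst.
Qed.

Let trunc_bnd : exists C : R, forall i w, `|co i w| <= C.
Proof.
have [C EC] := el_co_bnd E; exists C => i w; rewrite /co; case: ifP => // _.
by rewrite normr0 (le_trans _ (EC i w)).
Qed.

Definition el_trunc := Elementary trunc_lo_ge0 trunc_lo_hi trunc_smeas trunc_bnd.

Lemma el_trunc_below t : u <= t -> el_below t el_trunc.
Proof. by move=> ut i /=; rewrite ge_min ut orbT. Qed.

Lemma el_int_trunc N w : el_int el_trunc N w =
  \sum_i el_co E i w * (N (Num.min (el_hi E i) u) w - N (Num.min (el_lo E i) u) w).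
Proof.
apply: eq_bigr => i _ /=; rewrite /co; case: (leP (el_lo E i) u) => // h.
rewrite (min_idPr (ltW (lt_le_trans h (el_lo_hi E i)))).
by rewrite subrr !mulr0.
Qed.

Lemma el_val_trunc r w : r <= u -> el_val el_trunc r w = el_val E r w.
Proof.
move=> ru; apply: eq_bigr => i _ /=; rewrite /co !indicE.
rewrite !mem_setE !in_itv/= le_min ru andbT gt_min.
case: (leP (el_lo E i) u) => h.
  by rewrite [u < r]ltNge ru orbF.
by rewrite mul0r (ltNge (el_lo E i) r) (ltW (le_lt_trans ru h))/= mulr0.
Qed.

End truncation.

Section product.
Variables (E E' : elementary F).

Let lo (i : el_ix E * el_ix E') := Num.max (el_lo E i.1) (el_lo E' i.2).

(** The outer maximum makes the interval empty, and not reversed, when the two factors do not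
    overlap. *)
Let hi (i : el_ix E * el_ix E') :=
  Num.max (lo i) (Num.min (el_hi E i.1) (el_hi E' i.2)).

Let co (i : el_ix E * el_ix E') (w : T) := el_co E i.1 w * el_co E' i.2 w.

Let mul_lo_ge0 i : 0 <= lo i. Proof. by rewrite le_max el_lo_ge0. Qed.

Let mul_lo_hi i : lo i <= hi i. Proof. by rewrite le_max lexx. Qed.

Let mul_smeas i : smeas (F (lo i)) (co i).
Proof.
apply: measurable_funM.
  by apply: (filtration_smeas hF (el_lo_ge0 E i.1) _ (el_co_smeas E i.1)); rewrite le_max lexx.
by apply: (filtration_smeas hF (el_lo_ge0 E' i.2) _ (el_co_smeas E' i.2));
  rewrite le_max lexx orbT.
Qed.

Let mul_bnd : exists C : R, forall i w, `|co i w| <= C.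
Proof.
have [[C EC] [C' EC']] := (el_co_bnd E, el_co_bnd E'); exists (C * C') => i w.
by rewrite normrM ler_pM.
Qed.

Definition el_mul := Elementary mul_lo_ge0 mul_lo_hi mul_smeas mul_bnd.

Lemma el_mul_below t : el_below t E -> el_below t E' -> el_below t el_mul.
Proof.
move=> Et E't i /=; rewrite /hi /lo !ge_max ge_min Et/=.
by rewrite (le_trans (el_lo_hi E _))// (le_trans (el_lo_hi E' _)).
Qed.

Lemma el_val_mul r w : el_val el_mul r w = el_val E r w * el_val E' r w.
Proof.
rewrite /el_val mulr_suml.
under [RHS]eq_bigr do rewrite mulr_sumr.
rewrite pair_big/=; apply: eq_bigr => -[i j] _ /=; rewrite mulrACA; congr (_ * _).
rewrite !indicE -natrM mulnb; congr (_%:R); congr nat_of_bool.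
rewrite !mem_setE !in_itv/= /hi /lo /= !leNgt !gt_max gt_min.
by do 4 case: (_ < r).
Qed.

(** Associativity of stochastic integration at the elementary level: integrating the product means
    integrating [E] against the running integral of [E']. By [increment_overlap], the increment over
    an intersection is one interval of [E'] stopped at the two ends of an interval of [E]. *)
Lemma el_int_mul N w : el_int el_mul N w =
  \sum_i el_co E i w * (\sum_j el_co E' j w *
      (N (Num.min (el_hi E' j) (el_hi E i)) w - N (Num.min (el_lo E' j) (el_hi E i)) w) -
    \sum_j el_co E' j w *
      (N (Num.min (el_hi E' j) (el_lo E i)) w - N (Num.min (el_lo E' j) (el_lo E i)) w)).
Proof.
rewrite /el_int; under [RHS]eq_bigr do rewrite -sumrB mulr_sumr.
rewrite pair_big/=; apply: eq_bigr => -[i j] _ /=.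
rewrite /co -mulrA.
have /= -> := increment_overlap (N ^~ w) (el_lo_hi E i) (el_lo_hi E' j).
by rewrite -mulrBr.
Qed.

End product.
Section difference.
Variables (E E' : elementary F).

Let lo (i : el_ix E + el_ix E') := match i with inl j => el_lo E j | inr j => el_lo E' j end.
Let hi (i : el_ix E + el_ix E') := match i with inl j => el_hi E j | inr j => el_hi E' j end.
Let co (i : el_ix E + el_ix E') : T -> R :=
  match i with inl j => el_co E j | inr j => fun w => - el_co E' j w end.

Let sub_lo_ge0 i : 0 <= lo i. Proof. by case: i => i; exact: el_lo_ge0. Qed.
Let sub_lo_hi i : lo i <= hi i. Proof. by case: i => i; exact: el_lo_hi. Qed.
Let sub_smeas i : smeas (F (lo i)) (co i).
Proof.
case: i => i; first exact: el_co_smeas.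
exact: (measurableT_comp (@oppr_measurable R setT) (el_co_smeas E' i)).
Qed.
Let sub_bnd : exists C : R, forall i w, `|co i w| <= C.
Proof.
have [[C EC] [C' EC']] := (el_co_bnd E, el_co_bnd E'); exists (Num.max C C').
by move=> [i|i] w /=; rewrite ?normrN le_max ?EC ?EC' ?orbT.
Qed.

Definition el_sub := Elementary sub_lo_ge0 sub_lo_hi sub_smeas sub_bnd.

Lemma el_sub_below t : el_below t E -> el_below t E' -> el_below t el_sub.
Proof. by move=> Et E't [i|i] /=; [exact: Et|exact: E't]. Qed.

Lemma el_val_sub r w : el_val el_sub r w = el_val E r w - el_val E' r w.
Proof.
by rewrite /el_val big_sumType/= -sumrN; congr (_ + _); apply: eq_bigr => i _; rewrite mulNr.
Qed.

Lemma el_int_sub N w : el_int el_sub N w = el_int E N w - el_int E' N w.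
Proof.
by rewrite /el_int big_sumType/= -sumrN; congr (_ + _); apply: eq_bigr => i _; rewrite mulNr.
Qed.

Lemma el_int_trunc_sub u (u0 : 0 <= u) N w : el_int (el_trunc u0 el_sub) N w =
  el_int (el_trunc u0 E) N w - el_int (el_trunc u0 E') N w.
Proof.
rewrite !el_int_trunc big_sumType/= -sumrN.
by congr (_ + _); apply: eq_bigr => i _; rewrite mulNr.
Qed.

End difference.

Section unit.
Variables (t : R) (t0 : 0 <= t).

Let one_smeas (i : unit) : smeas (F 0) (cst 1 : T -> R).
Proof. exact: measurable_cst. Qed.

Let one_bnd : exists C : R, forall (i : unit) (w : T), `|cst 1 w| <= C.
Proof. by exists 1 => i w; rewrite normr1. Qed.

Definition el_one := Elementary (fun _ : unit => lexx 0) (fun _ : unit => t0)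
  one_smeas one_bnd.

Lemma el_val_one r w : el_val el_one r w = \1_(`]0, t]) r.
Proof. by rewrite /el_val (big_pred1 tt) ?mul1r// => -[]. Qed.

Lemma el_int_trunc_one u (u0 : 0 <= u) N w : u <= t ->
  el_int (el_trunc u0 el_one) N w = N u w - N 0 w.
Proof.
by move=> ut; rewrite el_int_trunc (big_pred1 tt) ?mul1r /= ?(min_idPr ut) ?(min_idPl u0)// => -[].
Qed.

End unit.

Section of_simple_process.
Variable S : simple_process F.

Let time_ge0 i : (i <= sp_size S)%N -> 0 <= sp_time S i.
Proof.
elim: i => [_|i ih iS]; first exact: sp_time_ge0.
exact: (le_trans (ih (ltnW iS)) (ltW (sp_time_lt iS))).
Qed.

Let sp_lo_ge0 (i : 'I_(sp_size S)) : 0 <= sp_time S i.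
Proof. exact: (time_ge0 (ltnW (ltn_ord i))). Qed.

Let sp_lo_hi (i : 'I_(sp_size S)) : sp_time S i <= sp_time S i.+1.
Proof. exact: (ltW (sp_time_lt (ltn_ord i))). Qed.

Let sp_smeas (i : 'I_(sp_size S)) : smeas (F (sp_time S i)) (sp_coef S i).
Proof.
apply/smeasP; first exact: (filtration_sigma hF (sp_lo_ge0 i)).
exact: (sp_coef_meas (ltn_ord i)).
Qed.

Let sp_bnd : exists C : R, forall (i : 'I_(sp_size S)) (w : T), `|sp_coef S i w| <= C.
Proof. by have [C SC] := sp_coef_bnd S; exists C => i w; exact: SC. Qed.

Definition el_simple := Elementary sp_lo_ge0 sp_lo_hi sp_smeas sp_bnd.

Lemma el_int_simple u (u0 : 0 <= u) N w :
  el_int (el_trunc u0 el_simple) N w = sp_int S N u w.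
Proof. by rewrite el_int_trunc. Qed.

End of_simple_process.

Lemma el_val_measurable t E : st_measurable t (el_val E).
Proof.
apply: st_measurable_sum => i; apply: st_measurable_prod; last exact: measurable_indic.
exact: el_co_measurable.
Qed.

Lemma el_val_bnd E : exists2 C : R, 0 <= C & forall r w, `|el_val E r w| <= C.
Proof.
have [C EC] := el_co_bnd E; exists (\sum_(i : el_ix E) Num.max 0 C).
  by apply: sumr_ge0 => i _; rewrite le_max lexx.
move=> r w; apply: le_trans (ler_norm_sum _ _ _) _; apply: ler_sum => i _.
rewrite normrM indicE normr_nat le_max; apply/orP; right.
by apply: le_trans (EC i w); rewrite ler_piMr// lern1 leq_b1.
Qed.

Lemma el_val_out t E r w : el_below t E -> ~ (0 < r <= t) -> el_val E r w = 0.
Proof.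
move=> Et rt; rewrite /el_val big1// => i _; rewrite indicE mem_setE in_itv/=.
case: andP => [[h1 h2]|_]; last by rewrite mulr0.
case: rt; rewrite (le_lt_trans (el_lo_ge0 E i) h1)/=.
exact: le_trans h2 (Et i).
Qed.

End elementary_operations.

Section ito_isometry.
Context d (T : measurableType d) (R : realType) (P : probability T R).
Variables (F : R -> set (set T)) (B : R -> T -> R).
Hypotheses (hF : filtration F) (hB : brownian_motion P F B).

Lemma el_isometry_below t (E : elementary F) : el_below t E ->
  nrm2 P (el_int E B) = ((moment2 R)%:E * st_nrm2 P t (el_val E))%E.
Proof.
move=> Et; rewrite /nrm2 (el_isometry hF hB) /st_nrm2; congr (_ * _)%E.
apply: eq_integral => w _; rewrite [RHS]integral_mkcond.
apply: eq_integral => r _; rewrite patchE; case: ifPn => // rt.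
rewrite (el_val_out w Et) ?expr0n// => /andP[r0 rt'].
by move: rt; rewrite notin_setE/= in_itv/= (ltW r0).
Qed.

End ito_isometry.

(** * Approximation of Ito integrals by elementary ones *)

Section approximation.
Context d (T : measurableType d) (R : realType) (P : probability T R).
Variables (F : R -> set (set T)) (B : R -> T -> R).
Hypotheses (hF : filtration F) (hB : brownian_motion P F B).
Local Notation c := (moment2 R).

Lemma st_nrm2S u t (K : R -> T -> R) : u <= t -> st_measurable u K -> st_measurable t K ->
  (st_nrm2 P u K <= st_nrm2 P t K)%E.
Proof.
move=> ut mu mt; rewrite !st_nrm2E//.
set g := fun z => K z.2 z.1 * \1_(`[0, t]) z.2.
have one (y : \bar R) : y = (1%:E * y + 0%:E * y)%E by rewrite mul1e mul0e adde0.
rewrite [leRHS]one.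
apply: nrm2_le => //.
move=> [w s] /=; rewrite /g/= !indicE !mem_setE !in_itv/= mul0r addr0 mul1r.
case: (leP 0 s) => //= s0; rewrite ?mulr0//.
by case: (leP s u) => su; [rewrite (le_trans su ut)|rewrite mulr0 expr0n sqr_ge0].
Qed.

Lemma el_int_brownian_sqint (E : elementary F) : sqint P (el_int E B).
Proof. by apply: (el_int_sqint hF) => s t; exact: (increment_sqint hF hB). Qed.

Lemma el_int_brownian_measurable (E : elementary F) : measurable_fun setT (el_int E B).
Proof. by case: (el_int_brownian_sqint E). Qed.

Lemma st_nrm2_null_le u (K K1 K2 : nat -> R -> T -> R) (a b : R) : 0 <= a -> 0 <= b ->
  (forall n, st_measurable u (K n)) -> (forall n, st_measurable u (K1 n)) ->
  (forall n, st_measurable u (K2 n)) ->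
  (forall n s w, 0 <= s <= u ->
    (K n s w) ^+ 2 <= a * (K1 n s w) ^+ 2 + b * (K2 n s w) ^+ 2) ->
  st_nrm2 P u (K1 n) @[n --> \oo] --> 0%E -> st_nrm2 P u (K2 n) @[n --> \oo] --> 0%E ->
  st_nrm2 P u (K n) @[n --> \oo] --> 0%E.
Proof.
move=> a0 b0 mK mK1 mK2 KK.
have E (L : nat -> R -> T -> R) : (forall n, st_measurable u (L n)) ->
    (fun n => st_nrm2 P u (L n)) = (fun n => nrm2 (P \x lebesgue_measure)%E
      (fun z => L n z.2 z.1 * \1_(`[0, u]) z.2)).
  by move=> mL; apply/funext => n; exact: st_nrm2E.
rewrite !E//; apply: (null2_le a0 b0) => // n [w s] /=; rewrite indicE.
have [|_] := boolP (s \in `[0, u]%classic); last by rewrite !mulr0 expr0n/= !mulr0 addr0.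
by rewrite inE/= in_itv/= !mulr1; exact: KK.
Qed.

(* One sequence serves all the horizons [u <= t], which [ito_integral] does not
   provide directly. *)
Definition approximable t (K I : R -> T -> R) := exists S : nat -> elementary F,
  [/\ forall n, el_below t (S n),
      st_nrm2 P t (fun s w => el_val (S n) s w - K s w) @[n --> \oo] --> 0%E &
      forall u (u0 : 0 <= u), u <= t ->
        null2 P (fun n w => el_int (el_trunc u0 (S n)) B w - I u w)].

(** The sequence for the horizon [t] also serves every [u <= t]: truncated at [u], it differs from
    the sequence that the definition provides for [u] by integrands tending to 0 on [[0, u]], so by
    the isometry the difference of the integrals tends to 0 as well. *)
Lemma ito_approximable t (K I : R -> T -> R) : 0 <= t ->
  (forall u, 0 <= u -> st_measurable u K) ->
  ito_integral P F B K I -> approximable t K I.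
Proof.
move=> t0 mK [_ mI ito].
have cK u (u0 : 0 <= u) : exists S : nat -> elementary F,
    [/\ forall n, el_below u (S n),
      st_nrm2 P u (fun s w => el_val (S n) s w - K s w) @[n --> \oo] --> 0%E &
      null2 P (fun n w => el_int (S n) B w - I u w)].
  have [S [SK SI]] := ito u u0.
  exists (fun n => el_trunc u0 (el_simple hF (S n))); split.
  - by move=> n; exact: el_trunc_below.
  - have -> : (fun n => st_nrm2 P u (fun s w =>
        el_val (el_trunc u0 (el_simple hF (S n))) s w - K s w)) = (fun n => (\int[P]_w
      \int[lebesgue_measure]_(s in `[0%R, u]) ((sp_val (S n) s w - K s w) ^+ 2)%:E)%E).
      apply/funext => n; apply: eq_integral => w _; apply: eq_integral => s.
      by rewrite inE/= in_itv/= => /andP[_ su]; rewrite el_val_trunc.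
    exact: SK.
  - rewrite /null2 /nrm2.
    have -> : (fun n => \int[P]_w ((el_int (el_trunc u0 (el_simple hF (S n))) B w -
        I u w) ^+ 2)%:E)%E = (fun n => \int[P]_w ((sp_int (S n) B u w - I u w) ^+ 2)%:E)%E.
      by apply/funext => n; apply: eq_integral => w _; rewrite el_int_simple.
    exact: SI.
have [S [St SK _]] := cK t t0; exists S; split => // u u0 ut.
have [S' [S'u S'K S'I]] := cK u u0.
pose D n := el_sub (S n) (S' n).
have mv n v : 0 <= v -> st_measurable v (fun s w => el_val (S n) s w - K s w).
  by move=> v0; apply: st_measurableB; [exact: el_val_measurable|exact: mK].
have mv' n v : 0 <= v -> st_measurable v (fun s w => el_val (S' n) s w - K s w).
  by move=> v0; apply: st_measurableB; [exact: el_val_measurable|exact: mK].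
have SKu : st_nrm2 P u (fun s w => el_val (S n) s w - K s w) @[n --> \oo] --> 0%E.
  apply: (squeeze_cvge _ (cvg_cst 0%E) SK); apply: nearW => n.
  by rewrite st_nrm2_ge0/= st_nrm2S//; exact: mv.
have Dn : null2 P (fun n => el_int (el_trunc u0 (D n)) B).
  rewrite /null2.
  have -> : (fun n => nrm2 P (el_int (el_trunc u0 (D n)) B)) =
      (fun n => c%:E * st_nrm2 P u (el_val (el_trunc u0 (D n))))%E.
    apply/funext => n; apply: (el_isometry_below hF hB).
    exact: el_trunc_below.
  rewrite [X in _ --> X](_ : _ = c%:E * 0)%E; last by rewrite mule0.
  apply: cvgeZl => //.
  apply: (@st_nrm2_null_le u _ _ _ 2 2 _ _ _ _ _ _ SKu S'K) => //.
  - by move=> n; exact: el_val_measurable.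
  - by move=> n; exact: mv.
  - by move=> n; exact: mv'.
  - move=> n s w /andP[_ su]; rewrite el_val_trunc// el_val_sub.
    move: (el_val _ _ _) (el_val _ _ _) (K s w) => x y z.
    by have := sqr_ge0 (x - z + (y - z)); nra.
have -> : (fun n w => el_int (el_trunc u0 (S n)) B w - I u w) =
    (fun n w => el_int (el_trunc u0 (D n)) B w + (el_int (el_trunc u0 (S' n)) B w - I u w)).
  by apply/funext => n; apply/funext => w; rewrite /D el_int_trunc_sub addrA subrK.
have trS' n w : el_int (el_trunc u0 (S' n)) B w = el_int (S' n) B w.
  rewrite el_int_trunc; apply: eq_bigr => i _.
  by rewrite !(min_idPl _)// ?S'u// (le_trans (el_lo_hi (S' n) i))// S'u.
apply: null2D => //.
- by move=> n; exact: el_int_brownian_measurable.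
- move=> n; apply: measurable_funB; first exact: el_int_brownian_measurable.
  exact: mI.
- have -> : (fun n w => el_int (el_trunc u0 (S' n)) B w - I u w) =
      (fun n w => el_int (S' n) B w - I u w).
    by apply/funext => n; apply/funext => w; rewrite trS'.
  exact: S'I.
Qed.

(** The integrand 1 is written as the indicator of [0 < s], which is exactly the value of [el_one]
    on [[0, t]]; the approximation errors for [K] and for its complement then agree up to sign at
    every point. *)
Lemma approximable_compl t (K I : R -> T -> R) : 0 <= t ->
  approximable t K I ->
  approximable t (fun s w => (0 < s)%R%:R - K s w) (fun u w => B u w - B 0 w - I u w).
Proof.
move=> t0 [S [St SK SI]]; exists (fun n => el_sub (el_one F t0) (S n)); split.
- by move=> n; apply: el_sub_below => // i /=.
- have -> : (fun n => st_nrm2 P t (fun s w => el_val (el_sub (el_one F t0) (S n)) s w -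
      ((0 < s)%R%:R - K s w))) =
    (fun n => st_nrm2 P t (fun s w => el_val (S n) s w - K s w)).
    apply/funext => n; apply: eq_integral => w _; apply: eq_integral => s.
    rewrite inE/= in_itv/= => /andP[s0 st].
    rewrite el_val_sub el_val_one indicE mem_setE in_itv/= st andbT.
    by congr (_%:E); ring.
  exact: SK.
- move=> u u0 ut; rewrite /null2 /nrm2.
  have -> : (fun n => \int[P]_w ((el_int (el_trunc u0 (el_sub (el_one F t0) (S n))) B w -
      (B u w - B 0 w - I u w)) ^+ 2)%:E)%E =
    (fun n => \int[P]_w ((el_int (el_trunc u0 (S n)) B w - I u w) ^+ 2)%:E)%E.
    apply/funext => n; apply: eq_integral => w _.
    by rewrite el_int_trunc_sub el_int_trunc_one//; congr (_%:E); ring.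
  exact: SI.
Qed.

(** By [el_int_mul], the product with [S n] integrates [E] against the running integral of [S n].
    That running integral converges in L^2 to [I] at each of the finitely many endpoints of [E], and
    the coefficients of [E] are bounded. *)
Lemma approximable_mul t (K I : R -> T -> R) (E : elementary F) :
  (forall u, 0 <= u <= t -> measurable_fun setT (I u)) ->
  approximable t K I -> el_below t E ->
  exists S : nat -> elementary F,
  [/\ forall n, el_below t (S n),
      st_nrm2 P t (fun s w => el_val (S n) s w - K s w) @[n --> \oo] --> 0%E &
      null2 P (fun n w => el_int E I w - el_int (el_mul hF E (S n)) B w)].
Proof.
move=> mI [S [St SK SI]] Et; exists S; split => //.
have h0 i : 0 <= el_hi E i := le_trans (el_lo_ge0 E i) (el_lo_hi E i).
have lt i : el_lo E i <= t := le_trans (el_lo_hi E i) (Et i).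
have -> : (fun n w => el_int E I w - el_int (el_mul hF E (S n)) B w) =
  (fun n w => \sum_i el_co E i w * (
    -1 * (el_int (el_trunc (h0 i) (S n)) B w - I (el_hi E i) w) +
    (el_int (el_trunc (el_lo_ge0 E i) (S n)) B w - I (el_lo E i) w))).
  apply/funext => n; apply/funext => w; rewrite el_int_mul [el_int E I w]/el_int -sumrB.
  by apply: eq_bigr => i _; rewrite !el_int_trunc; ring.
have mS n u (u0 : 0 <= u) : u <= t ->
    measurable_fun setT (fun w => el_int (el_trunc u0 (S n)) B w - I u w).
  move=> ut; apply: measurable_funB; first exact: el_int_brownian_measurable.
  by apply: mI; rewrite u0.
have m1S n u (u0 : 0 <= u) : u <= t ->
    measurable_fun setT (fun w => -1 * (el_int (el_trunc u0 (S n)) B w - I u w)).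
  by move=> ut; apply: measurable_funM => //; exact: mS.
have [C EC] := el_co_bnd E.
apply: null2_sum => [i n|i].
  apply: measurable_funM; first exact: (el_co_measurable hF).
  by apply: measurable_funD; [exact: m1S|exact: mS].
apply: (@null2M _ _ _ _ _ _ C) => //.
- exact: (el_co_measurable hF).
- by move=> n; apply: measurable_funD; [exact: m1S|exact: mS].
apply: null2D => //; [by move=> n; exact: m1S|by move=> n; exact: mS| |exact: SI].
apply: (@null2M _ _ _ _ _ _ 1) => //; last exact: SI.
- by move=> w; rewrite normrN1.
- by move=> n; exact: mS.
Qed.

(** The isometry for [E * K], as an inequality. The factor 4 arises from two uses of
    [(x + y) ^ 2 <= 2 * x ^ 2 + 2 * y ^ 2], one for the integrals and one for the integrands; the
    errors vanish as [n] grows. *)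
Lemma approximable_bound t (K I : R -> T -> R) (E : elementary F) :
  st_measurable t K -> (forall u, 0 <= u <= t -> measurable_fun setT (I u)) ->
  approximable t K I -> el_below t E ->
  (nrm2 P (el_int E I) <= (4 * c)%:E * st_nrm2 P t (fun s w => (el_val E s w * K s w)%R))%E.
Proof.
move=> mK mI aK Et; have [S [St SK SI]] := approximable_mul mI aK Et.
have [C C0 EC] := el_val_bnd E.
have mEI : measurable_fun setT (el_int E I).
  apply: measurable_sum => i; apply: measurable_funM; first exact: (el_co_measurable hF).
  by apply: measurable_funB; apply: mI; rewrite ?el_lo_ge0 ?Et
    ?(le_trans (el_lo_hi E i)) ?(le_trans (el_lo_ge0 E i)) ?el_lo_hi.
have mEK : st_measurable t (fun s w => el_val E s w * K s w).
  by apply: st_measurableM => //; exact: el_val_measurable.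
have mSK n : st_measurable t (fun s w => el_val (S n) s w - K s w).
  by apply: st_measurableB => //; exact: el_val_measurable.
have c0 := moment2_ge0 R.
pose e n : \bar R := ((2 * (c * (2 * C ^+ 2)))%:E *
    st_nrm2 P t (fun s w => (el_val (S n) s w - K s w)%R) +
  2%:E * nrm2 P (fun w => el_int E I w - el_int (el_mul hF E (S n)) B w)%R)%E.
apply: (@lee_null _ _ _ e).
  rewrite [X in _ --> X](_ : _ = (2 * (c * (2 * C ^+ 2)))%:E * 0 + 2%:E * 0)%E; last first.
    by rewrite !mule0 adde0.
  by apply: cvgeD; [rewrite !mule0|exact: cvgeZl|exact: cvgeZl].
move=> n; pose En := el_mul hF E (S n).
have mEn : measurable_fun setT (el_int En B) by exact: el_int_brownian_measurable.
have h1 : (nrm2 P (el_int E I) <= 2%:E * nrm2 P (el_int En B) +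
    2%:E * nrm2 P (fun w => el_int E I w - el_int En B w)%R)%E.
  apply: nrm2_le => //; first exact: measurable_funB.
  move=> w; move: (el_int E I w) (el_int En B w) => x y.
  by have := sqr_ge0 (y - (x - y)); nra.
have h2 : (st_nrm2 P t (el_val En) <= 2%:E * st_nrm2 P t (fun s w => (el_val E s w * K s w)%R) +
    (2 * C ^+ 2)%:E * st_nrm2 P t (fun s w => (el_val (S n) s w - K s w)%R))%E.
  apply: st_nrm2_le => //; first by rewrite mulr_ge0// sqr_ge0.
    exact: el_val_measurable.
  move=> s w _; rewrite el_val_mul.
  have : (el_val E s w) ^+ 2 <= C ^+ 2.
    by rewrite -real_normK ?num_real// lerXn2r ?nnegrE.
  move: (el_val E s w) (el_val (S n) s w) (K s w) => x y z xC.
  have /= : x ^+ 2 * (y - z) ^+ 2 <= C ^+ 2 * (y - z) ^+ 2 by rewrite ler_wpM2r// sqr_ge0.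
  by have := sqr_ge0 (x * z - x * (y - z)); nra.
apply: le_trans h1 _.
rewrite (el_isometry_below hF hB (t := t)); last exact: el_mul_below.
rewrite /e addeA leeD2r//.
apply: (@le_trans _ _ (2%:E * (c%:E * (2%:E * st_nrm2 P t (fun s w => (el_val E s w * K s w)%R) +
    (2 * C ^+ 2)%:E * st_nrm2 P t (fun s w => (el_val (S n) s w - K s w)%R))))%E).
  by rewrite lee_wpmul2l ?lee_fin// lee_wpmul2l ?lee_fin.
rewrite ge0_muleDr ?mule_ge0 ?lee_fin ?st_nrm2_ge0 ?mulr_ge0 ?sqr_ge0//.
rewrite ge0_muleDr ?mule_ge0 ?lee_fin ?st_nrm2_ge0 ?mulr_ge0 ?sqr_ge0//.
rewrite !muleA -!EFinM; rewrite (_ : 2 * c * 2 = 4 * c); last by ring.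
by rewrite (_ : 2 * c * (2 * C ^+ 2) = 2 * (c * (2 * C ^+ 2))); last by ring.
Qed.

Lemma approximable_mean0 t (K I : R -> T -> R) (E : elementary F) :
  (forall u, 0 <= u <= t -> measurable_fun setT (I u)) ->
  approximable t K I -> el_below t E ->
  sqint P (el_int E I) /\ (\int[P]_w (el_int E I w)%:E = 0)%E.
Proof.
move=> mI aK Et; have [S [St SK SI]] := approximable_mul mI aK Et.
apply: (mean0_lim _ _ _ SI).
- apply: measurable_sum => i; apply: measurable_funM; first exact: (el_co_measurable hF).
  by apply: measurable_funB; apply: mI; rewrite ?el_lo_ge0 ?Et
    ?(le_trans (el_lo_hi E i)) ?(le_trans (el_lo_ge0 E i)) ?el_lo_hi.
- by move=> n; exact: el_int_brownian_sqint.
- by move=> n; exact: (el_int_mean0 hF hB).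
Qed.

End approximation.

(** * Path functionals *)

Section half_line_functions.
Context (R : realType).
Implicit Types (f : R -> R) (a b s : R).

Lemma cvg_truncn_div s : 0 <= s ->
  (Num.truncn (n.+1%:R * s))%:R / n.+1%:R @[n --> \oo] --> s.
Proof.
move=> s0; apply: (@squeeze_cvgr _ _ _ _ (fun n => s - n.+1%:R^-1) (fun=> s)).
- apply: nearW => n.
  have /andP[h1 h2] := truncn_itv (mulr_ge0 (ler0n _ n.+1) s0).
  rewrite lerBlDr -[X in _ + X]mul1r -mulrDl ler_pdivlMr// ler_pdivrMr//.
  by rewrite [s * n.+1%:R]mulrC h1 natr1 ltW.
- rewrite -[X in _ --> X]subr0; apply: cvgB; first exact: cvg_cst.
  exact: cvg_harmonic.
- exact: cvg_cst.
Qed.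

Lemma within_cvg f (u : nat -> R) s : {within `[0, +oo[, continuous f} ->
  (forall n, 0 <= u n) -> 0 <= s -> u n @[n --> \oo] --> s -> f (u n) @[n --> \oo] --> f s.
Proof.
move=> cf u0 s0 us.
have := cvg_comp _ _ us (@continuous_maxr0 R _ cf s).
rewrite (max_idPr s0).
by rewrite (_ : (fun n => f (u n)) = (fun x => f (Num.max 0 x)) \o u)//;
  apply/funext => n /=; rewrite (max_idPr (u0 n)).
Qed.

(* The [dense_pt a b i j] are dense in [a, b]; the minimum with 1 keeps them in it. *)
Definition dense_pt a b (i j : nat) : R := a + (b - a) * Num.min 1 (i%:R / j.+1%:R).

Lemma dense_pt_itv a b i j : a <= b -> a <= dense_pt a b i j <= b.
Proof.
move=> ab; rewrite /dense_pt.
have h0 : 0 <= Num.min 1 (i%:R / j.+1%:R) :> R by rewrite le_min ler01 divr_ge0.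
have h1 : Num.min 1 (i%:R / j.+1%:R) <= 1 :> R by rewrite ge_min lexx.
by move: (Num.min _ _) h0 h1 => x x0 x1; apply/andP; split; nra.
Qed.

Lemma dense_ge f a b (c : R) : {within `[0, +oo[, continuous f} -> 0 <= a ->
  (forall i j, c <= f (dense_pt a b i j)) -> forall s, a <= s <= b -> c <= f s.
Proof.
move=> cf a0 fc s /andP[as_ sb].
have [ab|ab] := eqVneq a b.
  have -> : s = dense_pt a b 0 0 by rewrite /dense_pt ab subrr mul0r addr0; lra.
  exact: fc.
have ab2 : 0 < b - a by rewrite subr_gt0 lt_neqAle ab (le_trans as_).
pose x := (s - a) / (b - a).
have x0 : 0 <= x by apply: divr_ge0; lra.
have x1 : x <= 1 by rewrite ler_pdivrMr// mul1r lerB.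
have sE : s = a + (b - a) * x by rewrite /x; field; rewrite gt_eqF.
pose u n := dense_pt a b (Num.truncn (n.+1%:R * x)) n.
have uE n : u n = a + (b - a) * ((Num.truncn (n.+1%:R * x))%:R / n.+1%:R).
  rewrite /u /dense_pt (min_idPr _)// ler_pdivrMr// mul1r.
  have /andP[h _] := truncn_itv (mulr_ge0 (ler0n R n.+1) x0).
  by apply: le_trans h _; rewrite ler_piMr.
have us : u n @[n --> \oo] --> s.
  rewrite sE (_ : u = fun n => a + (b - a) * ((Num.truncn (n.+1%:R * x))%:R / n.+1%:R)).
    by apply: cvgD; [exact: cvg_cst|apply: cvgMr; exact: cvg_truncn_div].
  exact/funext.
have u0 n : 0 <= u n.
  by have /andP[h _] := dense_pt_itv (Num.truncn (n.+1%:R * x)) n (le_trans as_ sb);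
    exact: le_trans h.
have fu := within_cvg cf u0 (le_trans a0 as_) us.
by apply: (cvgr_to_ge fu); apply: nearW => n; exact: fc.
Qed.

Definition pos_on f a b := forall r, a <= r <= b -> 0 < f r.
Definition npos_on f a b := forall r, a <= r <= b -> f r <= 0.

Lemma within_segment f a b : {within `[0, +oo[, continuous f} -> 0 <= a ->
  {within `[a, b], continuous f}.
Proof.
move=> cf a0; apply: continuous_subspaceW cf => x /=.
by rewrite !in_itv/= andbT => /andP[+ _]; exact: le_trans.
Qed.

(** A continuous function that is positive on a compact interval has a positive minimum there. This
    turns positivity over an interval into a countable combination of conditions at single times,
    hence into an event. *)
Lemma pos_onP f a b : {within `[0, +oo[, continuous f} -> 0 <= a -> a <= b ->
  pos_on f a b <-> exists m : nat, forall i j, m.+1%:R^-1 <= f (dense_pt a b i j).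
Proof.
move=> cf a0 ab; split=> [fp|[m fm] r rab]; last first.
  by apply: lt_le_trans (dense_ge cf a0 fm rab); rewrite invr_gt0.
have [x xab fx] := EVT_min ab (within_segment cf a0).
have fx0 : 0 < f x by apply: fp; move: xab; rewrite in_itv.
exists (Num.truncn (f x)^-1) => i j.
apply: (@le_trans _ _ (f x)); last by apply: fx; rewrite in_itv/= dense_pt_itv.
by rewrite invf_ple ?posrE// ltW// truncnS_gt.
Qed.

Lemma npos_onP f a b : {within `[0, +oo[, continuous f} -> 0 <= a -> a <= b ->
  npos_on f a b <-> forall i j, f (dense_pt a b i j) <= 0.
Proof.
move=> cf a0 ab; split=> [fp i j|fp r rab]; first by apply: fp; exact: dense_pt_itv.
have cNf : {within `[0, +oo[, continuous (fun x => - f x)}.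
  by move=> x; apply: cvgN; exact: cf.
rewrite -oppr_ge0; apply: (dense_ge cNf a0 _ rab) => i j.
by rewrite oppr_ge0.
Qed.

End half_line_functions.

(** * Grids, stopping of down-closed conditions and left-point sums *)

Section grid.
Context (R : realType).
Implicit Types (f : R -> R) (D : R -> Prop) (a b s t : R).

Definition grid a b n i : R := a + i%:R * ((b - a) / n.+1%:R).

Lemma grid0 a b n : grid a b n 0 = a.
Proof. by rewrite /grid mul0r addr0. Qed.

Lemma grid_last a b n : grid a b n n.+1 = b.
Proof. by rewrite /grid mulrCA divff// mulr1 addrC subrK. Qed.

Lemma gridS a b n i : grid a b n i.+1 = grid a b n i + (b - a) / n.+1%:R.
Proof. by rewrite /grid -natr1 mulrDl mul1r addrA. Qed.

Lemma le_grid a b n i j : a <= b -> (i <= j)%N -> grid a b n i <= grid a b n j.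
Proof.
by move=> ab ij; rewrite lerD2l ler_wpM2r ?ler_nat// divr_ge0 ?subr_ge0.
Qed.

Lemma grid_ge a b n i : a <= b -> a <= grid a b n i.
Proof. by move=> ab; rewrite -[leLHS](grid0 a b n) le_grid. Qed.

Lemma grid_le a b n i : a <= b -> (i <= n.+1)%N -> grid a b n i <= b.
Proof. by move=> ab ij; rewrite -[leRHS](grid_last a b n) le_grid. Qed.

Lemma grid_cell a b n s : a < s <= b ->
  exists2 i, (i <= n)%N & grid a b n i < s <= grid a b n i.+1.
Proof.
move=> /andP[as_ sb].
have ex : exists i, s <= grid a b n i by exists n.+1; rewrite grid_last.
case: (ex_minnP ex) => -[|i] si min; first by move: si; rewrite grid0 leNgt as_.
exists i.
  by rewrite -ltnS; apply: min; rewrite grid_last.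
by rewrite si andbT ltNge; apply/negP => /min; rewrite ltnn.
Qed.

Lemma grid_cell_uniq a b n s i j : a <= b -> grid a b n i < s <= grid a b n i.+1 ->
  grid a b n j < s <= grid a b n j.+1 -> i = j.
Proof.
move=> ab /andP[i1 i2] /andP[j1 j2]; apply/eqP; rewrite eqn_leq; apply/andP; split.
  by rewrite leqNgt; apply/negP => /(le_grid n ab); lra.
by rewrite leqNgt; apply/negP => /(le_grid n ab); lra.
Qed.

(* For a down-closed [D], the time at which [D] stops holding, and [a] if [D] fails
   at once; the first element makes the supremum total. *)
Definition stop D a b : R := sup (a |` [set s | a <= s <= b /\ D s]).

Lemma stop_has_sup D a b : a <= b -> has_sup (a |` [set s | a <= s <= b /\ D s]).
Proof.
move=> ab; split; first by exists a; left.
by exists b => s [->//|[/andP[]]].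
Qed.

Lemma stop_ge D a b : a <= b -> a <= stop D a b.
Proof. by move=> ab; apply: (sup_upper_bound (stop_has_sup D ab)); left. Qed.

Lemma stop_le D a b : a <= b -> stop D a b <= b.
Proof.
move=> ab; apply: sup_le_ub; first by exists a; left.
by move=> s [->//|[/andP[]]].
Qed.

Lemma le_stop D a b s : a <= s <= b -> D s -> s <= stop D a b.
Proof.
move=> sab Ds; have ab : a <= b by case/andP: sab; exact: le_trans.
by apply: (sup_upper_bound (stop_has_sup D ab)); right.
Qed.

Definition down_closed a D := forall s r, a <= s -> s <= r -> D r -> D s.

Lemma lt_stop D a b s : down_closed a D -> a <= b -> a <= s -> s < stop D a b -> D s.
Proof.
move=> dD ab as_ ss; have := sup_adherent _ (stop_has_sup D ab).
move=> /(_ (stop D a b - s)); rewrite subr_gt0 => /(_ ss)[r].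
rewrite subKr => -[->|[rab Dr]] sr; first by move: sr; rewrite ltNge as_.
by apply: dD Dr => //; exact: ltW.
Qed.

Lemma stop_le_not D a b s : down_closed a D -> a <= b -> a <= s -> ~ D s -> stop D a b <= s.
Proof. by move=> dD ab as_ nDs; rewrite leNgt; apply/negP => /(lt_stop dD ab as_). Qed.

(** The condition is tested at the left end of each cell, so that with an adapted event in place of
    [D] this is the integral of an elementary integrand. *)
Definition grid_sum D a b n f : R :=
  \sum_(i < n.+1) `[<D (grid a b n i)>]%:R * (f (grid a b n i.+1) - f (grid a b n i)).

(** Let [j] be the least index at which [D] fails on the grid, or [n + 1]. As [D] is down-closed,
    exactly the cells before [j] contribute and the sum telescopes to the grid point [j], which
    exceeds [stop D a b] by at most one mesh. *)
Lemma grid_sumE D a b n f : down_closed a D -> a <= b ->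
  exists2 t, `|t - stop D a b| <= (b - a) / n.+1%:R & a <= t <= b /\
    grid_sum D a b n f = f t - f a.
Proof.
move=> dD ab.
pose Q j := (j == n.+1) || ~~ `[<D (grid a b n j)>].
have exQ : exists j, Q j by exists n.+1; rewrite /Q eqxx.
case: (ex_minnP exQ) => j Qj min.
have jn : (j <= n.+1)%N by apply: min; rewrite /Q eqxx.
have Dj i : (i < n.+1)%N -> `[<D (grid a b n i)>] = (i < j)%N.
  move=> iN; apply/idP/idP => [Di|ij].
    rewrite ltnNge; apply/negP => ji; move/orP: Qj => [/eqP jE|].
      by move: iN; rewrite -jE ltnNge ji.
    move=> /negP; apply; apply/asboolP; move/asboolP: Di.
    by apply: dD; [exact: grid_ge|exact: le_grid].
  apply: contraT => nDi; have : Q i by rewrite /Q nDi orbT.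
  by move/min; rewrite leqNgt ij.
exists (grid a b n j); last first.
  split; first by rewrite grid_ge ?grid_le.
  rewrite /grid_sum -[X in _ - f X](grid0 a b n).
  rewrite -(telescope_sumr (fun i => f (grid a b n i)) (leq0n j)).
  rewrite big_mkord (big_ord_widen _ (fun k => f (grid a b n k.+1) - f (grid a b n k)) jn).
  rewrite [RHS]big_mkcond; apply: eq_bigr => i _; rewrite Dj//.
  by case: ifP; rewrite ?mul1r ?mul0r.
have h0 : 0 <= (b - a) / n.+1%:R by rewrite divr_ge0 ?subr_ge0.
have up : stop D a b <= grid a b n j.
  move/orP: Qj => [/eqP ->|/asboolPn nDj]; first by rewrite grid_last stop_le.
  by apply: stop_le_not => //; exact: grid_ge.
rewrite ger0_norm ?subr_ge0// lerBlDl.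
case: j Qj min jn Dj up => [|j] Qj min jn Dj up.
  by rewrite grid0; apply: (le_trans (stop_ge D ab)); rewrite lerDl.
rewrite gridS lerD2r; apply: le_stop; first by rewrite grid_ge// grid_le// ltnW.
by apply/asboolP; rewrite Dj.
Qed.

Lemma grid_sum_cvg D a b f : {within `[0, +oo[, continuous f} -> 0 <= a ->
  down_closed a D -> a <= b ->
  grid_sum D a b n f @[n --> \oo] --> f (stop D a b) - f a.
Proof.
move=> cf a0 dD ab.
have ex n : exists t, `|t - stop D a b| <= (b - a) / n.+1%:R /\
    (a <= t <= b /\ grid_sum D a b n f = f t - f a).
  by case: (grid_sumE n f dD ab) => t t1 t2; exists t.
have [t tP] := choice ex.
have -> : (fun n => grid_sum D a b n f) = (fun n => f (t n) - f a).
  by apply/funext => n; case: (tP n) => _ [].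
apply: cvgB; last exact: cvg_cst.
apply: within_cvg => //.
- by move=> n; case: (tP n) => _ [/andP[h _] _]; exact: le_trans h.
- exact: le_trans a0 (stop_ge D ab).
- have e0 : (b - a) / n.+1%:R @[n --> \oo] --> 0.
    rewrite [X in _ --> X](_ : _ = (b - a) * 0); last by rewrite mulr0.
    by apply: cvgMr; exact: cvg_harmonic.
  apply/cvgrPdist_le => e e_gt0; near=> n.
  rewrite distrC; apply: (le_trans (tP n).1); apply: (le_trans (ler_norm _)).
  rewrite -normrN -sub0r; near: n.
  by move/cvgrPdist_le: e0; apply.
Unshelve. all: by end_near. Qed.

End grid.

(** * Events along continuous adapted paths, and locality of the integral *)

Section events.
Context d (T : measurableType d) (R : realType).
Variables (F : R -> set (set T)) (N : R -> T -> R).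
Hypotheses (hF : filtration F) (cN : continuous_paths N)
  (aN : forall u, 0 <= u -> smeas (F u) (N u)).

Let smeas_dense a b i j : 0 <= a -> a <= b -> smeas (F b) (N (dense_pt a b i j)).
Proof.
move=> a0 ab; have /andP[h1 h2] := dense_pt_itv i j ab.
exact: (filtration_smeas hF (le_trans a0 h1) h2 (aN (le_trans a0 h1))).
Qed.

Lemma pos_on_event a b : 0 <= a -> a <= b ->
  <<s F b >> [set w | pos_on (N ^~ w) a b].
Proof.
move=> a0 ab.
have -> : [set w | pos_on (N ^~ w) a b] = \bigcup_m \bigcap_i \bigcap_j
    (N (dense_pt a b i j) @^-1` [set x | m.+1%:R^-1 <= x]).
  apply/seteqP; split => w.
    by move=> /(pos_onP (@cN w) a0 ab)[m mN]; exists m => // i _ j _; exact: mN.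
  by move=> [m _ mN]; apply/(pos_onP (@cN w) a0 ab); exists m => i j; exact: mN.
apply: (@bigcup_measurable _ (g_sigma_algebraType (F b))) => m _.
apply: (@bigcap_measurable _ (g_sigma_algebraType (F b))) => // i _.
apply: (@bigcap_measurable _ (g_sigma_algebraType (F b))) => // j _.
have := smeas_dense i j a0 ab measurableT (measurable_itv `[m.+1%:R^-1, +oo[).
rewrite setTI; congr (_ _); apply/seteqP; split => w /=;
  by rewrite in_itv/= andbT.
Qed.

Lemma npos_on_event a b : 0 <= a -> a <= b ->
  <<s F b >> [set w | npos_on (N ^~ w) a b].
Proof.
move=> a0 ab.
have -> : [set w | npos_on (N ^~ w) a b] = \bigcap_i \bigcap_j
    (N (dense_pt a b i j) @^-1` [set x | x <= 0]).
  apply/seteqP; split => w.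
    by move=> /(npos_onP (@cN w) a0 ab) mN i _ j _; exact: mN.
  by move=> mN; apply/(npos_onP (@cN w) a0 ab) => i j; exact: mN.
apply: (@bigcap_measurable _ (g_sigma_algebraType (F b))) => // i _.
apply: (@bigcap_measurable _ (g_sigma_algebraType (F b))) => // j _.
have := smeas_dense i j a0 ab measurableT (measurable_itv `]-oo, 0]).
by rewrite setTI; congr (_ _); apply/seteqP; split => w /=; rewrite in_itv/=.
Qed.

End events.

Section grid_process.
Context d (T : measurableType d) (R : realType).
Variables (F : R -> set (set T)) (a b : R) (a0 : 0 <= a) (ab : a <= b).
Variables (A : R -> set T) (FA : forall s, a <= s <= b -> <<s F s >> (A s)) (n : nat).

Let lo (i : 'I_n.+1) := grid a b n i.
Let hi (i : 'I_n.+1) := grid a b n i.+1.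
Let co (i : 'I_n.+1) : T -> R := \1_(A (grid a b n i)).

Let g_lo_ge0 i : 0 <= lo i. Proof. exact: le_trans (grid_ge n i ab). Qed.
Let g_lo_hi i : lo i <= hi i. Proof. exact: le_grid. Qed.
Let g_smeas i : smeas (F (lo i)) (co i).
Proof.
apply: smeas_indic; apply: FA.
by rewrite grid_ge// grid_le// ltnW.
Qed.
Let g_bnd : exists C : R, forall i w, `|co i w| <= C.
Proof. by exists 1 => i w; rewrite /co indicE normr_nat lern1 leq_b1. Qed.

Definition el_grid := Elementary g_lo_ge0 g_lo_hi g_smeas g_bnd.

Lemma el_grid_below : el_below b el_grid.
Proof. by move=> i; exact: grid_le. Qed.

Lemma el_int_grid N w : el_int el_grid N w = grid_sum (fun s => A s w) a b n (N ^~ w).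
Proof.
by apply: eq_bigr => i _ /=; rewrite /co indicE; congr (_%:R * _).
Qed.

Lemma el_val_grid i s w : (i <= n)%N -> grid a b n i < s <= grid a b n i.+1 ->
  el_val el_grid s w = \1_(A (grid a b n i)) w.
Proof.
move=> iN si; rewrite /el_val (bigD1 (Ordinal (iN : (i < n.+1)%N)))//= big1.
  by rewrite addr0 /co /lo /hi /= !indicE [s \in _]mem_set ?mulr1//= in_itv.
move=> j ji; rewrite /lo /hi indicE memNset ?mulr0//= in_itv/= => sj.
by move/eqP: ji; apply; apply: val_inj; exact: (grid_cell_uniq ab sj si).
Qed.

Lemma el_val_grid_out s w : ~~ (a < s <= b) -> el_val el_grid s w = 0.
Proof.
move=> sab; rewrite /el_val big1// => i _; rewrite /lo /hi indicE memNset ?mulr0//= in_itv/=.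
apply: contraNnot sab => /andP[h1 h2]; rewrite (le_lt_trans (grid_ge n i ab) h1)/=.
by apply: le_trans h2 _; exact: grid_le.
Qed.

Lemma el_val_grid_le1 s w : `|el_val el_grid s w| <= 1.
Proof.
have [/(grid_cell n)[i iN si]|sab] := boolP (a < s <= b).
  by rewrite (el_val_grid w iN si) indicE normr_nat lern1 leq_b1.
by rewrite el_val_grid_out// normr0.
Qed.

End grid_process.

Section small_support.
Context d (T : measurableType d) (R : realType) (P : probability T R).

(** The support in time may depend on [w]; only its length has to be uniform, because the inner
    integral is bounded separately for each [w]. *)
Lemma st_nrm2_small (b delta : R) (g : R -> T -> R) : 0 <= delta ->
  st_measurable b g -> (forall s w, `|g s w| <= 1) ->
  (forall w, exists theta, forall s, 0 < s <= b -> g s w != 0 ->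
    theta <= s <= theta + delta) ->
  (st_nrm2 P b g <= delta%:E)%E.
Proof.
move=> d0 mg g1 gs.
have inner w : (\int[lebesgue_measure]_(s in `[0%R, b]) ((g s w) ^+ 2)%:E <= delta%:E)%E.
  have [theta gt] := gs w.
  (* The support hypothesis concerns positive times only; the added point 0 has measure zero. *)
  pose D : set (measurableTypeR R) := `[theta, theta + delta] `|` [set 0].
  have mD : measurable D.
    by apply: measurableU; [exact: measurable_itv|exact: measurable_set1].
  apply: (@le_trans _ _ (\int[lebesgue_measure]_s (\1_D s)%:E)%E).
    rewrite [leLHS]integral_mkcond; apply: ge0_le_integral => //.
    - move=> s _; rewrite patchE; case: ifP => // _; by rewrite lee_fin sqr_ge0.
    - have mgw : measurable_fun [set: measurableTypeR R] (fun s => g s w * \1_(`[0, b]) s).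
        exact: (measurableT_comp mg (@measurable_pair1 _ _ T (measurableTypeR R) w)).
      have -> : (fun s => ((g s w) ^+ 2)%:E) \_ `[0, b]%classic =
          (fun s => ((g s w * \1_(`[0, b]) s) ^+ 2)%:E).
        apply/funext => s; rewrite patchE indicE.
        by case: ifP => _; rewrite ?mulr1// mulr0 expr0n.
      by apply/measurable_EFinP; exact: measurable_funX.
    - by apply/measurable_EFinP; exact: measurable_indic.
    - move=> s _; rewrite patchE; case: ifP => [sb|_]; last first.
        by rewrite -[point]/(0%:E) lee_fin.
      rewrite lee_fin indicE; move: sb; rewrite inE/= in_itv/= => /andP[s0 sb].
      case: (boolP (s \in D)) => sD.
        by rewrite /= -[leRHS](expr1n _ 2) -real_normK ?num_real// lerXn2r ?nnegrE.
      have [gs0|gs0] := eqVneq (g s w) 0; first by rewrite gs0 expr0n.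
      exfalso; move: sD; apply/negP; rewrite negbK inE /D /=.
      have [->|sn0] := eqVneq s 0; first by right.
      by left; rewrite in_itv/=; apply: gt => //; rewrite lt_neqAle eq_sym sn0 s0.
  rewrite integral_indic//= setIT.
  apply: (le_trans (measureU2 _ _ _)) => //.
  rewrite [X in (_ + X)%E](_ : _ = 0%E); last exact: lebesgue_measure_set1.
  rewrite adde0 [leLHS](_ : _ = lebesgue_measure `[theta, theta + delta]%classic)//.
  rewrite lebesgue_measure_itv/=.
  case: ifP => _; last by rewrite lee_fin.
  by rewrite -EFinD lee_fin addrAC subrr add0r.
have mout : measurable_fun setT (fun w => \int[lebesgue_measure]_(s in `[0%R, b]) ((g s w) ^+ 2)%:E)%E.
  have m2 : measurable_fun [set: T * measurableTypeR R]
      (EFin \o (fun z => (g z.2 z.1 * \1_(`[0, b]) z.2) ^+ 2)).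
    by apply/measurable_EFinP; exact: measurable_funX.
  have := measurable_fun_fubini_tonelli_F (m2 := @lebesgue_measure R) _ m2.
  move=> /(_ _)/wrap[]; first by move=> z; rewrite lee_fin sqr_ge0.
  congr measurable_fun; apply/funext => w; rewrite /fubini_F [RHS]integral_mkcond.
  apply: eq_integral => s _ /=; rewrite patchE indicE.
  by case: ifPn => _; rewrite ?mulr1// mulr0 expr0n.
apply: (@le_trans _ _ (\int[P]_w delta%:E)%E).
  apply: ge0_le_integral => //.
  by move=> w _; apply: integral_ge0 => s _; rewrite lee_fin sqr_ge0.
rewrite integral_cst//= [X in (_ * X)%E](_ : _ = 1%E) ?mule1//.
exact: probability_setT.
Qed.

End small_support.

Section locality.
Context d (T : measurableType d) (R : realType) (P : probability T R).
Variables (F : R -> set (set T)) (hF : filtration F).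
Variables (a b : R) (a0 : 0 <= a) (ab : a <= b).
Variables (A : R -> set T) (FA : forall s, a <= s <= b -> <<s F s >> (A s)).
Hypothesis dA : forall w, down_closed a (fun s => A s w).

(** [K] vanishes as long as [A] holds, and the grid process is switched off from the first grid
    point at which [A] fails. The product therefore lives in the single cell in which [A] stops. *)
Lemma el_grid_small n (K : R -> T -> R) : st_measurable b K ->
  (forall s w, `|K s w| <= 1) ->
  (forall s w, a < s <= b -> A s w -> K s w = 0) ->
  (st_nrm2 P b (fun s w => (el_val (el_grid a0 ab FA n) s w * K s w)%R) <=
   ((b - a) / n.+1%:R)%:E)%E.
Proof.
move=> mK K1 KA; apply: st_nrm2_small.
- by rewrite divr_ge0 ?subr_ge0.
- by apply: st_measurableM => //; exact: (el_val_measurable hF).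
- move=> s w; rewrite normrM -[leRHS]mulr1 ler_pM//.
  exact: el_val_grid_le1.
- move=> w; exists (stop (fun s => A s w) a b) => s /andP[s0 sb] /eqP gs.
  have [sab|sab] := boolP (a < s <= b); last first.
    by case: gs; rewrite el_val_grid_out// mul0r.
  have [i iN /andP[si1 si2]] := grid_cell n sab.
  have [Ai|nAi] := pselect (A (grid a b n i) w); last first.
    case: gs; rewrite (el_val_grid a0 ab FA w iN) ?si1//.
    by rewrite indicE memNset// mul0r.
  have nAs : ~ A s w by move=> /(KA _ _ sab) Ks; case: gs; rewrite Ks mulr0.
  rewrite (stop_le_not (@dA w) ab _ nAs) /=; last by case/andP: sab => /ltW.
  apply: (le_trans si2); rewrite gridS lerD2r; apply: le_stop => //.
  by rewrite grid_ge// grid_le// ltnW.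
Qed.

(** On [A b] the condition holds at every grid point, so the grid integral telescopes to
    [I b - I a]; its square norm is at most [k] times the mesh. The statement is kept abstract
    because it serves both for the integral of the solution and for the complementary one. *)
Lemma increment_null (I K : R -> T -> R) (k : R) : 0 <= k -> st_measurable b K ->
  (forall s w, `|K s w| <= 1) ->
  (forall s w, a < s <= b -> A s w -> K s w = 0) ->
  (forall u, 0 <= u <= b -> measurable_fun setT (I u)) ->
  (forall E : elementary F, el_below b E ->
    (nrm2 P (el_int E I) <= k%:E * st_nrm2 P b (fun s w => (el_val E s w * K s w)%R))%E) ->
  {ae P, forall w, A b w -> I b w = I a w}.
Proof.
move=> k0 mK K1 KA mI Ik.
pose f w := \1_(A b) w * (I b w - I a w).
have mA : measurable_fun setT (\1_(A b) : T -> R).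
  apply: (smeas_measurable (filtration_sub hF (le_trans a0 ab))).
  by apply: smeas_indic; apply: FA; rewrite ab lexx.
have mf : measurable_fun setT f.
  by apply: measurable_funM => //; apply: measurable_funB; apply: mI;
    rewrite ?a0 ?ab ?lexx ?(le_trans a0 ab).
pose E n := el_grid a0 ab FA n.
have mE n : measurable_fun setT (el_int (E n) I).
  apply: measurable_sum => i; apply: measurable_funM; first exact: (el_co_measurable hF).
  have h := @el_grid_below _ _ _ _ _ _ a0 ab _ FA n.
  by apply: measurable_funB; apply: mI; rewrite ?el_lo_ge0 ?h
    ?(le_trans (el_lo_hi (E n) i)) ?(le_trans (el_lo_ge0 (E n) i)) ?el_lo_hi.
have fE n : (nrm2 P f <= (k * ((b - a) / n.+1%:R))%:E)%E.
  apply: (@le_trans _ _ (nrm2 P (el_int (E n) I))).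
    apply: ge0_le_integral => //.
    - by move=> w _; rewrite lee_fin sqr_ge0.
    - exact: measurable_sqr.
    - exact: measurable_sqr.
    move=> w _; rewrite lee_fin /f indicE.
    have [Ab|nAb] := pselect (A b w); last by rewrite memNset// mul0r expr0n sqr_ge0.
    rewrite mem_set// mul1r (el_int_grid a0 ab FA) /grid_sum.
    rewrite (eq_bigr (fun i : 'I_n.+1 => I (grid a b n i.+1) w - I (grid a b n i) w)); last first.
      move=> i _; rewrite asboolT ?mul1r//.
      by apply: (dA (grid_ge n i ab) _ Ab); rewrite grid_le// ltnW.
    rewrite -(big_mkord xpredT (fun i => I (grid a b n i.+1) w - I (grid a b n i) w)).
    by rewrite telescope_sumr// grid0 grid_last.
  apply: (le_trans (Ik _ _)); first exact: el_grid_below.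
  rewrite EFinM; apply: lee_wpmul2l; rewrite ?lee_fin//.
  exact: el_grid_small.
have f0 : nrm2 P f = 0%E.
  apply/eqP; rewrite eq_le nrm2_ge0 andbT.
  have e0 : ((k * ((b - a) / n.+1%:R))%:E)%E @[n --> \oo] --> 0%E.
    apply: cvg_EFin; first exact: nearW.
    rewrite [X in _ --> X](_ : _ = k * ((b - a) * 0)); last by rewrite !mulr0.
    by apply: cvgMr; apply: cvgMr; exact: cvg_harmonic.
  by apply: (lee_null e0) => n; rewrite add0e.
apply: filterS (nrm2_eq0_ae mf f0) => w + Ab.
by rewrite /f indicE mem_set// mul1r => /eqP; rewrite subr_eq0 => /eqP.
Qed.

End locality.

(** * The exit time from the positive half-line *)

Section hitting_time.
Context (R : realType).
Implicit Types (f : R -> R) (s t : R).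

(** For continuous [f], the first time at which [f] is non-positive, capped at [t]. The cap keeps
    the value finite and makes it depend on [f] up to time [t] only. *)
Definition hit f t : R := stop (pos_on f 0) 0 t.

Lemma pos_on_down f : down_closed 0 (pos_on f 0).
Proof.
move=> s r s0 sr fr u /andP[u0 us]; apply: fr.
by rewrite u0 (le_trans us).
Qed.

Lemma hit_ge0 f t : 0 <= t -> 0 <= hit f t. Proof. exact: stop_ge. Qed.

Lemma hit_le f t : 0 <= t -> hit f t <= t. Proof. exact: stop_le. Qed.

Lemma lt_hit f t s : 0 <= t -> 0 <= s -> s < hit f t -> pos_on f 0 s.
Proof. by move=> t0 s0 h; exact: (lt_stop (@pos_on_down f) t0 s0 h). Qed.

Lemma hit_pos f t : 0 <= t -> pos_on f 0 t -> hit f t = t.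
Proof.
move=> t0 ft; apply/eqP; rewrite eq_le hit_le//=; apply: le_stop => //.
by rewrite t0 lexx.
Qed.

Lemma hit_min f s t : 0 <= s -> s <= t -> hit f s = Num.min (hit f t) s.
Proof.
move=> s0 st; have t0 := le_trans s0 st.
(* As [m < hit f u], the function is positive on [[0, m]]; if [m <= v], then [m] would compete in
   the supremum defining [hit f v]. *)
have key u v m : 0 <= u -> 0 <= v -> hit f v < m -> m < hit f u -> v < m.
  move=> u0 v0 m1 m2; rewrite ltNge; apply/negP => mv.
  have m0 : 0 <= m := le_trans (hit_ge0 f v0) (ltW m1).
  have fm := lt_hit u0 m0 m2.
  have : m <= hit f v by apply: le_stop => //; rewrite m0.
  by rewrite leNgt m1.
have ht := hit_le f t0; have hs := hit_le f s0.
apply/eqP; rewrite eq_le le_min hs andbT; apply/andP; split; rewrite leNgt; apply/negP => h.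
  have := @key s t ((hit f t + hit f s) / 2) s0 t0; lra.
move: h; rewrite lt_min => /andP[h1 h2].
pose m := Num.min (hit f t) s.
have := @key t s ((m + hit f s) / 2) t0 s0.
have : hit f s < m by rewrite lt_min h1.
have : m <= s by rewrite ge_min lexx orbT.
have : m <= hit f t by rewrite ge_min lexx.
by move: m => m; lra.
Qed.

Lemma hit_lipschitz f s t : 0 <= s -> 0 <= t -> `|hit f t - hit f s| <= `|t - s|.
Proof.
wlog st : s t / s <= t.
  move=> h s0 t0; have [st|ts] := leP s t; first exact: h.
  by rewrite distrC [leRHS]distrC; apply: h => //; exact: ltW.
move=> s0 t0; rewrite (hit_min f s0 st) ![`|_|]ger0_norm ?subr_ge0 ?ge_min ?lexx//.
by have := hit_le f t0; case: (leP (hit f t) s) => h; lra.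
Qed.

Lemma cvg_hit f t (u : nat -> R) : 0 <= t -> (forall n, 0 <= u n) ->
  u n @[n --> \oo] --> t -> hit f (u n) @[n --> \oo] --> hit f t.
Proof.
move=> t0 u0 ut; apply/cvgrPdist_le => e e0; near=> n.
apply: (le_trans (hit_lipschitz f (u0 n) t0)).
near: n; by move/cvgrPdist_le: ut; apply.
Unshelve. all: by end_near. Qed.

(** If [f] were positive at the hitting time, that time would lie strictly before [t], and by
    maximality non-positive values of [f] would occur immediately after it; continuity carries their
    sign to the hitting time. *)
Lemma hit_npos f t : {within `[0, +oo[, continuous f} -> 0 <= t -> ~ pos_on f 0 t ->
  f (hit f t) <= 0.
Proof.
move=> cf t0 nft; rewrite leNgt; apply/negP => fh.
have h0 := hit_ge0 f t0; have ht := hit_le f t0.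
have fpos r : 0 <= r -> r <= hit f t -> 0 < f r.
  move=> r0; rewrite le_eqVlt => /predU1P[->//|rh].
  by apply: (lt_hit t0 r0 rh); rewrite r0 lexx.
have [ht'|th'] := ltP (hit f t) t; last first.
  by apply: nft => r /andP[r0 rt]; apply: fpos => //; exact: le_trans th'.
pose u n := hit f t + (t - hit f t) * n.+1%:R^-1.
have uh : u n @[n --> \oo] --> hit f t.
  rewrite -[X in _ --> X]addr0 -[X in _ --> _ + X](mulr0 (t - hit f t)).
  by apply: cvgD; [exact: cvg_cst|apply: cvgMr; exact: cvg_harmonic].
have hu n : hit f t < u n <= t.
  have i0 : 0 < n.+1%:R^-1 :> R by rewrite invr_gt0.
  have i1 : n.+1%:R^-1 <= 1 :> R by rewrite invf_le1// ler1n.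
  by rewrite /u; move: (n.+1%:R^-1) i0 i1 => x i0 i1; apply/andP; split; nra.
have ex n : exists r, hit f t < r <= u n /\ f r <= 0.
  have /andP[h1 h2] := hu n.
  apply: contrapT => nex; have : u n <= hit f t.
    apply: le_stop; first by rewrite (le_trans h0 (ltW h1)).
    move=> r /andP[r0 ru]; have [rh|hr] := leP r (hit f t); first exact: fpos.
    rewrite ltNge; apply/negP => fr; apply: nex; exists r.
    by rewrite hr ru.
  by rewrite leNgt h1.
have [v vP] := choice ex.
have vh : v n @[n --> \oo] --> hit f t.
  apply: (@squeeze_cvgr _ _ _ _ (fun=> hit f t) u) => //; last exact: cvg_cst.
  by apply: nearW => n; have [/andP[/ltW -> ->] _] := vP n.
have v0 n : 0 <= v n by have [/andP[/ltW h _] _] := vP n; exact: le_trans h.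
have fv := within_cvg cf v0 h0 vh.
have : f (hit f t) <= 0 by apply: (cvgr_to_le fv); apply: nearW => n; case: (vP n).
by rewrite leNgt fh.
Qed.

End hitting_time.

Section rational_times.
Context (R : realType).

Definition rtime (i j : nat) : R := i%:R / j.+1%:R.

Lemma rtime_ge0 i j : 0 <= rtime i j. Proof. by rewrite divr_ge0. Qed.

Lemma rtime_cvg (s : R) : 0 <= s -> exists u : nat -> nat * nat,
  (forall n, rtime (u n).1 (u n).2 <= s) /\ rtime (u n).1 (u n).2 @[n --> \oo] --> s.
Proof.
move=> s0; exists (fun n => (Num.truncn (n.+1%:R * s), n)); split => [n|] /=.
  have /andP[h _] := truncn_itv (mulr_ge0 (ler0n R n.+1) s0).
  by rewrite /rtime ler_pdivrMr// [s * _]mulrC.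
exact: cvg_truncn_div.
Qed.

Lemma rtime_cvg_gt (s : R) : 0 <= s -> exists u : nat -> nat * nat,
  (forall n, s < rtime (u n).1 (u n).2) /\ rtime (u n).1 (u n).2 @[n --> \oo] --> s.
Proof.
move=> s0; exists (fun n => ((Num.truncn (n.+1%:R * s)).+1, n)); split => [n|] /=.
  have /andP[_ h] := truncn_itv (mulr_ge0 (ler0n R n.+1) s0).
  by rewrite /rtime ltr_pdivlMr// [s * _]mulrC.
rewrite (_ : (fun n => _) = (fun n => (Num.truncn (n.+1%:R * s))%:R / n.+1%:R + n.+1%:R^-1)).
  by rewrite -[X in _ --> X]addr0; apply: cvgD; [exact: cvg_truncn_div|exact: cvg_harmonic].
by apply/funext => n; rewrite /rtime -natr1 mulrDl mul1r.
Qed.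

(** The hypothesis sees only rational times inside [[a, b]], so [a] is approached from above and [b]
    from below. It is the bridge from countably many almost sure statements to all real times. *)
Lemma constant_rtime (g : R -> R) (a b : R) : {within `[0, +oo[, continuous g} ->
  0 <= a -> a <= b ->
  (forall i j k l, a <= rtime i j -> rtime i j <= rtime k l -> rtime k l <= b ->
    g (rtime i j) = g (rtime k l)) -> g a = g b.
Proof.
move=> cg a0 + gr; rewrite le_eqVlt => /predU1P[->//|ab].
have [u [ua uc]] := rtime_cvg_gt a0.
have [v [vb vc]] := rtime_cvg (le_trans a0 (ltW ab)).
have gu := within_cvg cg (fun n => rtime_ge0 _ _) a0 uc.
have gv := within_cvg cg (fun n => rtime_ge0 _ _) (le_trans a0 (ltW ab)) vc.
have h1 : a < (a + b) / 2 by lra.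
have h2 : (a + b) / 2 < b by lra.
have n1 := cvgr_le _ uc _ h1.
have n2 := cvgr_ge _ vc _ h2.
have gv' : g (rtime (u n).1 (u n).2) @[n --> \oo] --> g b.
  apply: cvg_trans gv; apply: near_eq_cvg.
  near=> n; apply/esym/gr => //; first exact: (ltW (ua n)).
  apply: (@le_trans _ _ ((a + b) / 2)); first by near: n; exact: n1.
  by near: n; exact: n2.
exact: (cvg_unique (@norm_hausdorff _ _) gu gv').
Unshelve. all: by end_near. Qed.

End rational_times.

(** * Every solution is given by the explicit formula *)

Lemma limn_einf_le (R : realType) (u : nat -> \bar R) (k : \bar R) :
  (forall n, u n <= k)%E -> (limn_einf u <= k)%E.
Proof.
move=> uk; rewrite limn_einf_lim; apply: lime_le; first exact: is_cvg_einfs.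
by apply: nearW => n; apply: le_trans (uk n); apply: ereal_inf_lbound; exists n => //=.
Qed.

Lemma mean0_limit_ge0 d (T : measurableType d) (R : realType) (P : probability T R)
    (f : nat -> T -> R) (g : T -> R) (C : R) :
  (forall n, sqint P (f n)) -> (forall n, \int[P]_w (f n w)%:E = 0)%E ->
  (forall n, nrm2 P (f n) <= C%:E)%E ->
  (forall w, f n w @[n --> \oo] --> g w) -> {ae P, forall w, 0 <= g w} ->
  {ae P, forall w, g w = 0}.
Proof.
move=> f2 f0 fC fg g0.
have mf n : measurable_fun setT (f n) by case: (f2 n).
have mg : measurable_fun setT g by apply: (measurable_fun_cvg mf) => w _; exact: fg.
have one : (\int[P]_w 1%:E = 1%:E)%E.
  rewrite integral_cst//= [X in (_ * X)%E](_ : _ = 1%E) ?mule1//.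
  exact: probability_setT.
pose h w := Num.max (g w) 0.
have mh : measurable_fun setT h by exact: measurable_maxr.
have h0 w : 0 <= h w by rewrite le_max lexx orbT.
have gh : {ae P, forall w, g w = h w}.
  by apply: filterS g0 => w gw; rewrite /h (max_idPl gw).
have C0 : 0 <= C by rewrite -lee_fin; apply: le_trans (fC 0%N); exact: nrm2_ge0.
have maff (k : T -> R) (e : R) : measurable_fun setT k ->
    measurable_fun setT (fun w => ((2 * e * k w + 1) ^+ 2)%:E).
  move=> mk; apply/measurable_EFinP; apply: measurable_funX.
  by apply: measurable_funD => //; exact: measurable_funM.
(* Fatou's lemma for [(2 * e * f n + 1) ^ 2], whose mean is at most
   [4 * e ^ 2 * C + 1], while [(2 * e * h + 1) ^ 2 >= 4 * e * h + 1]. *)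
have key (e : R) : 0 < e -> (\int[P]_w (h w)%:E <= (e * C)%:E)%E.
  move=> e0.
  have h1 n : (\int[P]_w ((2 * e * f n w + 1) ^+ 2)%:E <= (4 * e ^+ 2 * C)%:E + 1%:E)%E.
    have i1 : P.-integrable setT (fun w => (4 * e ^+ 2)%:E * ((f n w) ^+ 2)%:E)%E.
      by apply: integrableZl => //; exact: sqint_sqr.
    have i2 : P.-integrable setT (fun w => (4 * e)%:E * (f n w)%:E)%E.
      by apply: integrableZl => //; exact: sqint_integrable.
    have i3 : P.-integrable setT (fun w => 1%:E : \bar R) by exact: finite_measure_integrable_cst.
    have -> : (\int[P]_w ((2 * e * f n w + 1) ^+ 2)%:E =
        \int[P]_w ((4 * e ^+ 2)%:E * ((f n w) ^+ 2)%:E + ((4 * e)%:E * (f n w)%:E + 1%:E)))%E.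
      by apply: eq_integral => w _; rewrite -!EFinM -!EFinD; congr (_%:E); ring.
    rewrite integralD//; last exact: integrableD.
    rewrite integralD// one.
    rewrite integralZl//; last exact: sqint_sqr.
    rewrite integralZl//; last exact: sqint_integrable.
    rewrite f0 mule0 add0e leeD2r// [leRHS]EFinM lee_wpmul2l ?lee_fin//.
      by rewrite mulr_ge0// sqr_ge0.
    exact: fC.
  have h2 : (\int[P]_w ((2 * e * h w + 1) ^+ 2)%:E <= (4 * e ^+ 2 * C)%:E + 1%:E)%E.
    rewrite (_ : (\int[P]_w _ = \int[P]_w ((2 * e * g w + 1) ^+ 2)%:E)%E); last first.
      apply: ge0_ae_eq_integral => //; [exact: maff|exact: maff|..].
      - by move=> w _; rewrite lee_fin sqr_ge0.
      - by move=> w _; rewrite lee_fin sqr_ge0.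
      - by apply: filterS gh => w gw _; rewrite gw.
    apply: (le_trans _ (limn_einf_le h1)).
    have p2 n w : setT w -> (0 <= ((2 * e * f n w + 1) ^+ 2)%:E)%E.
      by rewrite lee_fin sqr_ge0.
    apply: (le_trans _ (fatou P measurableT (fun n => maff _ e (mf n)) p2)).
    - rewrite le_eqVlt; apply/orP; left; apply/eqP; apply: eq_integral => w _.
      have /cvg_limn_einf_sup[-> _] // :
        ((2 * e * f n w + 1) ^+ 2)%:E @[n --> \oo] --> ((2 * e * g w + 1) ^+ 2)%:E.
      apply: cvg_EFin; first exact: nearW.
      rewrite /comp /=; under eq_fun do rewrite expr2; rewrite expr2.
      have c1 : 2 * e * f n w + 1 @[n --> \oo] --> 2 * e * g w + 1.
        by apply: cvgD; [apply: cvgMr; exact: fg|exact: cvg_cst].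
      exact: cvgM.
  have h3 : ((4 * e)%:E * \int[P]_w (h w)%:E + 1%:E <= (4 * e ^+ 2 * C)%:E + 1%:E)%E.
    apply: le_trans h2; rewrite -one -ge0_integralZl//; last 3 first.
    - exact/measurable_EFinP.
    - by move=> w _; rewrite lee_fin.
    - by rewrite lee_fin mulr_ge0// ltW.
    rewrite -ge0_integralD//; last 2 first.
    - by move=> w _; rewrite -EFinM lee_fin !mulr_ge0// ltW.
    - by apply: emeasurable_funM => //; exact/measurable_EFinP.
    apply: ge0_le_integral => //.
    - by move=> w _; rewrite -EFinM -EFinD lee_fin addr_ge0// !mulr_ge0// ltW.
    - by apply: emeasurable_funD => //; apply: emeasurable_funM => //; exact/measurable_EFinP.
    - exact: maff.
    - move=> w _; rewrite -EFinM -EFinD lee_fin.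
      by have := h0 w; have := sqr_ge0 (2 * e * h w); move: (h w) => x; nra.
  move: h3; rewrite leeD2rE// (_ : (4 * e ^+ 2 * C)%:E = (4 * e)%:E * (e * C)%:E)%E; last first.
    by rewrite -EFinM; congr (_%:E); ring.
  by rewrite lee_pmul2l// lte_fin mulr_gt0.
have H0 : (\int[P]_w (h w)%:E = 0)%E.
  apply/eqP; rewrite eq_le; apply/andP; split; last first.
    by apply: integral_ge0 => w _; rewrite lee_fin.
  have e0 : (n.+1%:R^-1 * C)%:E @[n --> \oo] --> (0 : \bar R).
    apply: cvg_EFin; first exact: nearW.
    rewrite [X in _ --> X](_ : _ = 0 * C); last by rewrite mul0r.
    by apply: cvgMl; exact: cvg_harmonic.
  by apply: (lee_null e0) => n; rewrite add0e key// invr_gt0.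
have [+ _] := ae_eq_integral_abs P measurableT ((measurable_EFinP _ _).2 mh).
move=> /(_ _)/wrap[].
  by rewrite -[RHS]H0; apply: eq_integral => w _; rewrite gee0_abs// lee_fin.
by apply: filterS2 gh => w -> /(_ I)[].
Qed.

(** * Deterministic analysis of a single path *)

Section solution_path.
Context (R : realType).
Implicit Types (lambda z t : R) (v : R -> R).

Definition free_path lambda z v t : R := z + lambda * t + v t.

Definition sol_path lambda z v t : R :=
  z + lambda * t + v (hit (free_path lambda z v) t).

End solution_path.

Section good_path.
Context (R : realType) (lambda z : R) (x i v : R -> R).
Hypotheses (lambda0 : lambda < 0)
  (cx : {within `[0, +oo[, continuous x}) (ci : {within `[0, +oo[, continuous i})
  (cv : {within `[0, +oo[, continuous v})
  (xE : forall t, 0 <= t -> x t = z + lambda * t + i t) (i0 : i 0 = 0)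
  (i_npos : forall j k l m : nat, rtime R j k <= rtime R l m ->
     npos_on x (rtime R j k) (rtime R l m) -> i (rtime R l m) = i (rtime R j k))
  (i_pos : forall j k l m : nat, rtime R j k <= rtime R l m ->
     pos_on x (rtime R j k) (rtime R l m) ->
     v (rtime R l m) - v 0 - i (rtime R l m) = v (rtime R j k) - v 0 - i (rtime R j k)).

Lemma npos_const a b : 0 <= a -> a <= b -> npos_on x a b -> i a = i b.
Proof.
move=> a0 ab xab; apply: constant_rtime => // j k l m ajk jklm lmb.
apply/esym/i_npos => // r /andP[r1 r2]; apply: xab.
by rewrite (le_trans ajk r1) (le_trans r2 lmb).
Qed.

Lemma pos_const a b : 0 <= a -> a <= b -> pos_on x a b -> v a - v 0 - i a = v b - v 0 - i b.
Proof.
move=> a0 ab xab; apply: (@constant_rtime _ (fun s => v s - v 0 - i s)) => //.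
  move=> s; apply: cvgB; last exact: ci.
  by apply: cvgB; [exact: cv|exact: cvg_cst].
move=> j k l m ajk jklm lmb.
apply/esym/i_pos => // r /andP[r1 r2]; apply: xab.
by rewrite (le_trans ajk r1) (le_trans r2 lmb).
Qed.

Lemma pos_eq t : 0 <= t -> pos_on x 0 t -> i t = v t - v 0.
Proof.
by move=> t0 xt; have := pos_const (lexx 0) t0 xt; rewrite i0; lra.
Qed.

(** [pos_eq] may fail to apply at [hit x t] itself, where [x] need not be positive; it applies at
    all earlier times, and the equality passes to the limit from the left. *)
Lemma hit_eq t : 0 <= t -> i (hit x t) = v (hit x t) - v 0.
Proof.
move=> t0; have h0 := hit_ge0 x t0.
have [->|hn0] := eqVneq (hit x t) 0; first by rewrite i0 subrr.
have hpos : 0 < hit x t by rewrite lt_neqAle eq_sym hn0.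
pose u n := hit x t - hit x t * n.+1%:R^-1.
have uh : u n @[n --> \oo] --> hit x t.
  rewrite -[X in _ --> X]subr0 -[X in _ --> _ - X](mulr0 (hit x t)).
  by apply: cvgB; [exact: cvg_cst|apply: cvgMr; exact: cvg_harmonic].
have uP n : 0 <= u n < hit x t.
  have j0 : 0 < n.+1%:R^-1 :> R by rewrite invr_gt0.
  have j1 : n.+1%:R^-1 <= 1 :> R by rewrite invf_le1// ler1n.
  by rewrite /u; move: (n.+1%:R^-1) j0 j1 => y j0 j1; apply/andP; split; nra.
have u0 n : 0 <= u n by case/andP: (uP n).
have iu := within_cvg ci u0 h0 uh.
have vu : v (u n) - v 0 @[n --> \oo] --> v (hit x t) - v 0.
  by apply: cvgB; [exact: (within_cvg cv u0 h0 uh)|exact: cvg_cst].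
apply: (cvg_unique (@norm_hausdorff _ _) iu).
rewrite (_ : (fun n => i (u n)) = (fun n => v (u n) - v 0))//.
apply/funext => n; apply: pos_eq => //.
by have /andP[_] := uP n; exact: lt_hit.
Qed.

(* [rho] below is the length of the final interval of [[hit x t, t]] on which [i]
   stays below [i (hit x t)]: a hitting time for the time reversal [g]. *)
Lemma hit_le_martingale t : 0 <= t -> i (hit x t) <= i t.
Proof.
move=> t0; have h0 := hit_ge0 x t0; have ht := hit_le x t0.
have [xt|nxt] := pselect (pos_on x 0 t); first by rewrite hit_pos.
have xh := hit_npos cx t0 nxt.
rewrite leNgt; apply/negP => it.
pose g s := i (hit x t) - i (Num.max 0 (t - s)).
have cg : {within `[0, +oo[, continuous g}.
  apply: continuous_subspaceT => s.
  apply: cvgB; first exact: cvg_cst.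
  apply: (@cvg_comp _ _ _ (fun s => t - s) (fun s => i (Num.max 0 s)) _ (nbhs (t - s))).
    by apply: cvgB; [exact: cvg_cst|exact: cvg_id].
  exact: (continuous_maxr0 ci).
set r0 := t - hit x t.
have r00 : 0 <= r0 by rewrite subr_ge0.
have gE s : s <= t -> g s = i (hit x t) - i (t - s).
  by move=> st; rewrite /g (max_idPr _) ?subr_ge0.
set rho := hit g r0.
have rho0 : 0 <= rho by exact: hit_ge0.
have rhor : rho <= r0 by exact: hit_le.
have rhot : rho <= t by apply: le_trans rhor _; rewrite /r0; lra.
(* [g r0 = 0] because [t - r0 = hit x t]; hence [g] is not positive on all of [[0, r0]] and its
   hitting time is a genuine one. *)
have grho : g rho <= 0.
  apply: hit_npos => // /(_ r0); rewrite r00 lexx => /(_ isT).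
  by rewrite gE /r0 ?subKr ?subrr ?ltxx//; lra.
have rho_gt0 : 0 < rho.
  rewrite lt_neqAle rho0 andbT; apply/eqP => rE.
  by move: grho; rewrite -rE gE// subr0 subr_le0 leNgt it.
pose q := t - rho.
have q0 : 0 <= q by rewrite subr_ge0.
have qt : q < t by rewrite /q; lra.
have gneg s : q < s -> s <= t -> i s < i (hit x t).
  move=> qs st; have h1 : 0 <= t - s by rewrite subr_ge0.
  have h2 : t - s < rho by move: qs; rewrite /q; lra.
  have := lt_hit r00 h1 h2; move=> /(_ (t - s)); rewrite h1 lexx => /(_ isT).
  by rewrite gE ?subKr ?subr_gt0//; have := le_trans q0 (ltW qs); lra.
have hq : hit x t <= q by rewrite /q; move: rhor; rewrite /r0; lra.
have xneg s : q < s -> s <= t -> x s <= 0.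
  move=> qs st; have s0 := le_trans q0 (ltW qs).
  have := gneg s qs st; have := xE s0; have := xE h0; move: xh.
  move: (x _) (x _) (i _) (i _) => a b c e h1 h2 h3 h4.
  have : lambda * s <= lambda * hit x t.
    by rewrite ler_nM2l//; exact: le_trans hq (ltW qs).
  by lra.
have iconst s : q < s -> s <= t -> i s = i t.
  move=> qs st; apply: npos_const => //; first exact: le_trans q0 (ltW qs).
  move=> r /andP[sr rt]; apply: xneg => //; exact: lt_le_trans qs sr.
pose u n := q + (t - q) * n.+1%:R^-1.
have uq : u n @[n --> \oo] --> q.
  rewrite -[X in _ --> X]addr0 -[X in _ --> _ + X](mulr0 (t - q)).
  by apply: cvgD; [exact: cvg_cst|apply: cvgMr; exact: cvg_harmonic].
have uP n : q < u n <= t.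
  have j0 : 0 < n.+1%:R^-1 :> R by rewrite invr_gt0.
  have j1 : n.+1%:R^-1 <= 1 :> R by rewrite invf_le1// ler1n.
  by rewrite /u; move: (n.+1%:R^-1) j0 j1 => y j0 j1; apply/andP; split; nra.
have u0 n : 0 <= u n by have /andP[h _] := uP n; exact: le_trans q0 (ltW h).
have iu := within_cvg ci u0 q0 uq.
have iqt : i q = i t.
  apply: (cvg_unique (@norm_hausdorff _ _) iu).
  rewrite (_ : (fun n => i (u n)) = (fun=> i t)); first exact: cvg_cst.
  by apply/funext => n; have /andP[h1 h2] := uP n; exact: iconst.
move: grho; rewrite gE// -/q iqt subr_le0 leNgt it//.
Qed.

(* The hitting times of [x] and of the free path agree, because both paths
   coincide up to the first time one of them fails to be positive. *)
Lemma good_path_sol : (forall t, 0 <= t -> i t = i (hit x t)) ->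
  forall t, 0 <= t -> x t = sol_path lambda z (fun s => v s - v 0) t.
Proof.
move=> ih t t0; rewrite xE// ih// hit_eq// /sol_path.
set Z := free_path _ _ _; suff -> : hit x t = hit Z t by [].
rewrite /hit; congr (stop _ 0 t); apply/funext => s.
have xZ r : 0 <= r -> x (hit x r) = Z (hit x r).
  by move=> r0; rewrite /Z /free_path xE ?hit_ge0// hit_eq.
apply/propext; split=> h r /andP[r0 rs].
  have xr : pos_on x 0 r by apply: pos_on_down rs h.
  by have := xZ r r0; rewrite hit_pos// => <-; apply: h; rewrite r0.
have [xr|nxr] := pselect (pos_on x 0 r); first by apply: xr; rewrite r0 lexx.
have := hit_npos cx r0 nxr; rewrite xZ// leNgt => /negP; case.
by apply: h; rewrite hit_ge0//= (le_trans (hit_le x r0)).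
Qed.

End good_path.

(** * From the stochastic equation to the pathwise hypotheses *)

Section solution_uniqueness.
Context d (T : measurableType d) (R : realType) (P : probability T R).
Variables (F : R -> set (set T)) (B : R -> T -> R).
Hypotheses (hF : filtration F) (hB : brownian_motion P F B).
Variables (lambda : R) (lambda0 : lambda < 0) (zeta : T -> R) (X I : R -> T -> R).
Hypotheses (aX : adapted F X) (cX : continuous_paths X).

Let H (s : R) (w : T) : R := (0 < X s w)%R%:R.

Hypotheses (itoI : ito_integral P F B H I)
  (XE : {ae P, forall w, forall t, 0 <= t -> X t w = zeta w + lambda * t + I t w}).

Let cB : continuous_paths B. Proof. by case: hB. Qed.
Let cI : continuous_paths I. Proof. by case: itoI. Qed.
Let mI t : 0 <= t -> measurable_fun setT (I t). Proof. by case: itoI => _ + _; apply. Qed.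

Let sX u : 0 <= u -> smeas (F u) (X u).
Proof. by move=> u0; apply/smeasP; [exact: filtration_sigma|exact: aX]. Qed.

Let mpos : measurable_fun [set: R] (fun x : R => (0 < x)%R%:R : R).
Proof.
rewrite (_ : (fun x => _) = \1_(`]0, +oo[)); first exact: measurable_indic.
by apply/funext => x; rewrite indicE mem_setE in_itv/= andbT.
Qed.

Let mH u : st_measurable u H.
Proof.
apply: (st_measurable_continuous (f := fun x : R => (0 < x)%R%:R) u _ cX mpos) => s s0.
exact: (filtration_measurable hF s0 (sX s0)).
Qed.

Let approxH t : 0 <= t -> approximable P F B t H I.
Proof. by move=> t0; apply: (ito_approximable hF hB t0 _ itoI) => u _; exact: mH. Qed.

(* The complementary integrand, whose integral is [B - B 0 - I]. *)
Let K (s : R) (w : T) : R := (0 < s)%R%:R - H s w.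
Let N (u : R) (w : T) : R := B u w - B 0 w - I u w.

Let approxK t : 0 <= t -> approximable P F B t K N.
Proof. by move=> t0; apply: (approximable_compl t0); exact: approxH. Qed.

Let mK u : st_measurable u K.
Proof.
apply: st_measurableB => //.
have m1 : measurable_fun [set: T] (cst 1 : T -> R) by exact: measurable_cst.
have := st_measurable_prod u m1 mpos.
by under eq_fun do under eq_fun do rewrite mul1r.
Qed.

Let mN t : 0 <= t -> measurable_fun setT (N t).
Proof.
move=> t0; apply: measurable_funB; last exact: mI.
by apply: measurable_funB; apply: (brownian_measurable hF hB).
Qed.

(** Locality with [A s] the event that [X] is non-positive on [[a, s]]: there the integrand [H]
    vanishes. The companion [I_pos] uses positivity on [[a, s]], where the complementary integrand
    [K] vanishes. *)
Let I_npos a b : 0 <= a -> a <= b ->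
  {ae P, forall w, npos_on (X ^~ w) a b -> I b w = I a w}.
Proof.
move=> a0 ab; have b0 := le_trans a0 ab.
pose A s : set T := [set w | npos_on (X ^~ w) a s].
have FA s : a <= s <= b -> <<s F s >> (A s).
  by move=> /andP[as_ _]; exact: (npos_on_event hF cX sX a0 as_).
have dA w : down_closed a (fun s => A s w).
  move=> s r as_ sr Xr u /andP[au us]; apply: Xr.
  by rewrite au (le_trans us).
apply: (@increment_null _ T R P F hF a b a0 ab A FA dA I H (4 * moment2 R)).
- by rewrite mulr_ge0// moment2_ge0.
- exact: mH.
- by move=> s w; rewrite /H normr_nat lern1 leq_b1.
- move=> s w /andP[as_ sb] /= Xs; rewrite /H ltNge Xs// lexx andbT ltW//.
- by move=> u /andP[u0 _]; exact: mI.
- move=> E Eb; apply: (approximable_bound hF hB (mH b) _ (approxH b0) Eb).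
  by move=> u /andP[u0 _]; exact: mI.
Qed.

Let I_pos a b : 0 <= a -> a <= b ->
  {ae P, forall w, pos_on (X ^~ w) a b -> N b w = N a w}.
Proof.
move=> a0 ab; have b0 := le_trans a0 ab.
pose A s : set T := [set w | pos_on (X ^~ w) a s].
have FA s : a <= s <= b -> <<s F s >> (A s).
  by move=> /andP[as_ _]; exact: (pos_on_event hF cX sX a0 as_).
have dA w : down_closed a (fun s => A s w).
  move=> s r as_ sr Xr u /andP[au us]; apply: Xr.
  by rewrite au (le_trans us).
apply: (@increment_null _ T R P F hF a b a0 ab A FA dA N K (4 * moment2 R)).
- by rewrite mulr_ge0// moment2_ge0.
- exact: mK.
- move=> s w; rewrite /K /H.
  by case: (0 < s); case: (0 < X s w); rewrite ?subr0 ?subrr ?sub0r ?normrN ?normr0 ?normr1.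
- move=> s w /andP[as_ sb] /= Xs; rewrite /K /H (le_lt_trans a0 as_) Xs ?subrr//.
  by rewrite lexx andbT ltW.
- by move=> u /andP[u0 _]; exact: mN.
- move=> E Eb; apply: (approximable_bound hF hB (mK b) _ (approxK b0) Eb).
  by move=> u /andP[u0 _]; exact: mN.
Qed.

(** Every elementary integral truncated at time 0 is 0, hence so is its L^2-limit. *)
Let I_0 : {ae P, forall w, I 0 w = 0}.
Proof.
have [S [_ _ /(_ 0 (lexx 0) (lexx 0)) S0]] := approxH (lexx 0).
apply: nrm2_eq0_ae; first exact: mI.
apply/eqP; rewrite eq_le nrm2_ge0 andbT; apply: (lee_null S0) => n; rewrite add0e.
rewrite le_eqVlt; apply/orP; left; apply/eqP; apply: eq_integral => w _.
rewrite el_int_trunc big1 ?sub0r ?sqrrN// => i _.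
rewrite !(min_idPr _) ?subrr ?mulr0 ?el_lo_ge0//.
exact: le_trans (el_lo_ge0 _ i) (el_lo_hi _ i).
Qed.

(** The hypotheses of the deterministic part. Times are restricted to rational ones so that the
    exceptional sets of [I_npos] and [I_pos] form a countable family. *)
Let good (w : T) : Prop :=
  [/\ forall t, 0 <= t -> X t w = zeta w + lambda * t + I t w, I 0 w = 0,
   forall j k l m : nat, rtime R j k <= rtime R l m ->
     npos_on (X ^~ w) (rtime R j k) (rtime R l m) -> I (rtime R l m) w = I (rtime R j k) w &
   forall j k l m : nat, rtime R j k <= rtime R l m ->
     pos_on (X ^~ w) (rtime R j k) (rtime R l m) -> N (rtime R l m) w = N (rtime R j k) w].

Let ae_good : {ae P, forall w, good w}.
Proof.
have h1 : {ae P, forall w, forall j k l m : nat, rtime R j k <= rtime R l m ->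
     npos_on (X ^~ w) (rtime R j k) (rtime R l m) -> I (rtime R l m) w = I (rtime R j k) w}.
  do 4 (apply: ae_foralln => ?).
  case: leP => [h|_]; last exact: aeW.
  by apply: filterS (I_npos (rtime_ge0 _ _ _) h) => w Iw _; exact: Iw.
have h2 : {ae P, forall w, forall j k l m : nat, rtime R j k <= rtime R l m ->
     pos_on (X ^~ w) (rtime R j k) (rtime R l m) -> N (rtime R l m) w = N (rtime R j k) w}.
  do 4 (apply: ae_foralln => ?).
  case: leP => [h|_]; last exact: aeW.
  by apply: filterS (I_pos (rtime_ge0 _ _ _) h) => w Iw _; exact: Iw.
by near=> w; split; near: w.
Unshelve. all: by end_near. Qed.

(** [E n] is the indicator of []0, t]] minus the grid process of positivity, so its integral against
    [I] converges pathwise to [I t - I (hit t)]. These integrals have mean zero, and since [E n] and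
    [H] are bounded by 1 their square norms stay below [4 * moment2 R * t]; the limit is
    nonnegative, hence null. *)
Let I_hit t : 0 <= t -> {ae P, forall w, I t w = I (hit (X ^~ w) t) w}.
Proof.
move=> t0.
pose A s : set T := [set w | pos_on (X ^~ w) 0 s].
have FA s : 0 <= s <= t -> <<s F s >> (A s).
  by move=> /andP[s0 _]; exact: (pos_on_event hF cX sX (lexx 0) s0).
pose E n := el_sub (el_one F t0) (el_grid (lexx 0) t0 FA n).
have Eb n : el_below t (E n).
  by apply: el_sub_below => [i //|]; exact: el_grid_below.
have mIt u : 0 <= u <= t -> measurable_fun setT (I u) by move=> /andP[u0 _]; exact: mI.
have c0 := moment2_ge0 R.
have EI n w : el_int (E n) I w = I t w - I 0 w - grid_sum (fun s => A s w) 0 t n (I ^~ w).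
  by rewrite el_int_sub el_int_grid /el_int (big_pred1 tt) ?mul1r// => -[].
have lim w : el_int (E n) I w @[n --> \oo] --> I t w - I (hit (X ^~ w) t) w.
  rewrite (_ : (fun n => _) =
    (fun n => I t w - I 0 w - grid_sum (fun s => A s w) 0 t n (I ^~ w))); last first.
    by apply/funext => n; rewrite EI.
  rewrite (_ : I t w - I (hit (X ^~ w) t) w =
    I t w - I 0 w - (I (hit (X ^~ w) t) w - I 0 w)); last by ring.
  apply: cvgB; first exact: cvg_cst.
  by apply: (grid_sum_cvg (@cI w) (lexx 0) _ t0); exact: pos_on_down.
have bnd n : (nrm2 P (el_int (E n) I) <= (4 * moment2 R * t)%:E)%E.
  apply: le_trans (approximable_bound hF hB (mH t) mIt (approxH t0) (Eb n)) _.
  rewrite [leRHS]EFinM; apply: lee_wpmul2l; first by rewrite lee_fin mulr_ge0.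
  apply: st_nrm2_small => //.
  - by apply: st_measurableM => //; exact: (el_val_measurable hF).
  - move=> s w; rewrite normrM -[leRHS]mulr1 ler_pM//; last by rewrite /H normr_nat lern1 leq_b1.
    have [st|st] := pselect (0 < s <= t); last by rewrite (el_val_out w (Eb n) st) normr0.
    have [i iN si] := grid_cell n st.
    rewrite el_val_sub el_val_one (el_val_grid (lexx 0) t0 FA w iN si) !indicE.
    rewrite mem_setE in_itv/= st.
    by case: (w \in _); rewrite ?subrr ?subr0 ?normr0 ?normr1.
  - by move=> w; exists 0 => s /andP[s0 st] _; rewrite add0r (ltW s0).
have mean n := approximable_mean0 hF hB mIt (approxH t0) (Eb n).
have ge0 : {ae P, forall w, 0 <= I t w - I (hit (X ^~ w) t) w}.
  apply: filterS ae_good => w [h1 h2 h3 h4]; rewrite subr_ge0.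
  exact: (hit_le_martingale lambda0 (@cX w) (@cI w) h1 h3 t0).
have := mean0_limit_ge0 (fun n => (mean n).1) (fun n => (mean n).2) bnd lim ge0.
by apply: filterS => w /eqP; rewrite subr_eq0 => /eqP.
Qed.

Lemma solution_sol_path : {ae P, forall w, forall t, 0 <= t ->
  X t w = sol_path lambda (zeta w) (fun s => B s w - B 0 w) t}.
Proof.
have h : {ae P, forall w, forall j k : nat, I (rtime R j k) w = I (hit (X ^~ w) (rtime R j k)) w}.
  by do 2 (apply: ae_foralln => ?); exact/I_hit/rtime_ge0.
apply: filterS2 ae_good h => w [h1 h2 h3 h4] h5.
apply: (good_path_sol (@cX w) (@cI w) (@cB w) h1 h2 h4) => t t0.
(* [h5] gives the identity at rational times; both sides are continuous in [t], the hitting time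
   being Lipschitz in its horizon. *)
have [u [_ uc]] := rtime_cvg t0.
have u0 n : 0 <= rtime R (u n).1 (u n).2 by exact: rtime_ge0.
have c1 := within_cvg (@cI w) u0 t0 uc.
have c2 := within_cvg (@cI w) (fun n => hit_ge0 (X ^~ w) (u0 n)) (hit_ge0 (X ^~ w) t0)
  (cvg_hit (f := X ^~ w) t0 u0 uc).
apply: (cvg_unique (@norm_hausdorff _ _) c1); move: c2.
by under eq_fun do rewrite -h5.
Qed.

End solution_uniqueness.

Lemma sde_solution_sol_path d (T : measurableType d) (R : realType) (P : probability T R)
    (F : R -> set (set T)) (B : R -> T -> R) (lambda : R) (zeta : T -> R) (X : R -> T -> R) :
  filtration F -> brownian_motion P F B -> lambda < 0 ->
  sde_solution P F lambda zeta B X ->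
  {ae P, forall w, forall t, 0 <= t ->
    X t w = sol_path lambda (zeta w) (fun s => B s w - B 0 w) t}.
Proof.
move=> hF hB l0 [aX cX [I [itoI XE]]].
exact: (solution_sol_path hF hB l0 aX cX itoI XE).
Qed.

(** * Existence *)

Lemma nrm2_fatou d (T : measurableType d) (R : realType) (P : {measure set T -> \bar R})
    (f : nat -> T -> R) (g : T -> R) (k : \bar R) :
  (forall n, measurable_fun setT (f n)) -> (forall w, f n w @[n --> \oo] --> g w) ->
  (forall n, nrm2 P (f n) <= k)%E -> (nrm2 P g <= k)%E.
Proof.
move=> mf fg fk; apply: (le_trans _ (limn_einf_le fk)).
have m2 n : measurable_fun setT (fun w => ((f n w) ^+ 2)%:E).
  by apply/measurable_EFinP; exact: measurable_funX.
have p2 n w : setT w -> (0 <= ((f n w) ^+ 2)%:E)%E by rewrite lee_fin sqr_ge0.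
apply: (le_trans _ (fatou P measurableT m2 p2)).
rewrite le_eqVlt; apply/orP; left; apply/eqP; apply: eq_integral => w _.
have /cvg_limn_einf_sup[-> _] // : ((f n w) ^+ 2)%:E @[n --> \oo] --> ((g w) ^+ 2)%:E.
apply: cvg_EFin; first exact: nearW.
rewrite /comp /=; under eq_fun do rewrite expr2; rewrite expr2.
by apply: cvgM; exact: fg.
Qed.

Lemma within_halfline (R : realType) (f g : R -> R) :
  (forall t, 0 <= t -> f t = g t) -> continuous g -> {within `[0, +oo[, continuous f}.
Proof.
move=> fg cg; apply/subspace_continuousP => x; rewrite /= in_itv/= andbT => x0.
rewrite /from_subspace fg//.
apply: (@cvg_trans _ (g @ within `[0, +oo[%classic (nbhs x))).
  apply: near_eq_cvg; rewrite near_withinE; apply: nearW => y.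
  by rewrite /= in_itv/= andbT => y0; rewrite fg.
by apply: cvg_within_filter; exact: cg.
Qed.

Lemma continuous_hit (R : realType) (f g : R -> R) :
  {within `[0, +oo[, continuous g} -> {within `[0, +oo[, continuous (fun t => g (hit f t))}.
Proof.
move=> cg.
apply: (@within_halfline _ _ (fun t => g (Num.max 0 (hit f (Num.max 0 t))))).
  by move=> t t0; rewrite (max_idPr t0) (max_idPr (hit_ge0 f t0)).
move=> t.
apply: (@cvg_comp _ _ _ (fun t => hit f (Num.max 0 t)) (fun s => g (Num.max 0 s)) _
  (nbhs (hit f (Num.max 0 t)))); last exact: (continuous_maxr0 cg).
apply/cvgrPdist_le => e e0; near=> s.
have m0 u : 0 <= Num.max 0 u :> R by rewrite le_max lexx.
apply: (le_trans (hit_lipschitz f (m0 s) (m0 t))).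
have : `|t - s| <= e by near: s; apply: cvgr_dist_le.
apply: le_trans; case: (leP 0 t); case: (leP 0 s) => ? ?; rewrite ?subrr ?normr0 ?normr_ge0//.
- by rewrite subr0 !ger0_norm; lra.
- by rewrite sub0r normrN ger0_norm// ltr0_norm; lra.
Unshelve. all: by end_near. Qed.

Section solution.
Context d (T : measurableType d) (R : realType).
Variables (F : R -> set (set T)) (B : R -> T -> R).
Hypotheses (hF : filtration F) (cB : continuous_paths B)
  (sB : forall u, 0 <= u -> smeas (F u) (B u)).
Variables (lambda : R) (zeta : T -> R).
Hypotheses (szeta : smeas (F 0) zeta).

Let V s w := B s w - B 0 w.
Let Z s w := free_path lambda (zeta w) (V ^~ w) s.
Let I t w := V (hit (Z ^~ w) t) w.
(** Continuity and adaptedness are proved before any probability enters, so that the construction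
    can be reused on the disjoint sum of two spaces when laws are compared. *)
Definition solution t w : R := sol_path lambda (zeta w) (fun s => B s w - B 0 w) t.

Let XE t w : solution t w = zeta w + lambda * t + I t w. Proof. by []. Qed.

Lemma el_int_smeas t (E : elementary F) : el_below t E -> smeas (F t) (el_int E B).
Proof.
move=> Et; apply: measurable_sum => i.
have h0 := el_lo_ge0 E i; have lh := el_lo_hi E i.
apply: measurable_funM.
  exact: (filtration_smeas hF h0 (le_trans lh (Et i)) (el_co_smeas E i)).
apply: measurable_funB.
  exact: (filtration_smeas hF (le_trans h0 lh) (Et i) (sB (le_trans h0 lh))).
exact: (filtration_smeas hF h0 (le_trans lh (Et i)) (sB h0)).
Qed.

Let cV w : {within `[0, +oo[, continuous (V ^~ w)}.
Proof. by move=> s; apply: cvgB; [exact: cB|exact: cvg_cst]. Qed.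

Let cZ : continuous_paths Z.
Proof.
move=> w s; apply: cvgD; last exact: cV.
apply: cvgD; first exact: cvg_cst.
have : {within `[0, +oo[, continuous (fun s => lambda * s)} by apply: continuous_subspaceT => u; exact: mulrl_continuous.
exact.
Qed.

Let sZ u : 0 <= u -> smeas (F u) (Z u).
Proof.
move=> u0; apply: measurable_funD.
  apply: measurable_funD; last exact: measurable_cst.
  exact: (filtration_smeas hF (lexx 0) u0 szeta).
apply: measurable_funB; first exact: sB.
exact: (filtration_smeas hF (lexx 0) u0 (sB (lexx 0))).
Qed.

Let cI : continuous_paths I.
Proof. by move=> w; exact: (@continuous_hit _ (Z ^~ w) _ (@cV w)). Qed.

Lemma solution_continuous : continuous_paths solution.
Proof.
move=> w s; apply: cvgD; last exact: cI.
apply: cvgD; first exact: cvg_cst.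
have : {within `[0, +oo[, continuous (fun s => lambda * s)} by apply: continuous_subspaceT => u; exact: mulrl_continuous.
exact.
Qed.

Lemma solution0 w : solution 0 w = zeta w.
Proof.
rewrite XE mulr0 addr0 /I (_ : hit _ 0 = 0) ?/V ?subrr ?addr0//.
by apply/eqP; rewrite eq_le hit_le ?hit_ge0.
Qed.

Let A s : set T := [set w | pos_on (Z ^~ w) 0 s].
Let dA w : down_closed 0 (fun s => A s w). Proof. exact: pos_on_down. Qed.

Section approximation.
Variables (t : R) (t0 : 0 <= t).

(** The grids cover [[0, t + 1]], so that their times increase strictly even when [t = 0], as
    [simple_process] demands when the same grids return below. *)
Let t1 : 0 <= t + 1. Proof. by rewrite addr_ge0. Qed.
Let FA s : 0 <= s <= t + 1 -> <<s F s >> (A s).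
Proof. by move=> /andP[s0 _]; exact: (pos_on_event hF cZ sZ (lexx 0) s0). Qed.

Let E n := el_grid (lexx 0) t1 FA n.

Let E_trunc n w : el_int (el_trunc t0 (E n)) B w =
  grid_sum (fun s => A s w) 0 (t + 1) n (fun s => B (Num.min s t) w).
Proof.
rewrite el_int_trunc /grid_sum; apply: eq_bigr => i _ /=; rewrite indicE.
by congr (_%:R * _).
Qed.

(** Truncation at [t] replaces [B] by the continuous path [s |-> B (min s t)]. The grid sums
    converge to its increment up to the hitting time with cap [t + 1], and the minimum of that time
    with [t] is the hitting time with cap [t]. *)
Lemma stopped_cvg w :
  grid_sum (fun s => A s w) 0 (t + 1) n (fun s => B (Num.min s t) w) @[n --> \oo] --> I t w.
Proof.
have -> : I t w = B (Num.min (stop (fun s => A s w) 0 (t + 1)) t) w - B (Num.min 0 t) w.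
  rewrite /I /V (hit_min (Z ^~ w) t0 (_ : t <= t + 1)) ?lerDl//.
  by rewrite (min_idPl t0).
apply: (grid_sum_cvg (f := fun s => B (Num.min s t) w)) => //.
(* For [s >= 0] the argument equals [min s t]; written with [max 0] it is continuous on the whole
   line, and so is the extended path. *)
apply: (@within_halfline _ _ (fun s => B (Num.max 0 (t - Num.max 0 (t - s))) w)).
  move=> s s0; congr (B _ w); case: (leP s t) => st.
    by rewrite (max_idPr (_ : 0 <= t - s)) ?subr_ge0// subKr (max_idPr s0).
  by rewrite (max_idPl (_ : t - s <= 0)) ?subr_le0 1?ltW// subr0 (max_idPr t0).
have cm : continuous (fun x : R => Num.max 0 x).
  by apply: (@continuous_maxr0 _ id); apply: continuous_subspaceT => x; exact: cvg_id.
move=> s.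
apply: (@cvg_comp _ _ _ (fun s => t - Num.max 0 (t - s)) (fun r => B (Num.max 0 r) w) _
  (nbhs (t - Num.max 0 (t - s)))); last exact: (continuous_maxr0 (@cB w)).
apply: cvgB; first exact: cvg_cst.
apply: (@cvg_comp _ _ _ (fun s => t - s) (fun r => Num.max 0 r) _ (nbhs (t - s))); last exact: cm.
by apply: cvgB; [exact: cvg_cst|exact: cvg_id].
Qed.

(** The stopped motion is a pointwise limit of elementary integrals truncated at [t], each of which
    is measurable at time [t]; no sigma-algebra of a stopping time is involved. *)
Lemma stopped_smeas : smeas (F t) (I t).
Proof.
apply: (@measurable_fun_cvg _ (g_sigma_algebraType (F t)) _ _
  (fun n => el_int (el_trunc t0 (E n)) B)) => [n|w _]; last first.
  by under eq_fun do rewrite E_trunc; exact: stopped_cvg.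
by apply: el_int_smeas; exact: el_trunc_below.
Qed.

Lemma solution_smeas : smeas (F t) (solution t).
Proof.
apply: measurable_funD; last exact: stopped_smeas.
apply: measurable_funD; last exact: measurable_cst.
exact: (filtration_smeas hF (lexx 0) t0 szeta).
Qed.

End approximation.

Lemma solution_adapted : adapted F solution.
Proof.
move=> t t0; apply/smeasP; first exact: filtration_sigma.
exact: solution_smeas.
Qed.

Hypothesis lambda0 : lambda < 0.

(** The sign of the drift enters the existence proof here: once [Z] has reached [Z (hit t) <= 0],
    the solution equals [Z (hit t) + lambda * (t - hit t)] and stays non-positive. Hence the
    integrand [H] is the indicator of the down-closed event [A]. *)
Let solution_gt0 t w : 0 <= t -> (0 < solution t w) <-> pos_on (Z ^~ w) 0 t.
Proof.
move=> t0; split=> h; last first.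
  rewrite XE /I hit_pos//; have := h t; rewrite t0 lexx => /(_ isT).
  by rewrite /Z /free_path.
apply: contrapT => nh; move: h; rewrite ltNge => /negP; apply.
have := hit_npos (@cZ w) t0 nh; rewrite XE /I /Z /free_path.
have : lambda * t <= lambda * hit (Z ^~ w) t by rewrite ler_nM2l// hit_le.
by rewrite /Z; lra.
Qed.

Section stochastic_integral.
Variable P : probability T R.
Hypothesis hB : brownian_motion P F B.

Let H (s : R) (w : T) : R := (0 < solution s w)%R%:R.

Section horizon.
Variables (t : R) (t0 : 0 <= t).

Let t1 : 0 <= t + 1. Proof. by rewrite addr_ge0. Qed.
Let FA s : 0 <= s <= t + 1 -> <<s F s >> (A s).
Proof. by move=> /andP[s0 _]; exact: (pos_on_event hF cZ sZ (lexx 0) s0). Qed.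

Let sp_lt n i : (i < n.+1)%N -> grid 0 (t + 1) n i < grid 0 (t + 1) n i.+1.
Proof. by move=> _; rewrite gridS ltrDl divr_gt0// subr0 ltr_pwDr. Qed.

Let sp_ge0 n : 0 <= grid 0 (t + 1) n 0. Proof. by rewrite grid0. Qed.

Let sp_meas n i : (i < n.+1)%N -> g_sigma_algebra_preimage
  (\1_(A (grid 0 (t + 1) n i)) : T -> R) `<=` F (grid 0 (t + 1) n i).
Proof.
move=> iN; have g0 := grid_ge n i t1.
apply/smeasP; first exact: filtration_sigma.
by apply: smeas_indic; apply: FA; rewrite g0 grid_le// ltnW.
Qed.

Let sp_bnd n : exists C : R, forall i w, (i < n.+1)%N ->
  `|(\1_(A (grid 0 (t + 1) n i)) : T -> R) w| <= C.
Proof. by exists 1 => i w _; rewrite indicE normr_nat lern1 leq_b1. Qed.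

Let S n : simple_process F :=
  SimpleProcess (sp_ge0 n) (@sp_lt n) (@sp_meas n) (sp_bnd n).

Let E n := el_grid (lexx 0) t1 FA n.

Let mH : st_measurable t H.
Proof.
have mpos : measurable_fun [set: R] (fun x : R => (0 < x)%R%:R : R).
  rewrite (_ : (fun x => _) = \1_(`]0, +oo[)); first exact: measurable_indic.
  by apply/funext => x; rewrite indicE mem_setE in_itv/= andbT.
apply: (st_measurable_continuous (f := fun x : R => (0 < x)%R%:R) t _ solution_continuous mpos).
by move=> s s0; exact: (filtration_measurable hF s0 (solution_smeas s0)).
Qed.

Let mS n : st_measurable t (fun s w => sp_val (S n) s w).
Proof. exact: (el_val_measurable hF t (E n)). Qed.

(** At time [s] the simple process shows [A] at the left end of the cell of [s], while [H] shows [A]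
    at [s]. The two differ only within the cell in which [A] stops. *)
Let S_small n : (st_nrm2 P t (fun s w => (sp_val (S n) s w - H s w)%R) <=
  ((t + 1) / n.+1%:R)%:E)%E.
Proof.
have tt1 : t <= t + 1 by rewrite lerDl.
have val s w : 0 < s <= t -> exists2 i, (i <= n)%N &
    grid 0 (t + 1) n i < s <= grid 0 (t + 1) n i.+1 /\
    sp_val (S n) s w = \1_(A (grid 0 (t + 1) n i)) w.
  move=> /andP[s0 st]; have [|i iN si] := @grid_cell _ 0 (t + 1) n s.
    by rewrite s0 (le_trans st).
  by exists i => //; split => //; exact: (el_val_grid (lexx 0) t1 FA w iN si).
apply: st_nrm2_small.
- by rewrite divr_ge0.
- by apply: st_measurableB.
- move=> s w; rewrite /H.
  have -> : sp_val (S n) s w = el_val (E n) s w by [].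
  have [st|st] := boolP (0 < s <= t + 1); last first.
    by rewrite el_val_grid_out// sub0r normrN normr_nat lern1 leq_b1.
  have [i iN si] := grid_cell n st.
  rewrite (el_val_grid (lexx 0) t1 FA w iN si) indicE.
  by case: (_ \in _); case: (0 < _); rewrite ?subrr ?subr0 ?sub0r ?normrN ?normr0 ?normr1.
- move=> w; exists (stop (fun s => A s w) 0 (t + 1)) => s st.
  have [i iN [/andP[si1 si2] ->]] := val s w st.
  have s0 : 0 <= s by case/andP: st => /ltW.
  have g0 := grid_ge n i t1.
  have AH : H s w = (`[<A s w>])%:R.
    rewrite /H; congr (_%:R); congr nat_of_bool.
    by apply/idP/asboolP => /(solution_gt0 w s0).
  rewrite AH indicE => AA.
  have As : ~ A s w.
    move=> As; move: AA; rewrite asboolT// mem_set ?subrr ?eqxx//.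
    exact: (dA g0 (ltW si1) As).
  rewrite (stop_le_not (@dA w) t1 s0 As)/=.
  apply: (le_trans si2); rewrite gridS subr0 lerD2r; apply: le_stop.
    by rewrite g0 grid_le// ltnW.
  by apply: contrapT => nA; move: AA; rewrite asboolF// memNset// subrr eqxx.
Qed.

Let S_val_cvg : st_nrm2 P t (fun s w => (sp_val (S n) s w - H s w)%R) @[n --> \oo] --> 0%E.
Proof.
have d0 : ((t + 1) / n.+1%:R)%:E @[n --> \oo] --> (0 : \bar R).
  apply: cvg_EFin; first exact: nearW.
  rewrite [X in _ --> X](_ : _ = (t + 1) * 0); last by rewrite mulr0.
  by apply: cvgMr; exact: cvg_harmonic.
apply: (squeeze_cvge _ (cvg_cst 0%E) d0); apply: nearW => n.
by rewrite st_nrm2_ge0 S_small.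
Qed.

Let S_int n w : sp_int (S n) B t w = el_int (el_trunc t0 (E n)) B w.
Proof. by rewrite el_int_trunc. Qed.

Let S_lim w : sp_int (S n) B t w @[n --> \oo] --> I t w.
Proof.
rewrite (_ : (fun n => _) = (fun n =>
  grid_sum (fun s => A s w) 0 (t + 1) n (fun s => B (Num.min s t) w))).
  exact: stopped_cvg.
apply/funext => n; rewrite /sp_int /grid_sum; apply: eq_bigr => i _ /=; rewrite indicE.
by congr (_%:R * _).
Qed.

(* Fatou's lemma in [m] for the differences of the integrals of [S n] and
   [S (m + n)]. *)
Let S_int_bound n : (nrm2 P (fun w => (sp_int (S n) B t w - I t w)%R) <=
  (moment2 R * (4 * ((t + 1) / n.+1%:R)))%:E)%E.
Proof.
have mSn k : measurable_fun setT (fun w => sp_int (S k) B t w).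
  by under eq_fun do rewrite S_int; exact: (el_int_brownian_measurable hF hB).
apply: (@nrm2_fatou _ _ _ P (fun m w => (sp_int (S n) B t w - sp_int (S (m + n)%N) B t w)%R)).
- by move=> m; exact: measurable_funB.
- move=> w; apply: cvgB; first exact: cvg_cst.
  by rewrite (cvg_shiftn n (fun m => sp_int (S m) B t w)); exact: S_lim.
move=> m; set k := (m + n)%N.
have -> : (fun w => sp_int (S n) B t w - sp_int (S k) B t w) =
    el_int (el_trunc t0 (el_sub (E n) (E k))) B.
  by apply/funext => w; rewrite el_int_trunc_sub !S_int.
rewrite (el_isometry_below hF hB (t := t)); last exact: el_trunc_below.
rewrite EFinM; apply: lee_wpmul2l; first by rewrite lee_fin moment2_ge0.
apply: (@le_trans _ _ (2%:E * st_nrm2 P t (fun s w => (sp_val (S n) s w - H s w)%R) +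
    2%:E * st_nrm2 P t (fun s w => (sp_val (S k) s w - H s w)%R))%E).
  apply: st_nrm2_le => //.
  - exact: (el_val_measurable hF).
  - exact: st_measurableB.
  - exact: st_measurableB.
  - move=> s w /andP[s0 st]; rewrite el_val_trunc// el_val_sub.
    rewrite -[el_val (E n) s w]/(sp_val (S n) s w) -[el_val (E k) s w]/(sp_val (S k) s w).
    move: (sp_val _ _ _) (sp_val _ _ _) (H s w) => x y z.
    by have := sqr_ge0 (x - z + (y - z)); nra.
have h1 : (2%:E * st_nrm2 P t (fun s w => (sp_val (S n) s w - H s w)%R) <=
    (2 * ((t + 1) / n.+1%:R))%:E)%E.
  by rewrite EFinM; apply: lee_wpmul2l => //; exact: S_small.
have h2 : (2%:E * st_nrm2 P t (fun s w => (sp_val (S k) s w - H s w)%R) <=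
    (2 * ((t + 1) / n.+1%:R))%:E)%E.
  rewrite EFinM; apply: lee_wpmul2l => //; apply: le_trans (S_small k) _.
  rewrite lee_fin ler_wpM2l// lef_pV2 ?posrE// ler_nat ltnS /k leq_addl//.
apply: (le_trans (leeD h1 h2)).
by rewrite -EFinD lee_fin; move: (_ / _) => q; lra.
Qed.

Lemma solution_ito : exists S : nat -> simple_process F,
  ((fun n => \int[P]_w \int[lebesgue_measure]_(s in `[0%R, t])
     ((sp_val (S n) s w - H s w) ^+ 2)%:E)%E @ \oo --> 0%E) /\
  ((fun n => \int[P]_w ((sp_int (S n) B t w - I t w) ^+ 2)%:E)%E @ \oo --> 0%E).
Proof.
exists S; split; first exact: S_val_cvg.
have d0 : (moment2 R * (4 * ((t + 1) / n.+1%:R)))%:E @[n --> \oo] --> (0 : \bar R).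
  apply: cvg_EFin; first exact: nearW.
  rewrite [X in _ --> X](_ : _ = moment2 R * (4 * ((t + 1) * 0))); last by rewrite !mulr0.
  by do 3 apply: cvgMr; exact: cvg_harmonic.
apply: (squeeze_cvge _ (cvg_cst 0%E) d0); apply: nearW => n.
by rewrite -/(nrm2 P _) nrm2_ge0 S_int_bound.
Qed.

End horizon.

Lemma solution_sde : sde_solution P F lambda zeta B solution.
Proof.
split; [exact: solution_adapted|exact: solution_continuous|].
exists I; split; last by apply: aeW.
split; first exact: cI.
- by move=> t t0; exact: (filtration_measurable hF t0 (stopped_smeas t0)).
- by move=> t t0; exact: solution_ito.
Qed.

End stochastic_integral.
End solution.

(** * Dynkin's argument and the filtration generated by the initial value and the motion *)

Lemma measure_setC d (T : measurableType d) (R : realType) (m : {measure set T -> \bar R})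
    (A : set T) : (m setT < +oo)%E -> measurable A -> m (~` A) = (m setT - m A)%E.
Proof.
move=> fT mA; rewrite -setTD measureD//.
by rewrite setTI.
Qed.

Section sigma_agreement.
Context d (T : measurableType d) d' (T' : measurableType d') (R : realType) (U : Type).
Variables (m : {measure set T -> \bar R}) (m' : {measure set T' -> \bar R}).
Variables (i : T -> U) (j : T' -> U).

(** Events of a common set [U] are pulled back along [i] and [j]. This covers two measures on one
    space, with identity maps, and two spaces embedded in their disjoint sum. *)
Definition agree (A : set U) :=
  [/\ measurable (i @^-1` A), measurable (j @^-1` A) & m (i @^-1` A) = m' (j @^-1` A)].

Lemma agree_sigma (G : set (set U)) : (m setT < +oo)%E -> m setT = m' setT ->
  setI_closed G -> G `<=` agree -> <<s G >> `<=` agree.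
Proof.
move=> fT mT GI GA; rewrite -(setI_closed_g_dynkin_g_sigma_algebra GI).
apply: smallest_sub => //; split.
- by split; rewrite preimage_setT//; exact: measurableT.
- move=> A [mA mA' mAA']; split; rewrite preimage_setC; [exact: measurableC..|].
  by rewrite !measure_setC -?mT// mAA'.
- move=> H tH GH; have [mH mH' mHH'] : [/\ forall n, measurable (i @^-1` (H n)),
      forall n, measurable (j @^-1` (H n)) & forall n, m (i @^-1` (H n)) = m' (j @^-1` (H n))].
    by split=> n; have [] := GH n.
  split; rewrite preimage_bigcup; [exact: bigcup_measurable..|].
  rewrite (measure_bigcup m); first last.
  + by move=> n p _ _ [x [Hn Hp]]; apply: tH => //; exists (i x).
  + by move=> n _; exact: mH.
  rewrite (measure_bigcup m'); first last.
  + by move=> n p _ _ [x [Hn Hp]]; apply: tH => //; exists (j x).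
  + by move=> n _; exact: mH'.
  by apply: eq_eseriesr => n _.
Qed.

End sigma_agreement.

Section generated_filtration.
Context d (T : measurableType d) (R : realType) (P : probability T R).
Variables (F : R -> set (set T)) (W : R -> T -> R) (zeta : T -> R).
Hypotheses (hF : filtration F) (hW : brownian_motion P F W)
  (mzeta : measurable_fun setT zeta)
  (hind : independent P (g_sigma_algebra_preimage zeta) (sigma_process W)).

Let G := generated_filtration zeta W.

Let sub_zeta t : g_sigma_algebra_preimage zeta `<=` G t.
Proof. by move=> A zA; apply: sub_sigma_algebra; left. Qed.

Let sub_W s t : 0 <= s <= t -> g_sigma_algebra_preimage (W s) `<=` G t.
Proof.
by move=> st A WA; apply: sub_sigma_algebra; right; exists s => //=; rewrite in_itv/=.
Qed.

Lemma preimage_sigma_sub (f : T -> R) : measurable_fun setT f ->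
  g_sigma_algebra_preimage f `<=` measurable.
Proof. by move=> mf _ [D mD <-]; exact: mf. Qed.

Lemma generated_filtration_filtration : filtration G.
Proof.
split.
  move=> t t0; split; first exact: smallest_sigma_algebra.
  apply: smallest_sub; first exact: sigma_algebra_measurable.
  move=> A [|[s]]; first exact: preimage_sigma_sub.
  rewrite /= in_itv/= => /andP[s0 _].
  by apply: preimage_sigma_sub; exact: (brownian_measurable hF hW s0).
move=> s t s0 st; apply: smallest_sub; first exact: smallest_sigma_algebra.
move=> A [|[r]]; first exact: sub_zeta.
rewrite /= in_itv/= => /andP[r0 rs] rA; apply: (sub_W _ rA).
by rewrite r0 (le_trans rs).
Qed.

Lemma generated_filtration_smeas t : 0 <= t -> smeas (G t) zeta.
Proof. by move=> t0; apply/smeasP; [exact: smallest_sigma_algebra|exact: sub_zeta]. Qed.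

Lemma generated_filtration_indep s t : 0 <= s -> s < t ->
  independent P (g_sigma_algebra_preimage (W t \- W s)) (G s).
Proof.
move=> s0 st B E [D mD <-]; rewrite setTI.
have t0 := le_trans s0 (ltW st).
set B' := _ @^-1` D; move=> GE.
(* It suffices to treat the pi-system [L] of the intersections of an event of
   [zeta] with an event of the past of [W]. *)
pose H := <<s \bigcup_(r in `[0, s]) g_sigma_algebra_preimage (W r) >>.
pose L := [set A `&` C | A in g_sigma_algebra_preimage zeta & C in H].
have mB : measurable B'.
  by rewrite -[X in measurable X]setTI; exact: (increment_measurable hF hW s0 (ltW st)).
have HF : H `<=` F s.
  apply: smallest_sub; first exact: (filtration_sigma hF s0).
  move=> A [r]; rewrite /= in_itv/= => /andP[r0 rs] WA.
  have [_ /(_ _ _ r0 rs)] := hF; apply.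
  by have [aW _ _ _ _] := hW; exact: (aW _ r0).
have HW : H `<=` sigma_process W.
  apply: smallest_sub; first exact: smallest_sigma_algebra.
  move=> A [r]; rewrite /= in_itv/= => /andP[r0 rs] WA; apply: sub_sigma_algebra.
  by exists r => //; rewrite /= in_itv/= r0.
have BW : sigma_process W B'.
  pose K := \bigcup_(r in `[0, +oo[) g_sigma_algebra_preimage (W r).
  have mK r : 0 <= r -> smeas K (W r).
    move=> r0 _ C mC; apply: sub_sigma_algebra; exists r; rewrite /= ?in_itv/= ?r0//.
    by exists C.
  have := measurable_funB (mK _ t0) (mK _ s0) measurableT mD.
  by rewrite setTI.
have LI : setI_closed L.
  move=> _ _ [A zA [C HC <-]] [A' zA' [C' HC' <-]].
  exists (A `&` A').
    have sz := sigma_algebra_preimage setT zeta (@sigma_algebra_measurable _ R).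
    exact: (@measurableI _ (g_sigma_algebra_preimageType zeta)).
  exists (C `&` C'); last by rewrite setIACA.
  exact: (@measurableI _ (g_sigma_algebraType _)).
(* Independence of [B'] says that [P] restricted to [B'] and [P] scaled by [P B'] are the same
   measure; both have total mass [P B']. On [L], the event of [zeta] splits off because [C] and [B']
   both belong to [W], and then [B'] splits off from the past event [C]. *)
pose k : {nonneg R} := NngNum (fine_ge0 (measure_ge0 P B')).
have kE : (k%:num)%:E = P B' by rewrite /= fineK// fin_num_measure.
have LA : L `<=` agree (mrestr P mB) (mscale k P) id id.
  move=> _ [A zA [C HC <-]].
  have mC : measurable C by apply: (filtration_sub hF s0); exact: HF.
  have mA := preimage_sigma_sub mzeta zA.
  have mAC := measurableI _ _ mA mC.
  split; rewrite ?preimage_id//= /mrestr /mscale kE.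
  have [_ _ _ indW _] := hW.
  suff : P (A `&` C `&` B') = (P B' * P (A `&` C))%E by [].
  rewrite -setIA (hind zA); last first.
    exact: (@measurableI _ (g_sigma_algebraType _) _ _ (HW _ HC) BW).
  rewrite (hind zA (HW _ HC)) setIC (indW _ _ s0 st B' C).
  - by rewrite muleCA muleA.
  - by exists D => //; rewrite setTI.
  - exact: HF.
have [|||_ _] := @agree_sigma _ _ _ _ _ _ (mrestr P mB) (mscale k P) id id L _ _ LI LA E.
- rewrite /= /mrestr setTI.
  by rewrite (@le_lt_trans _ _ 1%E) ?probability_le1 ?ltry.
- rewrite /= /mrestr /mscale setTI kE.
  suff : P B' = (P B' * P setT)%E by [].
  by rewrite probability_setT mule1.
- move: E GE; apply: smallest_sub; first exact: smallest_sigma_algebra.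
  move=> A [zA|[r]].
    apply: sub_sigma_algebra; exists A => //; exists setT; last exact: setIT.
    exact: (@measurableT _ (g_sigma_algebraType _)).
  rewrite /= in_itv/= => rs WA.
  apply: sub_sigma_algebra; exists setT; first by exists setT; rewrite ?preimage_setT ?setIT.
  exists A; last exact: setTI.
  by apply: sub_sigma_algebra; exists r; rewrite /= ?in_itv.
- by rewrite setIC /= /mrestr /mscale kE.
Qed.

Lemma generated_filtration_brownian : brownian_motion P G W.
Proof.
have [_ cW W0 _ lW] := hW; split => //.
- by move=> t t0; apply: sub_W; rewrite t0 lexx.
- exact: generated_filtration_indep.
Qed.

End generated_filtration.

(** * Laws on path space *)

Lemma rat_between (R : realType) (x y : R) : x < y -> exists q : rat, x < ratr q < y.
Proof. by move=> /rat_in_itvoo[q]; rewrite in_itv; exists q. Qed.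

Section path_space_topology.
Context (R : realType).
Local Notation halfline := (@halfline R).
Local Notation code := (rat * rat * (rat * rat))%type.

Definition box (c : code) (g : halfline -> R) := forall t : halfline,
  ratr c.1.1 <= set_val t <= ratr c.1.2 -> ratr c.2.1 <= g t <= ratr c.2.2.

Definition boxes (s : seq code) (g : halfline -> R) := forall c, c \in s -> box c g.

(* Otherwise some [g n] outside [O] lies in the first [n] rational boxes that
   contain [f]; by compactness such a sequence converges to [f] in the compact-open
   topology. *)
Lemma open_boxes (O : set {compact-open, halfline -> R}) (f : halfline -> R) :
  open O -> continuous f -> O f -> exists2 s, boxes s f & boxes s `<=` O.
Proof.
move=> oO cf Of; apply: contrapT => nO.
have nO' s : boxes s f -> exists g, boxes s g /\ ~ O g.
  move=> sf; apply: contrapT => h; apply: nO; exists s => // g sg.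
  by apply: contrapT => nOg; apply: h; exists g.
pose L n := [seq c <- pmap (@unpickle code) (iota 0 n) | `[<box c f>]].
have Lf n : boxes (L n) f by move=> c; rewrite mem_filter => /andP[/asboolP].
have /choice[g gP] : forall n, exists g, boxes (L n) g /\ ~ O g by move=> n; exact: nO'.
have gbox c : box c f -> \forall n \near \oo, box c (g n).
  move=> cf'; near=> n; apply: (gP n).1; rewrite mem_filter asboolT//= mem_pmap.
  apply/mapP; exists (pickle c); last by rewrite pickleK.
  by rewrite mem_iota/=; near: n; exact: nbhs_infty_gt.
suff gf : (g : nat -> {compact-open, halfline -> R}) @ \oo --> (f : {compact-open, halfline -> R}).
  have : nbhs (f : {compact-open, halfline -> R}) O by exact: open_nbhs_nbhs.
  by move=> /gf[N _ /(_ N (leqnn N))]; exact: (gP N).2.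
apply/compact_open_cvgP => K D /compact_near_coveringP cK oD fKD.
suff : \forall n \near \oo, K `<=` [set x | D (g n x)].
  by apply: filterS => n KD _ [x Kx <-]; exact: KD.
(* Compactness in its near-covering form: it suffices to treat a neighbourhood of each [x] in [K],
   where one rational box around the graph of [f] lies within [e] of [f x]. *)
apply: (cK nat \oo (fun n x => D (g n x)) _) => x Kx.
have /nbhs_ballP[e /= e0 De] : nbhs (f x) D.
  by apply: open_nbhs_nbhs; split => //; apply: fKD; exists x.
have [p /andP[p1 p2]] : exists p : rat, f x - e < ratr p < f x.
  by apply: rat_between; lra.
have [q /andP[q1 q2]] : exists q : rat, f x < ratr q < f x + e.
  by apply: rat_between; lra.
have fx : \forall y \near x, ratr p < f y < ratr q.
  have : \forall y \near f x, ratr p < y < ratr q.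
    have := @near_in_itvoo R (ratr p) (ratr q) (f x); rewrite in_itv/= p2 q1 => /(_ isT).
    by apply: filterS => y; rewrite in_itv.
  exact: cf.
case: fx => _ [[V oV <-] /= Vx VP].
have /nbhs_ballP[r /= r0 rV] : nbhs (set_val x) V by exact: open_nbhs_nbhs.
have [a /andP[a1 a2]] : exists a : rat, set_val x - r < ratr a < set_val x.
  by apply: rat_between; lra.
have [b /andP[b1 b2]] : exists b : rat, set_val x < ratr b < set_val x + r.
  by apply: rat_between; lra.
have bf : box (a, b, (p, q)) f.
  move=> t /= tab; have /VP/andP[h1 h2] : V (set_val t).
    by apply: rV; rewrite -ball_normE /= ltr_norml; apply/andP; split; lra.
  by rewrite !ltW.
have gb := gbox _ bf.
have xab : \forall y \near x, ratr a < set_val y < ratr b.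
  have : \forall y \near set_val x, ratr a < y < ratr b.
    have := @near_in_itvoo R (ratr a) (ratr b) (set_val x); rewrite in_itv/= a2 b1 => /(_ isT).
    by apply: filterS => y; rewrite in_itv.
  exact: (@initial_continuous halfline R set_val).
near=> y n => /=; apply: De; rewrite -ball_normE /=.
have yab : ratr a < set_val y < ratr b by near: y.
have : box (a, b, (p, q)) (g n) by near: n.
move=> /(_ y) /=; case/andP: yab => y1 y2; rewrite (ltW y1) (ltW y2) => /(_ isT).
by move=> /andP[h1 h2]; rewrite ltr_norml; apply/andP; split; lra.
Unshelve. all: by end_near. Qed.

Section measurability.
Context d (T : measurableType d) (X : R -> T -> R).
Hypothesis cX : continuous_paths X.

Let cpath w : continuous (fun t : halfline => X (set_val t) w).
Proof. by have /subspace_sigL_continuousP := @cX w. Qed.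

Definition path_of w : path_space R := mkcts (@cpath w).

Lemma path_preimageE A : path_preimage X A = path_of @^-1` A.
Proof.
apply/seteqP; split => w /=.
  by move=> [f Af fX]; rewrite (_ : path_of w = f)//; apply/continuousEP.
by move=> Aw; exists (path_of w).
Qed.

Let S := \bigcup_(s in `[0, +oo[) g_sigma_algebra_preimage (X s).

Let mX s : 0 <= s -> smeas S (X s).
Proof.
move=> s0 _ D mD; apply: sub_sigma_algebra; exists s; rewrite /= ?in_itv/= ?s0//.
by exists D.
Qed.

Lemma box_event c : <<s S >> [set w | box c (path_of w)].
Proof.
(* A time window may begin before 0; only its part from [a] on contains times of a path, and the box
   condition is vacuous if that part is empty. *)
pose a : R := Num.max 0 (ratr c.1.1); pose b : R := ratr c.1.2.
have a0 : 0 <= a by rewrite le_max lexx.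
have [ab|ba] := leP a b; last first.
  rewrite (_ : [set _ | _] = setT); first exact: (@measurableT _ (g_sigma_algebraType S)).
  apply/seteqP; split => // w _ t /andP[h1 h2]; exfalso.
  have /set_mem := valP t; rewrite /halfline /= in_itv/= andbT => t0.
  by move: ba; rewrite ltNge => /negP; apply; rewrite ge_max (le_trans h1) ?(le_trans t0).
have -> : [set w | box c (path_of w)] = \bigcap_i \bigcap_j
    (X (dense_pt a b i j) @^-1` `[ratr c.2.1, ratr c.2.2]).
  apply/seteqP; split => w.
    move=> cw i _ j _ /=; have /andP[h1 h2] := dense_pt_itv i j ab.
    have h0 : halfline (dense_pt a b i j) by rewrite /halfline /= in_itv/= andbT (le_trans a0).
    have := cw (SigSub (mem_set h0)); rewrite in_itv; apply.
    by rewrite h2 andbT; apply: le_trans h1; rewrite le_max lexx orbT.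
  move=> cw t /andP[h1 h2].
  have /set_mem := valP t; rewrite /halfline /= in_itv/= andbT => t0.
  have tab : a <= set_val t <= b by rewrite h2 andbT ge_max t0.
  apply/andP; split.
    apply: (dense_ge (f := X ^~ w) (@cX w) a0 _ tab) => i j.
    by have := cw i Logic.I j Logic.I; rewrite /= in_itv => /andP[].
  rewrite -lerN2.
  apply: (dense_ge (f := fun s => - X s w) _ a0 _ tab) => [|i j].
    by move=> s; apply: cvgN; exact: cX.
  by rewrite lerN2; have := cw i Logic.I j Logic.I; rewrite /= in_itv => /andP[].
apply: (@bigcap_measurable _ (g_sigma_algebraType S)) => // i _.
apply: (@bigcap_measurable _ (g_sigma_algebraType S)) => // j _.
have /andP[h1 _] := dense_pt_itv i j ab.
have := mX (le_trans a0 h1) measurableT (measurable_itv `[ratr c.2.1, ratr c.2.2]).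
by rewrite setTI.
Qed.

Lemma boxes_event s : <<s S >> [set w | boxes s (path_of w)].
Proof.
rewrite (_ : [set _ | _] = \bigcap_(c in [set` s]) [set w | box c (path_of w)]).
  apply: (@fin_bigcap_measurable _ (g_sigma_algebraType S)) => // c _; exact: box_event.
by apply/seteqP; split => w sw c; exact: sw.
Qed.

(** By [open_boxes], an open set of paths is the union of those finite intersections of rational
    boxes that it contains. There are countably many, and each is decided by countably many values
    of the process. *)
Lemma path_event A : path_borel A -> <<s S >> (path_preimage X A).
Proof.
pose E := [set A : set (path_space R) | <<s S >> (path_preimage X A)].
suff sE : @path_borel R `<=` E by exact: sE.
apply: smallest_sub.
  split; rewrite /E /=.
  - rewrite path_preimageE preimage_set0; exact: (@measurable0 _ (g_sigma_algebraType S)).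
  - move=> B; rewrite !path_preimageE setTD preimage_setC.
    exact: (@measurableC _ (g_sigma_algebraType S)).
  - move=> B mB; rewrite path_preimageE preimage_bigcup.
    apply: (@bigcup_measurable _ (g_sigma_algebraType S)) => n _.
    by have := mB n; rewrite path_preimageE.
move=> _ [D oD <-]; rewrite /E /= path_preimageE setTI.
have -> : path_of @^-1` ((fun f : path_space R => (f : {compact-open, halfline -> R})) @^-1` D) =
    \bigcup_(s in [set s | boxes s `<=` D]) [set w | boxes s (path_of w)].
  apply/seteqP; split => w /=.
    by move=> Dw; have [s sw sD] := open_boxes oD (@cpath w) Dw; exists s.
  by move=> [s sD sw]; exact: sD.
rewrite bigcup_mkcond; apply: (@countable_bigcupT_measurable _ (g_sigma_algebraType S)) => // s.
by case: ifP => _; [exact: boxes_event|exact: (@measurable0 _ (g_sigma_algebraType S))].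
Qed.

End measurability.
End path_space_topology.

(* Two probability spaces are compared on their disjoint sum: an event [E] of the
   sum is a pair of events, and a functional of glued processes restricts to the
   same functional on each side. *)
HB.instance Definition _ (T T' : pointedType) := isPointed.Build (T + T')%type (inl point).

Definition glue (T T' A : Type) (f : T -> A) (g : T' -> A) (u : T + T') : A :=
  match u with inl w => f w | inr w => g w end.

Lemma sigma_algebra_comap (T U : Type) (i : T -> U) (S : set (set T)) :
  sigma_algebra setT S -> sigma_algebra setT [set E | S (i @^-1` E)].
Proof.
move=> [S0 SC SU]; split => /=.
- by rewrite preimage_set0.
- by move=> A SA; rewrite setTD preimage_setC -setTD; exact: SC.
- by move=> A SA; rewrite preimage_bigcup; exact: SU.
Qed.

Lemma smeas_sub (T : pointedType) (R : realType) (S : set (set T)) (f : T -> R) :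
  smeas S f -> g_sigma_algebra_preimage f `<=` <<s S >>.
Proof. by move=> mf _ [D mD <-]; exact: mf. Qed.

(** * The joint law of the initial value and the driving motion *)

Section joint_law.
Context d (T : measurableType d) d' (T' : measurableType d') (R : realType).
Variables (P : probability T R) (F : R -> set (set T)) (W : R -> T -> R) (zeta : T -> R).
Variables (P' : probability T' R) (F' : R -> set (set T')) (B : R -> T' -> R) (eta : T' -> R).
Hypotheses (hF : filtration F) (hW : brownian_motion P F W) (szeta : smeas (F 0) zeta).
Hypotheses (hF' : filtration F') (hB : brownian_motion P' F' B) (seta : smeas (F' 0) eta).
Hypothesis same : forall D, measurable D -> P (zeta @^-1` D) = P' (eta @^-1` D).

Local Notation U := (T + T')%type.
Let xi : U -> R := glue zeta eta.
Let V s : U -> R := glue (W s \- W 0) (B s \- B 0).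

(** The invariant for adding times in increasing order. Membership in [F y] and [F' y] is what makes
    the next increment independent of [E] on each side; measurability of [V y] allows the next value
    to be recovered from that increment. *)
Definition agree_upto y (S : set (set U)) := [/\ 0 <= y, smeas S (V y) &
  forall E, <<s S >> E -> [/\ F y (inl @^-1` E), F' y (inr @^-1` E) & agree P P' inl inr E]].

Let Vl x : 0 <= x -> smeas (F x) (W x \- W 0).
Proof.
move=> x0; apply: measurable_funB; first exact: (brownian_smeas hF hW).
exact: (filtration_smeas hF (lexx 0) x0 (brownian_smeas hF hW (lexx 0))).
Qed.

Let Vr x : 0 <= x -> smeas (F' x) (B x \- B 0).
Proof.
move=> x0; apply: measurable_funB; first exact: (brownian_smeas hF' hB).
exact: (filtration_smeas hF' (lexx 0) x0 (brownian_smeas hF' hB (lexx 0))).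
Qed.

Lemma agree_upto0 : agree_upto 0 (g_sigma_algebra_preimage xi).
Proof.
have s0 : sigma_algebra setT (g_sigma_algebra_preimage xi).
  exact: (sigma_algebra_preimage setT xi (@sigma_algebra_measurable _ _)).
split => //.
  rewrite (_ : V 0 = cst 0); first exact: measurable_cst.
  by apply/funext => -[] w /=; rewrite subrr.
move=> E; rewrite sigma_algebra_id// => -[D mD <-]; rewrite setTI.
have zl : F 0 (zeta @^-1` D).
  by move/(smeasP _ (filtration_sigma hF (lexx 0))) : szeta; apply; exists D; rewrite ?setTI.
have zr : F' 0 (eta @^-1` D).
  by move/(smeasP _ (filtration_sigma hF' (lexx 0))) : seta; apply; exists D; rewrite ?setTI.
split => //; split; first exact: (filtration_sub hF (lexx 0)).
  exact: (filtration_sub hF' (lexx 0)).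
exact: same.
Qed.

(** As [V x] is [V y] plus an increment [D], intersections of old events with events of [D] form a
    pi-system that generates the new information. On both sides such an intersection has the
    probability of the old event times the same normal probability. *)
Lemma agree_upto_step y x S : agree_upto y S -> y <= x ->
  agree_upto x (S `|` g_sigma_algebra_preimage (V x)).
Proof.
move=> [y0 SV SE]; have subS : S `<=` <<s S `|` g_sigma_algebra_preimage (V x) >>.
  by move=> A SA; apply: sub_sigma_algebra; left.
rewrite le_eqVlt => /predU1P[yx|yx].
  rewrite -yx; split => //.
    by apply: sub_smeas SV; rewrite yx.
  move=> E h; apply: SE; move: E h; apply: smallest_sub; first exact: smallest_sigma_algebra.
  move=> A [|]; [exact: sub_sigma_algebra|exact: smeas_sub].
have x0 := le_trans y0 (ltW yx).
have sVx : smeas (S `|` g_sigma_algebra_preimage (V x)) (V x).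
  by move=> _ D mD; apply: sub_sigma_algebra; right; exists D.
split => // E SxE.
have Fx : F x (inl @^-1` E) /\ F' x (inr @^-1` E).
  have [_ Fyx] := hF; have [_ Fyx'] := hF'.
  split; move: E SxE.
    apply: smallest_sub; first exact: (sigma_algebra_comap _ (filtration_sigma hF x0)).
    move=> A [SA|[D mD <-]].
      have /SE[h _ _] : <<s S >> A by exact: sub_sigma_algebra.
      exact: (Fyx _ _ y0 (ltW yx)).
    move/(smeasP _ (filtration_sigma hF x0)) : (Vl x0); apply.
    by exists D => //; rewrite !setTI.
  apply: smallest_sub; first exact: (sigma_algebra_comap _ (filtration_sigma hF' x0)).
  move=> A [SA|[D mD <-]].
    have /SE[_ h _] : <<s S >> A by exact: sub_sigma_algebra.
    exact: (Fyx' _ _ y0 (ltW yx)).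
  move/(smeasP _ (filtration_sigma hF' x0)) : (Vr x0); apply.
  by exists D => //; rewrite !setTI.
have [Fl Fr] := Fx; split => //.
pose D : U -> R := glue (W x \- W y) (B x \- B y).
pose L := [set A `&` C | A in <<s S >> & C in g_sigma_algebra_preimage D].
have LI : setI_closed L.
  move=> _ _ [A SA [C DC <-]] [A' SA' [C' DC' <-]].
  exists (A `&` A'); first exact: (@measurableI _ (g_sigma_algebraType S)).
  exists (C `&` C'); last by rewrite setIACA.
  exact: (@measurableI _ (g_sigma_algebra_preimageType D)).
have SL : <<s S >> `<=` <<s L >>.
  move=> A SA; apply: sub_sigma_algebra; exists A => //; exists setT; last exact: setIT.
  by exists setT; rewrite ?preimage_setT ?setIT.
have LD : smeas L D.
  move=> _ C mC; apply: sub_sigma_algebra; exists setT; first exact: (@measurableT _ (g_sigma_algebraType S)).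
  by exists (D @^-1` C); [exists C; rewrite ?setTI|].
have LV : smeas L (V x).
  rewrite (_ : V x = V y \+ D); last by apply/funext => -[] w /=; ring.
  by apply: measurable_funD => //; exact: (sub_smeas (subset_trans (@sub_sigma_algebra _ setT S) SL) SV).
have SxL : <<s S `|` g_sigma_algebra_preimage (V x) >> `<=` <<s L >>.
  apply: smallest_sub; first exact: smallest_sigma_algebra.
  move=> A [SA|]; last exact: smeas_sub.
  by apply: SL; exact: sub_sigma_algebra.
have fT : (P setT < +oo)%E by rewrite probability_setT ltry.
have PT : P setT = P' setT by rewrite !probability_setT.
apply: (agree_sigma fT PT LI _ (SxL _ SxE)) => _ [A SA [_ [C mC <-] <-]].
have [Al Ar [mAl mAr Aa]] := SE _ SA.
have mWC := increment_measurable hF hW y0 (ltW yx) measurableT mC.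
have mBC := increment_measurable hF' hB y0 (ltW yx) measurableT mC.
rewrite setTI in mWC; rewrite setTI in mBC.
have [_ _ _ indW lawW] := hW; have [_ _ _ indB lawB] := hB.
rewrite setTI; split; [exact: (measurableI _ _ mAl mWC)|exact: (measurableI _ _ mAr mBC)|].
transitivity (P (inl @^-1` A) * normal_prob 0 (Num.sqrt (x - y)) C)%E.
  rewrite -(lawW _ _ y0 yx _ mC) muleC.
  rewrite -(indW _ _ y0 yx _ _ _ Al); first by rewrite setIC.
  by exists C => //; rewrite setTI.
rewrite Aa -(lawB _ _ y0 yx _ mC) muleC.
rewrite -(indB _ _ y0 yx _ _ _ Ar); first by rewrite setIC.
by exists C => //; rewrite setTI.
Qed.

Lemma agree_upto_path l : forall y S, agree_upto y S -> path <=%R y l ->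
  agree_upto (last y l) (S `|` \bigcup_(t in [set` l]) g_sigma_algebra_preimage (V t)).
Proof.
elim: l => [|x l ih] y S yS /=.
  by move=> _; rewrite set_nil bigcup_set0 setU0.
move=> /andP[yx xl]; have -> : [set` x :: l] = x |` [set` l].
  by apply/seteqP; split => t /=; rewrite in_cons; [move=> /predU1P|move=> h; apply/predU1P].
rewrite bigcup_setU1 setUA.
exact: (ih _ _ (agree_upto_step yS yx) xl).
Qed.

Definition joint_events := <<s g_sigma_algebra_preimage xi `|`
  \bigcup_(t in `[0, +oo[) g_sigma_algebra_preimage (V t) >>.

(** Events that depend on finitely many times form a pi-system generating all joint events; sorting
    the times reduces each of them to the step-by-step construction. *)
Lemma joint_agree : joint_events `<=` agree P P' inl inr.
Proof.
pose gen (l : seq R) := g_sigma_algebra_preimage xi `|`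
  \bigcup_(t in [set` l]) g_sigma_algebra_preimage (V t).
pose K := [set E | exists2 l : seq R, all (>= 0) l & <<s gen l >> E].
have gen_sub l l' : {subset l <= l'} -> <<s gen l >> `<=` <<s gen l' >>.
  move=> ll'; apply: smallest_sub; first exact: smallest_sigma_algebra.
  move=> A [xA|[t tl VA]]; apply: sub_sigma_algebra; first by left.
  by right; exists t => //; exact: ll'.
have KI : setI_closed K.
  move=> A A' [l l0 lA] [l' l0' lA']; exists (l ++ l'); first by rewrite all_cat l0.
  apply: (@measurableI _ (g_sigma_algebraType (gen (l ++ l')))).
    by apply: gen_sub lA => t; rewrite mem_cat => ->.
  by apply: gen_sub lA' => t; rewrite mem_cat orbC => ->.
have KA : K `<=` agree P P' inl inr.
  move=> E [l l0 lE].
  have pl : path <=%R 0 (sort <=%R l).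
    by rewrite path_sortedE ?all_sort ?sort_le_sorted ?l0//; exact: le_trans.
  have [_ _ h] := agree_upto_path agree_upto0 pl.
  suff /h[_ _ //] : <<s gen (sort <=%R l) >> E.
  by apply: gen_sub lE => t; rewrite mem_sort.
have fT : (P setT < +oo)%E by rewrite probability_setT ltry.
have PT : P setT = P' setT by rewrite !probability_setT.
move=> E jE; apply: (agree_sigma fT PT KI KA).
move: E jE; apply: smallest_sub; first exact: smallest_sigma_algebra.
move=> A [xA|[t]].
  by apply: sub_sigma_algebra; exists [::] => //; apply: sub_sigma_algebra; left.
rewrite /= in_itv/= andbT => t0 VA; apply: sub_sigma_algebra.
exists [:: t]; first by rewrite /= t0.
by apply: sub_sigma_algebra; right; exists t => //=; rewrite mem_head.
Qed.

Variable lambda : R.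

Let M := g_sigma_algebraType (g_sigma_algebra_preimage xi `|`
  \bigcup_(t in `[0, +oo[) g_sigma_algebra_preimage (V t)).

Let cV : @continuous_paths _ M R V.
Proof.
have [_ cW _ _ _] := hW; have [_ cB _ _ _] := hB.
by case=> w s; apply: cvgB; [exact: cW|exact: cvg_cst|exact: cB|exact: cvg_cst].
Qed.

(** For this constant filtration, adaptedness of the glued solution means that its values are
    determined by the joint events, which is all that the comparison of laws requires. *)
Let hJ : @filtration _ M R (fun=> joint_events).
Proof.
by split=> [t t0|s t _ _ A //]; split; [exact: smallest_sigma_algebra|].
Qed.

Let sV u : 0 <= u -> smeas joint_events (V u).
Proof.
move=> u0 _ D mD; do 2 apply: sub_sigma_algebra; right.
by exists u; rewrite /= ?in_itv/= ?u0//; exists D.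
Qed.

Let sxi : smeas joint_events xi.
Proof. by move=> _ D mD; do 2 apply: sub_sigma_algebra; left; exists D. Qed.

Let X : R -> M -> R := @solution _ M R V lambda xi.

Let cX : @continuous_paths _ M R X.
Proof. exact: solution_continuous. Qed.

Lemma solution_path_agree (A : set (path_space R)) : path_borel A ->
  agree P P' inl inr (path_preimage X A).
Proof.
move=> /(path_event cX) XA; apply: joint_agree.
move: (path_preimage _ _) XA; apply: smallest_sub; first exact: smallest_sigma_algebra.
move=> C [t]; rewrite /= in_itv/= andbT => t0.
have h := @solution_adapted _ M R _ _ hJ cV sV lambda _ sxi; exact: (h _ t0).
Qed.

Lemma solution_law (A : set (path_space R)) : path_borel A ->
  [/\ measurable (path_preimage (solution W lambda zeta) A),
      measurable (path_preimage (solution B lambda eta) A) &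
      P (path_preimage (solution W lambda zeta) A) =
      P' (path_preimage (solution B lambda eta) A)].
Proof.
move=> /solution_path_agree[].
have Xl t w : X t (inl w) = solution W lambda zeta t w.
  rewrite /X /solution /=; congr sol_path; apply/funext => s.
  by rewrite subrr subr0.
have Xr t w : X t (inr w) = solution B lambda eta t w.
  rewrite /X /solution /=; congr sol_path; apply/funext => s.
  by rewrite subrr subr0.
have -> : inl @^-1` path_preimage X A = path_preimage (solution W lambda zeta) A.
  by apply/seteqP; split => w [f Af fX]; exists f => // t; rewrite fX Xl.
have -> // : inr @^-1` path_preimage X A = path_preimage (solution B lambda eta) A.
by apply/seteqP; split => w [f Af fX]; exists f => // t; rewrite fX Xr.
Qed.

End joint_law.

Lemma probability_ae_eq d (T : measurableType d) (R : realType) (P : probability T R)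
    (A A' : set T) : measurable A -> measurable A' ->
  {ae P, forall w, A w <-> A' w} -> P A = P A'.
Proof.
move=> mA mA' AA'.
rewrite -(setIT A) -(setIT A') -!integral_indic//.
apply: ae_eq_integral => //; [exact/measurable_EFinP..|].
apply: filterS AA' => w AA' _ /=; congr (_%:E).
by rewrite !indicE; congr (_%:R); congr nat_of_bool; apply/idP/idP; rewrite !inE => /AA'.
Qed.

Theorem theorem1 (R : realType) (lambda : R) (hlambda : lambda < 0)
  (d : measure_display) (T : measurableType d) (P : probability T R)
  (F : R -> set (set T)) (hF : filtration F)
  (W : R -> T -> R) (hW : brownian_motion P F W)
  (zeta : {RV P >-> R})
  (hind : independent P (g_sigma_algebra_preimage zeta) (sigma_process W)) :
  exists X : R -> T -> R,
    [/\ sde_solution P (generated_filtration zeta W) lambda zeta W X,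
        (forall w, X 0 w = zeta w),
        (forall X' : R -> T -> R,
           sde_solution P (generated_filtration zeta W) lambda zeta W X' ->
           indistinguishable P X' X) &
        (forall (d' : measure_display) (T' : measurableType d')
           (P' : probability T' R) (F' : R -> set (set T'))
           (Y B : R -> T' -> R),
           weak_solution P' F' lambda (distribution P zeta) Y B ->
           same_path_law P' P Y X)].
Proof.
have mzeta : measurable_fun setT zeta by [].
have hG := generated_filtration_filtration hF hW mzeta.
have hGW := generated_filtration_brownian hF hW mzeta hind.
have sz := @generated_filtration_smeas _ _ _ W zeta _ (lexx (0 : R)).
have [_ cW _ _ _] := hW.
exists (solution W lambda zeta); split.
- by apply: solution_sde => // u u0; exact: (brownian_smeas hG hGW).
- exact: solution0.
- by move=> X' /(sde_solution_sol_path hG hGW hlambda).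
move=> d' T' P' F' Y B [hF' hB sY initY] A bA.
have [aY cY _] := sY.
have sY0 : smeas (F' 0) (Y 0).
  by apply/smeasP; [exact: (filtration_sigma hF' (lexx 0))|exact: (aY _ (lexx 0))].
have same D : measurable D -> P (zeta @^-1` D) = P' (Y 0 @^-1` D).
  by move=> mD; rewrite initY.
(* The law of [X] is replaced by that of the explicit solution on the other space, driven by [B] and
   started from [Y 0]; the weak solution [Y] coincides with the latter almost surely. *)
have [_ mX' ->] := solution_law hG hGW sz hF' hB sY0 same lambda bA.
apply: probability_ae_eq => //.
  have := path_event cY bA; move: (path_preimage _ _); apply: smallest_sub.
    exact: sigma_algebra_measurable.
  move=> C [t]; rewrite /= in_itv/= andbT => t0 /(aY _ t0).
  exact: (filtration_sub hF' t0).
apply: filterS (sde_solution_sol_path hF' hB hlambda sY) => w YX.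
have YX' (t : @halfline R) : Y (set_val t) w = solution B lambda (Y 0) (set_val t) w.
  by apply: YX; have /set_mem := valP t; rewrite /halfline /= in_itv/= andbT.
by split=> -[f Af fX]; exists f => // t; rewrite fX YX'.
Qed.
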